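(* Let $n\ge 2$ agents communicate over an undirected connected weighted graph with Laplacian $L$. Let $f_1,\dots,f_n:\mathbb{R}^d\to\mathbb{R}$ be differentiable with $\|\nabla f_i(x)-\nabla f_i(y)\|\le L_f\|x-y\|$ for all $x,y\in\mathbb{R}^d$, $i\in[n]$, where $L_f>0$. Let $f=\frac1n\sum_{i=1}^n f_i$, assume that $f^*=\min_{x\in\mathbb{R}^d}f(x)$ is finite, and assume that $f$ satisfies the Polyak–Łojasiewicz condition with constant $\nu>0$: $\frac12\|\nabla f(x)\|^2\ge\nu(f(x)-f^* )$ for all $x\in\mathbb{R}^d$. Let $\mathcal{C}:\mathbb{R}^d\to\mathbb{R}^d$ be a (possibly random) compressor such that, for some constants $\varphi\in(0,1]$ and $r>0$, $\mathbf{E}_{\mathcal C}\big[\|\mathcal{C}(x)/r-x\|^2\big]\le(1-\varphi)\|x\|^2$ for all $x\in\mathbb{R}^d$. Let $\{x_{i,k}\}$ be generated by Algorithm 2 (see context) with $\alpha=\kappa_1\beta$, $\beta>\kappa_2$, $\eta\in(0,\check\kappa_3)$, $\sigma\in(0,\kappa_0)$ and $\psi\in(0,1/r]$, where $\kappa_0,\kappa_1,\kappa_2,\check\kappa_3$ are the positive constants defined in the context. Let $\bar x_k=\frac1n\sum_{i=1}^n x_{i,k}$. Then the constant $\check\epsilon$ defined in the context lies in $(0,1)$ and, for any $k\in\mathbb{N}_0$, $$\sum_{i=1}^{n}\mathbf{E}_{\mathcal{C}}\big[\|x_{i,k}-\bar{x}_k\|^2+f(\bar{x}_k)-f^*\big]=\mathcal{O}((1-\check\epsilon)^{k}),$$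 i.e. the left side is at most a constant independent of $k$ times $(1-\check\epsilon)^k$.
   Context: Notation: $\mathbb{N}_0$ is the set of nonnegative integers, $[n]=\{1,\dots,n\}$, $\|\cdot\|$ is the Euclidean norm. The graph has symmetric weighted adjacency matrix $A=(a_{ij})$, $a_{ij}\ge0$, $a_{ii}=0$; $(i,j)$ is an edge iff $a_{ij}>0$; $L=(L_{ij})=\mathrm{diag}(\sum_j a_{1j},\dots,\sum_j a_{nj})-A$. $\rho(L)$ is the spectral radius of $L$ and $\rho_2(L)$ its smallest positive eigenvalue. $\mathbf{E}_{\mathcal C}$ is expectation over the internal randomness of the compressor; each application of $\mathcal C$ uses fresh randomness, so the compressor inequality holds conditionally on the past. Algorithm 2 (error feedback): positive parameters $\alpha,\beta,\eta,\psi,\sigma$. Initialize with arbitrary (deterministic) $x_{i,0}\in\mathbb{R}^d$, $a_{i,0}=b_{i,0}=e_{i,0}=v_{i,0}=\mathbf 0_d$, $q_{i,0}=\hat q_{i,0}=\mathcal C(x_{i,0})$. For $k=0,1,\dots$ and all $i\in[n]$: $a_{i,k+1}=a_{i,k}+\psi q_{i,k}$; $b_{i,k+1}=b_{i,k}+\psi\big(q_{i,k}-\sum_{j=1}^nL_{ij}q_{j,k}\big)$; $x_{i,k+1}=x_{i,k}-\eta\alpha\big(a_{i,k}-b_{i,k}+\sum_{j=1}^nL_{ij}\hat q_{j,k}\big)-\eta(\beta v_{i,k}+\nabla f_i(x_{i,k}))$; $v_{i,k+1}=v_{i,k}+\eta\beta\big(a_{i,k}-b_{i,k}+\sum_{j=1}^nL_{ij}\hat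 q_{j,k}\big)$; $q_{i,k+1}=\mathcal C(x_{i,k+1}-a_{i,k+1})$; $e_{i,k+1}=\sigma e_{i,k}+x_{i,k}-a_{i,k}-\hat q_{i,k}$; $\hat q_{i,k+1}=\mathcal C(\sigma e_{i,k+1}+x_{i,k+1}-a_{i,k+1})$. Constants: $r_0=2r^2(1-\varphi)+2(1-r)^2$; $r_1>1$ is any constant, $r_2=\frac{r_1}{r_1-1}$; $\kappa_0=\frac{1}{\sqrt{r_0r_1}}$. $\kappa_4>0$ is any constant; $\kappa_1$ is any constant with $\kappa_1\ge\max\{\frac{9+\kappa_4}{2\rho_2(L)},1\}$; $\kappa_5=\max\{\frac{4+5L_f^2}{\kappa_4},\frac{6}{\rho_2(L)}\}$; $\kappa_6=\frac{8(\kappa_1+1)^2L_f^2}{\kappa_5\rho_2(L)}+\frac{4L_f^2}{\rho_2^2(L)}$; $\kappa_2=\max\{\kappa_5,\sqrt{\kappa_6}\}$. $\epsilon_1=\frac{\alpha}{2}\rho_2(L)-\frac14(9\beta+4+5L_f^2)$, $\epsilon_2=3L_f^2+\frac{4(2+\varphi\psi r)}{\varphi\psi r}(\alpha^2\rho^2(L)+L_f^2)+2\beta^2+1+3\alpha^2\rho^2(L)$, $\epsilon_3=\frac{\beta}{2}-3\rho_2^{-1}(L)$, $\epsilon_4=2\beta^2\rho(L)+\frac{4(2+\varphi\psi r)\beta^2\rho^2(L)}{\varphi\psi r}+\rho_2^{-1}(L)$, $\epsilon_5=\frac18-\frac{(\alpha+\beta)^2L_f^2}{\beta^5\rho_2(L)}-\frac{L_f^2}{2\beta^2\rho_2^2(L)}$,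 $\epsilon_6=\frac{(\alpha+\beta)L_f^2}{2\beta^3\rho_2(L)}+\frac{3L_f^2}{4}+\frac{L_f^2}{2\beta^2\rho_2^2(L)}+\frac{L_f}{2}$, $\epsilon_7=\frac{\varphi\psi r}{2}(1+\varphi\psi r)$, $\epsilon_8=\frac12(\alpha+2\beta)\rho(L)r_0+2\beta r_0$, $\epsilon_9=\frac{(8+7\varphi\psi r)\alpha^2\rho^2(L)r_0}{\varphi\psi r}+(2\beta^2+1)r_0$, $\check\epsilon_8=((\alpha+2\beta)\rho(L)+4\beta)(r_0r_1+1)\sigma^2$, $\check\epsilon_9=2(7\alpha^2\rho^2(L)+2\beta^2+1)(r_0r_1+1)\sigma^2$. $\tau_0$ is any constant in $(0,\frac{\epsilon_7}{r_0r_2})$; $\tau_1=\frac{\sqrt{r_2^2\epsilon_8^2+2r_2\epsilon_9(\epsilon_7-r_0r_2\tau_0)}-r_2\epsilon_8}{2r_2\epsilon_9}$; $\tau_2=\frac{\sqrt{\check\epsilon_8^2+4(1-r_0r_1\sigma^2)\tau_0\check\epsilon_9}-\check\epsilon_8}{2\check\epsilon_9}$; $\tau_3=\epsilon_7-r_0r_2\tau_0-2\eta r_2\epsilon_8-2\eta^2r_2\epsilon_9$; $\tau_4=(1-r_0r_1\sigma^2)\tau_0-\eta\check\epsilon_8-\eta^2\check\epsilon_9$; $\check\kappa_3=\min\{\frac{\epsilon_1}{\epsilon_2},\frac{\epsilon_3}{\epsilon_4},\frac{\epsilon_5}{\epsilon_6},\tau_1,\tau_2\}$. In the degenerate case $r_0=0$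 one reads $\kappa_0=\epsilon_7/(r_0r_2)=\tau_1=+\infty$. Finally $\check\epsilon=\check\epsilon_{12}/\epsilon_{11}$ with $\epsilon_{11}=\max\{\frac12+\frac{\alpha}{\beta},\frac{\alpha\rho_2(L)+\beta}{2\alpha\rho_2(L)}\}$ and $\check\epsilon_{12}=\eta\min\{\epsilon_1-\eta\epsilon_2,\ \epsilon_3-\eta\epsilon_4,\ \frac{\nu}{2},\ \frac{\tau_3}{\eta},\ \frac{\tau_4}{\eta\tau_0}\}$. *)

(* Defs.v *)
(* MathComp / MathComp-Analysis. *)
From HB Require Import structures.
From mathcomp Require Import all_boot all_order all_algebra.
From mathcomp Require Import all_classical all_reals all_analysis.

Set Implicit Arguments.
Unset Strict Implicit.
Unset Printing Implicit Defensive.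

Import Order.TTheory GRing.Theory Num.Theory.
Import numFieldNormedType.Exports.

Local Open Scope classical_set_scope.
Local Open Scope ring_scope.

(* The norm `|x| of the library on 'rV[R]_d is the sup norm. *)
Definition enorm (R : realType) (d : nat) (x : 'rV[R]_d) : R :=
  Num.sqrt (\sum_j x ord0 j ^+ 2).

Definition gradient (R : realType) (d : nat) (f : 'rV[R]_d -> R)
    (x : 'rV[R]_d) : 'rV[R]_d :=
  \row_j 'D_(delta_mx ord0 j) f x.

Definition average (R : realType) (n : nat) (V : lmodType R) (y : 'I_n -> V) : V :=
  n%:R^-1 *: \sum_i y i.

Definition avg_fun (R : realType) (n d : nat) (f : 'I_n -> 'rV[R]_d -> R) :
    'rV[R]_d -> R :=
  fun x => n%:R^-1 * \sum_i f i x.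

Definition lipschitz_gradient (R : realType) (d : nat) (Lf : R)
    (f : 'rV[R]_d -> R) : Prop :=
  forall x y, enorm (gradient f x - gradient f y) <= Lf * enorm (x - y).

Definition is_minimum (R : realType) (T : Type) (f : T -> R) (m : R) : Prop :=
  (exists x, f x = m) /\ (forall x, m <= f x).

Definition polyak_lojasiewicz (R : realType) (d : nat) (nu : R)
    (f : 'rV[R]_d -> R) (fstar : R) : Prop :=
  forall x, nu * (f x - fstar) <= 1 / 2 * enorm (gradient f x) ^+ 2.

Record weighted_graph (R : realType) (n : nat) (A : 'M[R]_n) : Prop := {
  wg_sym : forall i j, A i j = A j i ;
  wg_ge0 : forall i j, 0 <= A i j ;
  wg_diag0 : forall i, A i i = 0 }.

Definition graph_connected (R : realType) (n : nat) (A : 'M[R]_n) : Prop :=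
  forall i j, connect (fun i j : 'I_n => 0 < A i j) i j.

Definition laplacian (R : realType) (n : nat) (A : 'M[R]_n) : 'M[R]_n :=
  diag_mx (\row_i \sum_j A i j) - A.

(* Only used for symmetric matrices, all of whose eigenvalues are real. *)
Definition spectral_radius (R : realType) (n : nat) (L : 'M[R]_n) : R :=
  sup [set `|a| | a in [set a : R | eigenvalue L a]].

(* The set below is finite; it is nonempty for the Laplacian of a connected
   graph with at least two vertices. *)
Definition smallest_pos_eigenvalue (R : realType) (n : nat) (L : 'M[R]_n) : R :=
  inf [set a : R | eigenvalue L a /\ 0 < a].

Notation borel_rV R d := (g_sigma_algebraType (@open 'rV[R]_d)).

(* A random compressor is a jointly measurable map [C x z], where the seed [z]
   is drawn from [mu]; a deterministic compressor ignores [z]. *)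
Record compressor (R : realType) (d : nat) (dZ : measure_display)
    (Z : measurableType dZ) (mu : probability Z R) (phi r : R)
    (C : 'rV[R]_d -> Z -> 'rV[R]_d) : Prop := {
  comp_meas :
    measurable_fun setT (fun u : borel_rV R d * Z => C u.1 u.2 : borel_rV R d) ;
  comp_ineq : forall x : 'rV[R]_d,
    ('E_mu[fun z => (enorm (r^-1 *: C x z - x) ^+ 2)%R]
       <= ((1 - phi) * enorm x ^+ 2)%:E)%E }.

Definition mutually_independent (R : realType) (dO dZ : measure_display)
    (Omega : measurableType dO) (Z : measurableType dZ) (P : probability Omega R)
    (J : eqType) (xi : J -> Omega -> Z) : Prop :=
  forall (s : seq J) (B : J -> set Z), uniq s ->
    (forall j, measurable (B j)) ->
    P (\bigcap_(j in [set` s]) (xi j @^-1` B j)) =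
      (\prod_(j <- s) P (xi j @^-1` B j))%E.

(* Seeds are indexed by (iteration, agent, b), where b = false for the
   application of the compressor producing q and b = true for hat q. *)
Record fresh_seeds (R : realType) (n : nat) (dO dZ : measure_display)
    (Omega : measurableType dO) (Z : measurableType dZ) (P : probability Omega R)
    (mu : probability Z R) (xi : nat * 'I_n * bool -> Omega -> Z) : Prop := {
  seeds_meas : forall j, measurable_fun setT (xi j) ;
  seeds_law : forall j (B : set Z), measurable B -> P (xi j @^-1` B) = mu B ;
  seeds_indep : mutually_independent P xi }.

(* [alpha], ..., [sigma] are the parameters of the algorithm; [Lf], [nu], [phi],
   [r] are the constants of the assumptions; [r1], [kappa1], [kappa4], [tau0]
   are the free auxiliary constants. *)
Record params (R : realType) : Type := Params {
  par_alpha : R ; par_beta : R ; par_eta : R ; par_psi : R ; par_sigma : R ;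
  par_Lf : R ; par_nu : R ; par_phi : R ; par_r : R ;
  par_r1 : R ; par_kappa1 : R ; par_kappa4 : R ; par_tau0 : R }.

Section algorithm.
Variables (R : realType) (n d : nat) (Omega Z : Type).
Variables (p : params R) (L : 'M[R]_n) (f : 'I_n -> 'rV[R]_d -> R).
Variables (C : 'rV[R]_d -> Z -> 'rV[R]_d) (xi : nat * 'I_n * bool -> Omega -> Z).
Variable x0 : 'I_n -> 'rV[R]_d.
Variables a b x v q e qh : nat -> 'I_n -> Omega -> 'rV[R]_d.

Local Notation "'α'" := (par_alpha p).
Local Notation "'β'" := (par_beta p).
Local Notation "'η'" := (par_eta p).
Local Notation "'ψ'" := (par_psi p).
Local Notation "'σ'" := (par_sigma p).

(* q and hat q are initialized with the same realization of C(x_{i,0}). *)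
Record error_feedback : Prop := {
  ef_x0 : forall i w, x 0%N i w = x0 i ;
  ef_a0 : forall i w, a 0%N i w = 0 ;
  ef_b0 : forall i w, b 0%N i w = 0 ;
  ef_e0 : forall i w, e 0%N i w = 0 ;
  ef_v0 : forall i w, v 0%N i w = 0 ;
  ef_q0 : forall i w, q 0%N i w = C (x 0%N i w) (xi (0%N, i, false) w) ;
  ef_qh0 : forall i w, qh 0%N i w = q 0%N i w ;
  ef_a : forall k i w, a k.+1 i w = a k i w + ψ *: q k i w ;
  ef_b : forall k i w,
    b k.+1 i w = b k i w + ψ *: (q k i w - \sum_j L i j *: q k j w) ;
  ef_x : forall k i w,
    x k.+1 i w = x k i w
      - (η * α) *: (a k i w - b k i w + \sum_j L i j *: qh k j w)
      - η *: (β *: v k i w + gradient (f i) (x k i w)) ;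
  ef_v : forall k i w,
    v k.+1 i w = v k i w
      + (η * β) *: (a k i w - b k i w + \sum_j L i j *: qh k j w) ;
  ef_q : forall k i w,
    q k.+1 i w = C (x k.+1 i w - a k.+1 i w) (xi (k.+1, i, false) w) ;
  ef_e : forall k i w,
    e k.+1 i w = σ *: e k i w + x k i w - a k i w - qh k i w ;
  ef_qh : forall k i w,
    qh k.+1 i w = C (σ *: e k.+1 i w + x k.+1 i w - a k.+1 i w)
                    (xi (k.+1, i, true) w) }.

End algorithm.

Section constants.
Variables (R : realType) (n : nat) (p : params R) (L : 'M[R]_n).

Local Notation "'α'" := (par_alpha p).
Local Notation "'β'" := (par_beta p).
Local Notation "'η'" := (par_eta p).
Local Notation "'ψ'" := (par_psi p).
Local Notation "'σ'" := (par_sigma p).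
Local Notation "'φ'" := (par_phi p).
Local Notation "'ν'" := (par_nu p).
Local Notation Lf := (par_Lf p).
Local Notation r := (par_r p).
Local Notation r1 := (par_r1 p).
Local Notation κ1 := (par_kappa1 p).
Local Notation κ4 := (par_kappa4 p).
Local Notation τ0 := (par_tau0 p).
Local Notation ρ := (spectral_radius L).
Local Notation ρ2 := (smallest_pos_eigenvalue L).

Definition r0 : R := 2 * r ^+ 2 * (1 - φ) + 2 * (1 - r) ^+ 2.
Definition r2 : R := r1 / (r1 - 1).

(* r0 = 0 (i.e. φ = r = 1) is allowed, hence the extended real values of
   kappa0, tau0_bound and tau1. *)
Definition kappa0 : \bar R :=
  if r0 == 0 then +oo%E else (1 / Num.sqrt (r0 * r1))%:E.

Definition kappa1_bound : R := Num.max ((9 + κ4) / (2 * ρ2)) 1.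
Definition kappa5 : R := Num.max ((4 + 5 * Lf ^+ 2) / κ4) (6 / ρ2).
Definition kappa6 : R :=
  8 * (κ1 + 1) ^+ 2 * Lf ^+ 2 / (kappa5 * ρ2) + 4 * Lf ^+ 2 / ρ2 ^+ 2.
Definition kappa2 : R := Num.max kappa5 (Num.sqrt kappa6).

Definition eps1 : R := α / 2 * ρ2 - 1 / 4 * (9 * β + 4 + 5 * Lf ^+ 2).
Definition eps2 : R :=
  3 * Lf ^+ 2
  + 4 * (2 + φ * ψ * r) / (φ * ψ * r) * (α ^+ 2 * ρ ^+ 2 + Lf ^+ 2)
  + 2 * β ^+ 2 + 1 + 3 * α ^+ 2 * ρ ^+ 2.
Definition eps3 : R := β / 2 - 3 * ρ2^-1.
Definition eps4 : R :=
  2 * β ^+ 2 * ρ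
  + 4 * (2 + φ * ψ * r) * β ^+ 2 * ρ ^+ 2 / (φ * ψ * r) + ρ2^-1.
Definition eps5 : R :=
  1 / 8 - (α + β) ^+ 2 * Lf ^+ 2 / (β ^+ 5 * ρ2)
  - Lf ^+ 2 / (2 * β ^+ 2 * ρ2 ^+ 2).
Definition eps6 : R :=
  (α + β) * Lf ^+ 2 / (2 * β ^+ 3 * ρ2) + 3 * Lf ^+ 2 / 4
  + Lf ^+ 2 / (2 * β ^+ 2 * ρ2 ^+ 2) + Lf / 2.
Definition eps7 : R := φ * ψ * r / 2 * (1 + φ * ψ * r).
Definition eps8 : R := 1 / 2 * (α + 2 * β) * ρ * r0 + 2 * β * r0.
Definition eps9 : R :=
  (8 + 7 * φ * ψ * r) * α ^+ 2 * ρ ^+ 2 * r0 / (φ * ψ * r)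
  + (2 * β ^+ 2 + 1) * r0.
Definition check_eps8 : R :=
  ((α + 2 * β) * ρ + 4 * β) * (r0 * r1 + 1) * σ ^+ 2.
Definition check_eps9 : R :=
  2 * (7 * α ^+ 2 * ρ ^+ 2 + 2 * β ^+ 2 + 1) * (r0 * r1 + 1) * σ ^+ 2.

Definition tau0_bound : \bar R :=
  if r0 == 0 then +oo%E else (eps7 / (r0 * r2))%:E.

Definition tau1 : \bar R :=
  if r0 == 0 then +oo%E else
  ((Num.sqrt (r2 ^+ 2 * eps8 ^+ 2 + 2 * r2 * eps9 * (eps7 - r0 * r2 * τ0))
    - r2 * eps8) / (2 * r2 * eps9))%:E.
Definition tau2 : R :=
  (Num.sqrt (check_eps8 ^+ 2 + 4 * (1 - r0 * r1 * σ ^+ 2) * τ0 * check_eps9)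
   - check_eps8) / (2 * check_eps9).
Definition tau3 : R :=
  eps7 - r0 * r2 * τ0 - 2 * η * r2 * eps8 - 2 * η ^+ 2 * r2 * eps9.
Definition tau4 : R :=
  (1 - r0 * r1 * σ ^+ 2) * τ0 - η * check_eps8 - η ^+ 2 * check_eps9.

Definition check_kappa3 : \bar R :=
  Order.min (eps1 / eps2)%:E
   (Order.min (eps3 / eps4)%:E
    (Order.min (eps5 / eps6)%:E
     (Order.min tau1 tau2%:E))).

Definition eps11 : R :=
  Num.max (1 / 2 + α / β) ((α * ρ2 + β) / (2 * α * ρ2)).
Definition check_eps12 : R :=
  η * Num.min (eps1 - η * eps2)
       (Num.min (eps3 - η * eps4)
        (Num.min (ν / 2) (Num.min (tau3 / η) (tau4 / (η * τ0))))).
Definition check_eps : R := check_eps12 / eps11.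

End constants.

(* Main.v *)
(* A step is analysed on the stacked matrices X, V, ... whose rows belong to the
   agents. Put K = 1 - J with J the averaging matrix, let Q be the pseudo-inverse
   of L, g0 the stacked local gradients at the average, and consider
     u = K X,  s = Q (V + g0 / beta),  Y = X - a.
   Since b = a - L a throughout, X is coupled only through L Xh with Xh = a + qh,
   and
     - alpha <X, L Xh> = alpha / 2 (<D, L D> - <X, L X> - <Xh, L Xh>),
     D = Xh - X.
   The term -<Xh, L Xh> absorbs all second-order contributions of L Xh, and
   -<X, L X> gives a decrease of |u|^2 at rate alpha rho2(L). Hence the energy
     |u|^2 / 2 + (alpha + beta) / (2 beta) <s, L s> + <u, s> + n (f(xbar) - f-star)
   contracts up to a multiple of |D|^2, and adding |Y|^2 + tau0 |e|^2 yields a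
   Lyapunov function. Pathwise its increment depends on the compressors only
   through |C(y)/r - y|^2 for y a row of Y or of sigma e + Y. These y depend on
   seeds of earlier iterations only, so independence of the fresh seed and
   Tonelli's theorem bound the expectation by (1 - phi) E|y|^2. *)
Require Import Defs.
From HB Require Import structures.
From mathcomp Require Import all_boot all_order all_algebra.
From mathcomp Require Import all_classical all_reals all_analysis.
From mathcomp Require Import measurable_realfun ring lra.
Set Implicit Arguments.
Unset Strict Implicit.
Unset Printing Implicit Defensive.
Import Order.TTheory GRing.Theory Num.Theory.
Import numFieldNormedType.Exports.
Local Open Scope ring_scope.

(** * Rayleigh quotients *)

(** The target [- g0 / beta] of [V] moves with the average. Over one step the drift of [g0] is at
    most [Lf] times the movement of the average, which is [eta] times the averaged gradient. The
    squared norm [G] of that gradient is exactly what the descent lemma releases, as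
    [- eta / 2 * G], so the drift is paid from the optimality gap and not from the consensus terms.
    The part of |X' - X|^2 due to the average, which perturbs [Y], is charged to [G] as well. The
    error |D|^2 is not a function of the current state: D = sigma e - e', where e' is the next
    feedback error. The bound therefore raises the weight of the new |e'|^2 above [tau0] before e'
    is estimated. Expectations are taken only once, after a pathwise inequality that is linear in
    the two squared compression errors. Each error is integrated against its own seed, so the joint
    law of q and hat q within one iteration never enters; this covers iteration 0, where they share
    a seed. *)

Section InnerProduct.
Variable R : realType.

Definition ip m n (X Y : 'M[R]_(m, n)) : R := \tr (X *m Y^T).

Lemma ipE m n (X Y : 'M[R]_(m, n)) : ip X Y = \sum_i \sum_j X i j * Y i j.
Proof.
rewrite /ip /mxtrace; apply: eq_bigr => i _; rewrite mxE.
by apply: eq_bigr => j _; rewrite mxE.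
Qed.

Lemma ipC m n (X Y : 'M[R]_(m, n)) : ip X Y = ip Y X.
Proof. by rewrite /ip -mxtrace_tr trmx_mul trmxK. Qed.

Lemma ipDl m n (X Y Z : 'M[R]_(m, n)) : ip (X + Y) Z = ip X Z + ip Y Z.
Proof. by rewrite /ip mulmxDl mxtraceD. Qed.

Lemma ipDr m n (X Y Z : 'M[R]_(m, n)) : ip Z (X + Y) = ip Z X + ip Z Y.
Proof. by rewrite ipC ipDl ![ip _ Z]ipC. Qed.

Lemma ipZl m n (c : R) (X Y : 'M[R]_(m, n)) : ip (c *: X) Y = c * ip X Y.
Proof. by rewrite /ip -scalemxAl mxtraceZ. Qed.

Lemma ipZr m n (c : R) (X Y : 'M[R]_(m, n)) : ip X (c *: Y) = c * ip X Y.
Proof. by rewrite ipC ipZl ipC. Qed.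

Lemma ipNl m n (X Y : 'M[R]_(m, n)) : ip (- X) Y = - ip X Y.
Proof. by rewrite -scaleN1r ipZl mulN1r. Qed.

Lemma ipNr m n (X Y : 'M[R]_(m, n)) : ip X (- Y) = - ip X Y.
Proof. by rewrite ipC ipNl ipC. Qed.

Lemma ip0l m n (Y : 'M[R]_(m, n)) : ip 0 Y = 0.
Proof. by rewrite /ip mul0mx mxtrace0. Qed.

Lemma ip0r m n (Y : 'M[R]_(m, n)) : ip Y 0 = 0.
Proof. by rewrite ipC ip0l. Qed.

Definition ipS := (ipDl, ipDr, ipNl, ipNr, ipZl, ipZr).

Lemma ip_mull m n (A : 'M[R]_m) (X Y : 'M[R]_(m, n)) :
  ip (A *m X) Y = ip X (A^T *m Y).
Proof. by rewrite /ip -mulmxA mxtrace_mulC trmx_mul trmxK mulmxA. Qed.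

Lemma ip_mulr m n (A : 'M[R]_n) (X Y : 'M[R]_(m, n)) :
  ip X (Y *m A) = ip (X *m A^T) Y.
Proof. by rewrite /ip trmx_mul mulmxA. Qed.

Lemma ip_ge0 m n (X : 'M[R]_(m, n)) : 0 <= ip X X.
Proof.
by rewrite ipE; apply: sumr_ge0 => i _; apply: sumr_ge0 => j _; rewrite -expr2 sqr_ge0.
Qed.

Lemma ip_eq0 m n (X : 'M[R]_(m, n)) : ip X X = 0 -> X = 0.
Proof.
rewrite ipE => /eqP; rewrite psumr_eq0; last first.
  by move=> i _; apply: sumr_ge0 => j _; rewrite -expr2 sqr_ge0.
move=> /allP h; apply/matrixP => i j; rewrite mxE.
have /= := h i (mem_index_enum _); rewrite psumr_eq0; last first.
  by move=> k _; rewrite -expr2 sqr_ge0.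
by move=> /allP /(_ j (mem_index_enum _)) /=; rewrite mulf_eq0 orbb => /eqP.
Qed.

Lemma ip_young m n (c : R) (X Y : 'M[R]_(m, n)) : 0 < c ->
  ip X Y <= c * ip X X + (4 * c)^-1 * ip Y Y.
Proof.
move=> c0; rewrite -subr_ge0 -(pmulr_rge0 _ c0).
rewrite (_ : c * (_ - ip X Y) = ip (c *: X - 2^-1 *: Y) (c *: X - 2^-1 *: Y)) ?ip_ge0//.
by rewrite !ipS (ipC Y X); field; rewrite gt_eqF.
Qed.

Lemma ip_sqrD m n (X Y : 'M[R]_(m, n)) :
  ip (X + Y) (X + Y) = ip X X + 2 * ip X Y + ip Y Y.
Proof. by rewrite !ipS (ipC Y X); ring. Qed.

Lemma ip_sqrB m n (X Y : 'M[R]_(m, n)) :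
  ip (X - Y) (X - Y) = ip X X - 2 * ip Y X + ip Y Y.
Proof. by rewrite ip_sqrD ipNr ipNr ipNl opprK (ipC X Y) mulrN. Qed.

Lemma enorm_sqr d (x : 'rV[R]_d) : enorm x ^+ 2 = ip x x.
Proof.
rewrite /enorm sqr_sqrtr; last by apply: sumr_ge0 => j _; rewrite sqr_ge0.
by rewrite ipE big_ord1; apply: eq_bigr => j _; rewrite expr2.
Qed.

Lemma ip_rows n d (X Y : 'M[R]_(n, d)) : ip X Y = \sum_i ip (row i X) (row i Y).
Proof.
rewrite ipE; apply: eq_bigr => i _; rewrite ipE big_ord1.
by apply: eq_bigr => j _; rewrite !mxE.
Qed.

Lemma ip_cols n d (X Y : 'M[R]_(n, d)) :
  ip X Y = \sum_j ip (col j X)^T (col j Y)^T.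
Proof.
rewrite ipE exchange_big; apply: eq_bigr => j _; rewrite ipE big_ord1.
by apply: eq_bigr => i _; rewrite !mxE.
Qed.

Definition psd n (A : 'M[R]_n) := forall x : 'rV[R]_n, 0 <= ip x (x *m A).

Lemma psd_ip n d (A : 'M[R]_n) (X : 'M[R]_(n, d)) : A^T = A -> psd A ->
  0 <= ip X (A *m X).
Proof.
move=> sA pA; rewrite ip_cols; apply: sumr_ge0 => j _.
by rewrite (_ : col j (A *m X) = A *m col j X) ?trmx_mul ?sA//; rewrite !colE mulmxA.
Qed.

Lemma psd_kernel n (A : 'M[R]_n) (x : 'rV[R]_n) : A^T = A -> psd A ->
  ip x (x *m A) = 0 -> x *m A = 0.
Proof.
move=> sA pA x0; apply: ip_eq0.
set y := x *m A; set N := ip y y; set q := ip y (y *m A).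
have q0 : 0 <= q by exact: pA.
have N0 : 0 <= N by exact: ip_ge0.
(* The form at [x + t *: y] equals 2 t N + t^2 q, so a small negative t makes it negative unless N =
   0. The summand 1 keeps the denominator positive when q = 0. *)
set t := - N / (q + 1).
have := pA (x + t *: y).
rewrite mulmxDl -scalemxAl !ipS x0.
have -> : ip x (y *m A) = N.
  by rewrite ip_mulr sA.
rewrite -/N -/q -/y => h.
have q1 : 0 < q + 1 by lra.
have : 0 <= (q + 1) ^+ 2 * (0 + t * N + t * (N + t * q)).
  by rewrite mulr_ge0 ?sqr_ge0//; lra.
have -> : (q + 1) ^+ 2 * (0 + t * N + t * (N + t * q)) = - (N ^+ 2 * (q + 2)).
  by rewrite /t; field; rewrite gt_eqF.
rewrite oppr_ge0 pmulr_lle0; last by lra.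
by move=> hN; apply/eqP; rewrite -sqrf_eq0 eq_le hN sqr_ge0.
Qed.

Lemma ip_continuous n (A : 'M[R]_n) :
  continuous (fun x : 'rV[R]_n => ip x (x *m A)).
Proof.
move=> x; rewrite (_ : (fun x => _) =
  fun x : 'rV[R]_n => \sum_j x ord0 j * \sum_i x ord0 i * A i j); last first.
  apply/funext => y; rewrite ipE big_ord1; apply: eq_bigr => j _.
  by rewrite mxE.
move: x; apply: continuous_big => [|j _]; first exact: add_continuous.
move=> x; apply: cvgM; [exact: (@nbhs_filter (matrix R 1 n) x)|exact: coord_continuous|].
move: x; apply: continuous_big => [|i _]; first exact: add_continuous.
move=> x; apply: cvgM; [exact: (@nbhs_filter (matrix R 1 n) x)|exact: coord_continuous|].
exact: cst_continuous.
Qed.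

(* The maximiser [c] of the Rayleigh quotient is an eigenvector because it
   annihilates the positive semidefinite form [M - A]. *)
Lemma rayleigh_max n (A : 'M[R]_n) : (0 < n)%N -> A^T = A ->
  exists2 M, eigenvalue A M & psd (M%:M - A).
Proof.
move=> n0 sA.
pose S : set 'rV[R]_n := [set x | ip x x = 1]%classic.
have ipx1 (x : 'rV[R]_n) : ip x (x *m 1%:M) = ip x x by rewrite mulmx1.
have [c Sc cmax] : exists2 c, c \in S & forall t, t \in S ->
    ip t (t *m A) <= ip c (c *m A).
  apply: EVT_max_rV.
  - exists (delta_mx ord0 (Ordinal n0)); rewrite /S /= ipE big_ord1.
    rewrite (bigD1 (Ordinal n0)) //= !mxE !eqxx mulr1 big1 ?addr0// => j jn.
    by rewrite !mxE (negPf jn) mulr0.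
  - apply: bounded_closed_compact.
    (* The sphere is Euclidean, boundedness refers to the sup norm: each squared entry is at most
       [ip x x]. *)
    + exists 1; split; first exact: num_real.
      move=> M M1 x /= Sx; rewrite ltW// (le_lt_trans _ M1)//.
      rewrite [leLHS]mx_normrE; apply: bigmax_le => // -[i j] _ /=.
      rewrite -(@expr_le1 _ 2)// real_normK ?num_real//.
      have <- : ip x x = 1 := Sx.
      rewrite ipE ord1 big_ord1 (bigD1 j)//= -expr2 lerDl.
      by apply: sumr_ge0 => k _; rewrite -expr2 sqr_ge0.
    + rewrite (_ : S = (fun x : 'rV[R]_n => ip x (x *m 1%:M)) @^-1` [set 1])%classic.
        apply: preimage_closed; first by move=> y _; exact: ip_continuous.
        exact: closed_eq.
      by apply/seteqP; split => x /=; rewrite /S /= mulmx1.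
  - exact/continuous_subspaceT/ip_continuous.
have c1 : ip c c = 1 by move: Sc; rewrite inE.
set M := ip c (c *m A) in cmax.
have pB : psd (M%:M - A).
  move=> x; rewrite mulmxBr mul_mx_scalar !ipS subr_ge0.
  have [/ip_eq0 ->|xn0] := eqVneq (ip x x) 0; first by rewrite ip0r mul0mx ip0r mulr0.
  have x0 : 0 < ip x x by rewrite lt_def xn0 ip_ge0.
  set s := Num.sqrt (ip x x).
  have s0 : 0 < s by rewrite sqrtr_gt0.
  have ss : s ^+ 2 = ip x x by rewrite sqr_sqrtr// ltW.
  have := cmax (s^-1 *: x); rewrite inE /S /= -scalemxAl !ipS.
  have -> : s^-1 * (s^-1 * ip x x) = 1 by rewrite -ss; field; rewrite gt_eqF.
  move=> /(_ erefl); rewrite mulrA -invfM -expr2 ss mulrC ler_pdivrMr //.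
exists M => //; apply/eigenvalueP; exists c; last first.
  by apply: contra_eq_neq c1 => ->; rewrite ip0l eq_sym oner_neq0.
have : c *m (M%:M - A) = 0.
  apply: psd_kernel => //; first by rewrite linearB /= tr_scalar_mx sA.
  by rewrite mulmxBr mul_mx_scalar !ipS c1 mulr1 subrr.
by rewrite mulmxBr mul_mx_scalar => /eqP; rewrite subr_eq0 => /eqP.
Qed.

End InnerProduct.

(** * Graph Laplacian *)

Section Laplacian.
Variables (R : realType) (n : nat) (A : 'M[R]_n).
Hypotheses (hn : (1 < n)%N) (hA : weighted_graph A) (hconn : graph_connected A).

Let L := laplacian A.
Definition avg_mx m : 'M[R]_m := const_mx m%:R^-1.
Let J := avg_mx n.

Let nR0 : (n%:R : R) != 0.
Proof. by rewrite pnatr_eq0 -lt0n ltnW. Qed.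

Lemma tr_laplacian : L^T = L.
Proof.
apply/matrixP => i j; rewrite !mxE (wg_sym hA j i) eq_sym.
by have [->|] := eqVneq i j.
Qed.

Lemma tr_avg_mx : J^T = J.
Proof. by apply/matrixP => i j; rewrite !mxE. Qed.

Lemma avg_mx_mul d (X : 'M[R]_(n, d)) :
  J *m X = \matrix_(i, j) (n%:R^-1 * \sum_k X k j).
Proof.
apply/matrixP => i j; rewrite !mxE mulr_sumr.
by apply: eq_bigr => k _; rewrite mxE.
Qed.

Lemma avg_mx_idem : J *m J = J.
Proof.
rewrite avg_mx_mul; apply/matrixP => i j; rewrite !mxE.
under eq_bigr do rewrite mxE.
by rewrite sumr_const card_ord -[X in _ * X]mulr_natl mulfV ?mulr1.
Qed.

Lemma avg_mx_laplacian : J *m L = 0.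
Proof.
rewrite avg_mx_mul; apply/matrixP => i j; rewrite !mxE.
rewrite (_ : \sum_k _ = 0) ?mulr0//.
under eq_bigr do rewrite !mxE.
rewrite sumrB (bigD1 j)//= eqxx mulr1n [X in _ + X - _]big1 => [|k kj]; last by rewrite (negPf kj).
rewrite addr0; apply/eqP; rewrite subr_eq0; apply/eqP/eq_bigr => k _.
exact: (wg_sym hA).
Qed.

Lemma laplacian_avg_mx : L *m J = 0.
Proof.
apply: trmx_inj; rewrite trmx_mul tr_laplacian trmx0 tr_avg_mx.
exact: avg_mx_laplacian.
Qed.

(** Adding the sum to itself with the two indices exchanged completes the squares. *)
Lemma laplacian_quad (x : 'rV[R]_n) :
  ip x (x *m L) = 2^-1 * \sum_i \sum_j A i j * (x ord0 i - x ord0 j) ^+ 2.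
Proof.
have xL j : (x *m L) ord0 j = \sum_i A i j * (x ord0 j - x ord0 i).
  rewrite mxE; under eq_bigr do rewrite !mxE mulrBr.
  rewrite sumrB (bigD1 j)//= eqxx mulr1n [X in _ + X - _]big1 ?addr0; last first.
    by move=> k kj; rewrite (negPf kj) mulr0.
  rewrite mulr_sumr -sumrB; apply: eq_bigr => i _.
  by rewrite (wg_sym hA j i); ring.
rewrite ipE big_ord1; under eq_bigr do rewrite xL mulr_sumr.
set S := LHS.
have S2 : S = \sum_j \sum_i x ord0 i * (A j i * (x ord0 i - x ord0 j)).
  by rewrite /S exchange_big.
have : S + S = \sum_i \sum_j A i j * (x ord0 i - x ord0 j) ^+ 2.
  rewrite {2}S2 /S -big_split; apply: eq_bigr => j _ /=.
  rewrite -big_split; apply: eq_bigr => i _ /=.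
  by rewrite (wg_sym hA j i); ring.
by move=> <-; field.
Qed.

Lemma psd_laplacian : psd L.
Proof.
move=> x; rewrite laplacian_quad mulr_ge0 ?invr_ge0//.
do 2 (apply: sumr_ge0 => ? _); by rewrite mulr_ge0 ?sqr_ge0 ?(wg_ge0 hA).
Qed.

(** A vanishing sum of squares forces equal values across every edge, and connectedness carries the
    equality along paths. *)
Lemma laplacian_kernel (x : 'rV[R]_n) : ip x (x *m L) = 0 ->
  forall i j, x ord0 i = x ord0 j.
Proof.
rewrite laplacian_quad => /eqP; rewrite mulf_eq0 invr_eq0 pnatr_eq0 /=.
rewrite psumr_eq0 => [/allP x0|i _]; last first.
  by apply: sumr_ge0 => j _; rewrite mulr_ge0 ?sqr_ge0 ?(wg_ge0 hA).
have edge i j : 0 < A i j -> x ord0 i = x ord0 j.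
  have := x0 i (mem_index_enum _); rewrite /= psumr_eq0 => [/allP|k _]; last first.
    by rewrite mulr_ge0 ?sqr_ge0 ?(wg_ge0 hA).
  move=> /(_ j (mem_index_enum _)) /=; rewrite mulf_eq0 sqrf_eq0 subr_eq0.
  by move=> /orP[/eqP ->|/eqP //]; rewrite ltxx.
move=> i j; have /connectP[s] := hconn i j.
elim: s i => [|k s IH] i /=; first by move=> _ ->.
by move=> /andP[/edge ->] /IH.
Qed.

Lemma laplacian_pos (x : 'rV[R]_n) : x *m J = 0 -> x != 0 -> 0 < ip x (x *m L).
Proof.
move=> xJ xn0; rewrite lt_def psd_laplacian andbT.
apply: contra_neq xn0 => /laplacian_kernel xc.
apply/matrixP => i j; rewrite mxE ord1.
move/matrixP : xJ => /(_ ord0 j); rewrite !mxE.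
under eq_bigr => k _ do rewrite (xc k j) mxE.
by rewrite sumr_const card_ord -mulrnAr -[n%:R^-1 *+ n]mulr_natr mulVf// mulr1.
Qed.

Lemma eigen_ip (B : 'M[R]_n) a (v : 'rV[R]_n) : v *m B = a *: v ->
  ip v (v *m B) = a * ip v v.
Proof. by move=> ->; rewrite !ipS. Qed.

Lemma ip_gt0 (v : 'rV[R]_n) : v != 0 -> 0 < ip v v.
Proof. by move=> v0; rewrite lt_def ip_ge0 andbT; apply: contra_neq v0 => /ip_eq0. Qed.

(** If the top eigenvalue were at most 0, the form would vanish on a basis vector, which is not
    constant because there are two vertices. *)
Lemma laplacian_top : exists M, [/\ eigenvalue L M, 0 < M & psd (M%:M - L)].
Proof.
have [M eM pM] := rayleigh_max (ltnW hn) tr_laplacian.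
exists M; split => //; rewrite ltNge; apply/negP => M0.
pose x : 'rV[R]_n := delta_mx ord0 (Ordinal hn).
have /laplacian_kernel : ip x (x *m L) = 0.
  apply/eqP; rewrite eq_le psd_laplacian andbT.
  have := pM x; rewrite mulmxBr mul_mx_scalar !ipS subr_ge0 => /le_trans; apply.
  by rewrite mulr_le0_ge0 ?ip_ge0.
move=> /(_ (Ordinal hn) (Ordinal (ltnW hn))); rewrite !mxE /=.
by move/eqP; rewrite oner_eq0.
Qed.

(** [M] also bounds the set of absolute eigenvalues, which is what makes its [sup] meaningful. *)
Lemma laplacian_top_le M : eigenvalue L M -> 0 < M -> psd (M%:M - L) ->
  M <= spectral_radius L.
Proof.
move=> eM M0 pM; apply: ub_le_sup; last by exists M => //; rewrite gtr0_norm.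
exists M => _ [a /= /eigenvalueP[v vL v0] <-].
have v1 := ip_gt0 v0.
rewrite ger0_norm; last first.
  by rewrite -(pmulr_lge0 _ v1) -(eigen_ip vL) psd_laplacian.
by have := pM v; rewrite mulmxBr mul_mx_scalar !ipS (eigen_ip vL) subr_ge0 ler_pM2r.
Qed.

Lemma psd_spectral_radius : psd ((spectral_radius L)%:M - L).
Proof.
have [M [eM M0 pM]] := laplacian_top.
have MB := laplacian_top_le eM M0 pM.
move=> x; apply: le_trans (pM x) _.
by rewrite !mulmxBr !mul_mx_scalar !ipS lerD2r ler_wpM2r ?ip_ge0.
Qed.

Lemma smallest_pos_eigenvalue_le : smallest_pos_eigenvalue L <= spectral_radius L.
Proof.
have [M [eM M0 pM]] := laplacian_top.
apply: le_trans (laplacian_top_le eM M0 pM); apply: ge_inf => //.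
by exists 0 => a /= [_ /ltW].
Qed.

(* Adding [t J] moves the zero eigenvalue of [L] to [t]. *)
Lemma laplacian_bottom t : exists mu, psd (L + t *: J - mu%:M) /\
  (mu = t \/ eigenvalue L mu /\ 0 < mu).
Proof.
have sT : (- (L + t *: J))^T = - (L + t *: J).
  by rewrite linearN linearD linearZ /= tr_laplacian tr_avg_mx.
have [M /eigenvalueP[v vT v0] pM] := rayleigh_max (ltnW hn) sT.
exists (- M); split.
  by move=> x; have := pM x; rewrite (_ : L + _ - _ = M%:M - - (L + t *: J))//
    raddfN /= !opprK addrC.
have vL : v *m L + t *: (v *m J) = - M *: v.
  by rewrite scaleNr -vT mulmxN opprK [RHS]mulmxDr scalemxAr.
(* Multiplying [vL] by [J] leaves t (v J) = - M (v J). Either v J = 0 and v is an eigenvector of [L]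
   orthogonal to the constants, or the eigenvalue is t. *)
have [vJ|vJ] := eqVneq (v *m J) 0; [right|left].
  move: vL; rewrite vJ scaler0 addr0 => vL.
  split; first by apply/eigenvalueP; exists v.
  by rewrite -(pmulr_lgt0 _ (ip_gt0 v0)) -(eigen_ip vL) laplacian_pos.
have : v *m L *m J + t *: (v *m J *m J) = - M *: (v *m J).
  by rewrite scalemxAl -mulmxDl vL scalemxAl.
rewrite -!mulmxA laplacian_avg_mx avg_mx_idem mulmx0 add0r => /eqP.
by rewrite -subr_eq0 -scalerBl scaler_eq0 (negPf vJ) orbF subr_eq0 => /eqP.
Qed.

Let eigen_avg a (v : 'rV[R]_n) : v *m L = a *: v -> a != 0 -> v *m J = 0.
Proof.
move=> vL a0; have : v *m L *m J = a *: (v *m J) by rewrite vL scalemxAl.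
rewrite -mulmxA laplacian_avg_mx mulmx0 => /esym/eqP.
by rewrite scaler_eq0 (negPf a0) => /eqP.
Qed.

(** An infimum of positive numbers could be 0. The bottom eigenvalue of [L + J] is positive and
    bounds every positive eigenvalue of [L] from below, since the eigenvectors of the latter are
    annihilated by [J]. *)
Lemma smallest_pos_eigenvalue_gt0 : 0 < smallest_pos_eigenvalue L.
Proof.
have [mu [pmu mu1]] := laplacian_bottom 1.
have mu0 : 0 < mu by case: mu1 => [->|[]].
apply: (lt_le_trans mu0); apply: lb_le_inf.
  by have [M [eM M0 _]] := laplacian_top; exists M.
move=> a /= [/eigenvalueP[v vL v0] a0].
have := pmu v; rewrite mulmxBr mulmxDr -scalemxAr (eigen_avg vL) ?gt_eqF//.
rewrite scaler0 addr0 mul_mx_scalar ipDr (eigen_ip vL) ipNr ipZr subr_ge0.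
by rewrite ler_pM2r ?ip_gt0.
Qed.

(** With t the smallest positive eigenvalue, both alternatives of [laplacian_bottom] give a bottom
    eigenvalue of [L + t *: J] that is at least t. *)
Lemma psd_smallest_pos_eigenvalue :
  psd (L - smallest_pos_eigenvalue L *: (1%:M - J)).
Proof.
set t := smallest_pos_eigenvalue L.
have [mu [pmu mu1]] := laplacian_bottom t.
have tmu : t <= mu.
  case: mu1 => [->//|emu]; apply: ge_inf => //.
  by exists 0 => a /= [_ /ltW].
move=> x; apply: le_trans (pmu x) _.
rewrite !(mulmxBr, mulmxDr, mul_mx_scalar) -!scalemxAr mulmxBr mulmx1 !ipS.
have := ler_wpM2r (ip_ge0 x) tmu; lra.
Qed.

(** [L + J] acts as [L] on vectors of mean zero and as the identity on constants; subtracting [J]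
    from its inverse leaves the Moore-Penrose inverse of [L]. *)
Definition laplacian_pinv : 'M[R]_n := invmx (L + J) - J.
Let Q := laplacian_pinv.

Let unitLJ : L + J \in unitmx.
Proof.
rewrite -row_free_unit -kermx_eq0; apply/eqP/row_matrixP => i; rewrite row0.
set v := row i _; have v0 : v *m (L + J) = 0.
  by apply/sub_kermxP; exact: row_sub.
have vJ : v *m J = 0.
  have : (v *m L + v *m J) *m J = 0 by rewrite -[v *m L + _]mulmxDr v0 mul0mx.
  by rewrite [LHS]mulmxDl -!mulmxA laplacian_avg_mx avg_mx_idem mulmx0 add0r.
apply/eqP; apply/negPn/negP => vn0.
have := laplacian_pos vJ vn0; move: v0; rewrite [LHS]mulmxDr vJ addr0 => ->.
by rewrite ip0r ltxx.
Qed.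

Let invJ : invmx (L + J) *m J = J.
Proof.
have LJJ : (L + J) *m J = J by rewrite [LHS]mulmxDl laplacian_avg_mx add0r avg_mx_idem.
by rewrite -{2}LJJ mulKmx.
Qed.

Lemma tr_laplacian_pinv : Q^T = Q.
Proof.
by rewrite /Q /laplacian_pinv linearB /= trmx_inv linearD /= tr_laplacian tr_avg_mx.
Qed.

Lemma laplacian_pinv_avg : Q *m J = 0.
Proof. by rewrite mulmxBl invJ avg_mx_idem subrr. Qed.

Lemma avg_laplacian_pinv : J *m Q = 0.
Proof.
apply: trmx_inj; rewrite trmx_mul tr_laplacian_pinv tr_avg_mx.
by rewrite laplacian_pinv_avg trmx0.
Qed.

Lemma laplacian_pinvK : L *m Q = 1%:M - J.
Proof.
rewrite -{1}(addrK J L) [LHS]mulmxBl avg_laplacian_pinv subr0 [LHS]mulmxBr mulmxV//.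
by rewrite [_ *m J]mulmxDl laplacian_avg_mx add0r avg_mx_idem.
Qed.

Lemma laplacian_pinvKl : Q *m L = 1%:M - J.
Proof.
rewrite -[LHS]trmxK trmx_mul tr_laplacian tr_laplacian_pinv laplacian_pinvK.
by rewrite linearB /= tr_scalar_mx tr_avg_mx.
Qed.

End Laplacian.

(** * Pathwise decrease of the Lyapunov function *)

Section Step.
Variables (R : realType) (n d : nat) (L : 'M[R]_n) (rho rho2 : R).
Hypothesis sL : L^T = L.
Hypothesis L_ge0 : forall X : 'M[R]_(n, d), 0 <= ip X (L *m X).
Hypothesis L_le : forall X : 'M[R]_(n, d), ip X (L *m X) <= rho * ip X X.
Hypothesis rho_gt0 : 0 < rho.

Definition ipL (X Y : 'M[R]_(n, d)) := ip X (L *m Y).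

Lemma ipLC X Y : ipL X Y = ipL Y X.
Proof. by rewrite /ipL ipC ip_mull sL. Qed.

Lemma ipLDl X Y Z : ipL (X + Y) Z = ipL X Z + ipL Y Z.
Proof. by rewrite /ipL ipDl. Qed.

Lemma ipLDr X Y Z : ipL Z (X + Y) = ipL Z X + ipL Z Y.
Proof. by rewrite ipLC ipLDl ![ipL _ Z]ipLC. Qed.

Lemma ipLZl c X Y : ipL (c *: X) Y = c * ipL X Y.
Proof. by rewrite /ipL ipZl. Qed.

Lemma ipLZr c X Y : ipL X (c *: Y) = c * ipL X Y.
Proof. by rewrite ipLC ipLZl ipLC. Qed.

Lemma ipLNl X Y : ipL (- X) Y = - ipL X Y.
Proof. by rewrite /ipL ipNl. Qed.

Lemma ipLNr X Y : ipL X (- Y) = - ipL X Y.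
Proof. by rewrite ipLC ipLNl ipLC. Qed.

Definition ipLS := (ipLDl, ipLDr, ipLNl, ipLNr, ipLZl, ipLZr).

Lemma ipL_young (c : R) X Y : 0 < c -> ipL X Y <= c * ipL X X + (4 * c)^-1 * ipL Y Y.
Proof.
move=> c0; rewrite -subr_ge0 -(pmulr_rge0 _ c0).
rewrite (_ : c * (_ - ipL X Y) = ipL (c *: X - 2^-1 *: Y) (c *: X - 2^-1 *: Y)).
  exact: L_ge0.
by rewrite !ipLS (ipLC Y X); field; rewrite gt_eqF.
Qed.

Lemma ipL_sqrD X Y : ipL (X + Y) (X + Y) = ipL X X + 2 * ipL X Y + ipL Y Y.
Proof. by rewrite !ipLS (ipLC Y X); ring. Qed.

(** This is L^2 <= rho L. It follows without diagonalization by expanding the nonnegative form at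
    [X - rho^-1 *: Y] and bounding the quadratic term by [L_le]. *)
Lemma ip_mulL_le X : ip (L *m X) (L *m X) <= rho * ipL X X.
Proof.
set Y := L *m X.
have XY : ipL X Y = ip Y Y by rewrite ipLC /ipL.
have := L_ge0 (X - rho^-1 *: Y); rewrite -/(ipL _ _) !ipLS (ipLC Y X) XY => h1.
have h2 : rho^-1 * (rho^-1 * ipL Y Y) <= rho^-1 * ip Y Y.
  by rewrite ler_pM2l ?invr_gt0// ler_pdivrMl//; exact: L_le.
have h3 : rho^-1 * ip Y Y <= ipL X X by lra.
by rewrite -ler_pdivrMl.
Qed.

Variables (alpha beta eta : R).
Hypotheses (alpha_gt0 : 0 < alpha) (beta_gt0 : 0 < beta) (eta_gt0 : 0 < eta).
Hypothesis rho2_gt0 : 0 < rho2.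

(* The consensus part of the Lyapunov function, in the coordinates
   [u = K x] and [s = Q (v + g0 / beta)]. *)
Definition consensus_energy (u s : 'M[R]_(n, d)) :=
  2^-1 * ip u u + (alpha + beta) / (2 * beta) * ipL s s + ip u s.

(** In the application [eh] is the centred [Xh - X], [g] the centred difference of the local
    gradients at [X] and at the average, and [th] the drift of [Q g0]. The rest of the gradient
    together with [V] is [beta *: (L *m s)], which gives [dx] its form. *)
Variables (u eh s g th : 'M[R]_(n, d)).
Let xh := u + eh.
Let dx := - eta *: (alpha *: (L *m xh) + beta *: (L *m s) + g).
Let ds := (eta * beta) *: xh + beta^-1 *: th.

(** The weights of the energy make the terms in [ipL u s] cancel: the three summands contribute -
    eta beta, eta (alpha + beta) and - eta alpha. The decrease in [s] comes from the cross term
    [ip u s]. *)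
Lemma consensus_energy_step :
  consensus_energy (u + dx) (s + ds) - consensus_energy u s =
  - eta * alpha * ipL u xh + eta * beta * ipL s eh - eta * beta * ipL s s
  - eta * ip u g - eta * ip s g + (alpha + beta) / beta ^+ 2 * ipL s th
  + eta * beta * ip u xh + beta^-1 * ip u th
  + 2^-1 * ip dx dx + (alpha + beta) / (2 * beta) * ipL ds ds + ip dx ds.
Proof.
rewrite /consensus_energy.
rewrite ip_sqrD ipL_sqrD (ipDl u dx) (ipDr s ds u) (ipDr s ds dx).
have -> : ip u dx = - eta * (alpha * ipL u xh + beta * ipL u s + ip u g).
  by rewrite /dx !ipZr !ipDr !ipZr.
have -> : ip dx s = - eta * (alpha * ipL s xh + beta * ipL s s + ip s g).
  by rewrite ipC /dx !ipZr !ipDr !ipZr.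
have -> : ipL s ds = eta * beta * ipL s xh + beta^-1 * ipL s th.
  by rewrite /ds ipLDr !ipLZr.
have -> : ip u ds = eta * beta * ip u xh + beta^-1 * ip u th.
  by rewrite /ds ipDr !ipZr.
have -> : ipL s xh = ipL s u + ipL s eh by rewrite /xh ipLDr.
by rewrite (ipLC s u); field; rewrite gt_eqF.
Qed.

(** The factors 5/2, 2 and 10 have reciprocals adding up to 1. The large one is put on [g], which
    keeps the first small enough for [coef_xh]. *)
Lemma step_size_le : ip dx dx <= eta ^+ 2 *
  (5 / 2 * alpha ^+ 2 * rho * ipL xh xh + 2 * beta ^+ 2 * rho * ipL s s + 10 * ip g g).
Proof.
rewrite /dx ipZl ipZr mulrA mulNr mulrN opprK -expr2 ler_wpM2l ?sqr_ge0//.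
set a := alpha *: _; set b := beta *: _.
have ha : ip a a <= alpha ^+ 2 * (rho * ipL xh xh).
  by rewrite /a ipZl ipZr mulrA -expr2 ler_wpM2l ?sqr_ge0// ip_mulL_le.
have hb : ip b b <= beta ^+ 2 * (rho * ipL s s).
  by rewrite /b ipZl ipZr mulrA -expr2 ler_wpM2l ?sqr_ge0// ip_mulL_le.
have h1 : ip a b <= 5 / 8 * ip a a + 2 / 5 * ip b b.
  by have := @ip_young _ _ _ (5 / 8) a b ltac:(lra); lra.
have h2 : ip a g <= 1 / 8 * ip a a + 2 * ip g g.
  by have := @ip_young _ _ _ (1 / 8) a g ltac:(lra); lra.
have h3 : ip b g <= 1 / 10 * ip b b + 5 / 2 * ip g g.
  by have := @ip_young _ _ _ (1 / 10) b g ltac:(lra); lra.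
rewrite (ip_sqrD (a + b)) (ip_sqrD a) (ipDl a b).
have := ip_ge0 g; lra.
Qed.

Variables (Lf G gam h : R).
Hypotheses (h_ge0 : 0 <= h) (uE : rho2 * ip u u <= ipL u u)
  (sE : rho2 * ip s s <= ipL s s) (g_le : ip g g <= gam)
  (thL : rho2 * ipL th th <= eta ^+ 2 * Lf ^+ 2 * G)
  (th2 : rho2 ^+ 2 * ip th th <= eta ^+ 2 * Lf ^+ 2 * G).

(** [h] is the weight with which |X' - X|^2 enters the bound on the next tracking error. In
    [h + 3 / 2], 1/2 comes from the square of [u + dx] and 1 from [ip dx ds]. *)
Lemma consensus_energy_decrease :
  consensus_energy (u + dx) (s + ds) + h * ip dx dx <= consensus_energy u s
  + eta * (- (alpha / 2) * rho2 + 1 + 5 / 4 * beta + eta * beta ^+ 2) * ip u u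
  + eta * (3 / 4 + 10 * (h + 3 / 2) * eta) * gam
  + eta * (- (5 / 8) * beta + rho2^-1 + (h + 3 / 2) * eta * (2 * beta ^+ 2 * rho))
      * ipL s s
  + eta * (- (alpha / 2) + eta * (alpha + beta) * beta
           + (h + 3 / 2) * eta * (5 / 2 * alpha ^+ 2 * rho)) * ipL xh xh
  + eta * ((alpha / 2 + beta) * rho + beta + eta * beta ^+ 2) * ip eh eh
  + eta * (2 * (alpha + beta) ^+ 2 * Lf ^+ 2 / (beta ^+ 5 * rho2)
           + Lf ^+ 2 / (2 * beta ^+ 2 * rho2 ^+ 2)
           + eta * ((alpha + beta) * Lf ^+ 2 / (beta ^+ 3 * rho2)
                    + Lf ^+ 2 / (2 * beta ^+ 2 * rho2 ^+ 2))) * G.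
Proof.
have abn0 : alpha + beta != 0 by rewrite gt_eqF ?addr_gt0.
have bn0 : beta != 0 by rewrite gt_eqF.
have en0 : eta != 0 by rewrite gt_eqF.
have rn0 : rho2 != 0 by rewrite gt_eqF.
have xhE : ipL u xh = 2^-1 * (ipL u u + ipL xh xh - ipL eh eh).
  by rewrite /xh !ipLS (ipLC eh u); field.
have ehL : ipL eh eh <= rho * ip eh eh by exact: L_le.
(* Of the decrease eta beta [ipL s s], one quarter is spent here and one eighth in [b8]; this leaves
   the 5/8 of the statement. *)
have b2 : ipL s eh <= 4^-1 * ipL s s + ipL eh eh.
  by have := @ipL_young 4^-1 s eh ltac:(lra); lra.
have gg := g_le.
have b3 : - ip u g <= 2^-1 * ip u u + 2^-1 * gam.
  by have := @ip_young _ _ _ 2^-1 u (- g) ltac:(lra); rewrite ipNr ipNr ipNl; lra.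
have b4 : - ip s g <= rho2^-1 * ipL s s + 4^-1 * gam.
  have : ip s s <= rho2^-1 * ipL s s by rewrite ler_pdivlMl.
  by have := @ip_young _ _ _ 1 s (- g) ltac:(lra); rewrite ipNr ipNr ipNl; lra.
have b5 : ip u xh <= 5 / 4 * ip u u + ip eh eh.
  by rewrite /xh ipDr; have := @ip_young _ _ _ 4^-1 u eh ltac:(lra); lra.
have thL' : ipL th th <= eta ^+ 2 * Lf ^+ 2 * G / rho2.
  by rewrite ler_pdivlMr// mulrC.
have th2' : ip th th <= eta ^+ 2 * Lf ^+ 2 * G / rho2 ^+ 2.
  by rewrite ler_pdivlMr ?exprn_gt0// mulrC.
have b8 : (alpha + beta) / beta ^+ 2 * ipL s th <= eta * beta / 8 * ipL s s
    + eta * (2 * (alpha + beta) ^+ 2 * Lf ^+ 2 / (beta ^+ 5 * rho2)) * G.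
  (* Chosen so that (alpha + beta) / beta^2 times [c] is exactly eta beta / 8. *)
  set c := eta * beta ^+ 3 / (8 * (alpha + beta)).
  have c0 : 0 < c by rewrite divr_gt0 ?mulr_gt0 ?exprn_gt0 ?addr_gt0//.
  have := ipL_young s th c0; rewrite -(ler_pM2l (_ : 0 < (alpha + beta) / beta ^+ 2)); last first.
    by rewrite divr_gt0 ?exprn_gt0 ?addr_gt0.
  move=> /le_trans; apply; rewrite mulrDr lerD//.
    rewrite mulrA ler_wpM2r ?L_ge0//.
    rewrite le_eqVlt; apply/orP; left; apply/eqP; rewrite /c; field.
    by rewrite ?abn0 ?bn0 ?en0 ?rn0.
  have k0 : 0 <= (alpha + beta) / beta ^+ 2 * (4 * c)^-1.
    rewrite ltW// mulr_gt0//; first by rewrite divr_gt0 ?exprn_gt0 ?addr_gt0.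
    by rewrite invr_gt0 mulr_gt0.
  have h1 := ler_wpM2l k0 thL'.
  rewrite [leLHS]mulrA; apply: (le_trans h1).
  rewrite le_eqVlt; apply/orP; left; apply/eqP; rewrite /c; field.
  by rewrite ?abn0 ?bn0 ?en0 ?rn0.
have b9 : beta^-1 * ip u th <= eta / 2 * ip u u
    + eta * (Lf ^+ 2 / (2 * beta ^+ 2 * rho2 ^+ 2)) * G.
  set c := eta * beta / 2.
  have c0 : 0 < c by rewrite divr_gt0 ?mulr_gt0.
  have := ip_young u th c0; rewrite -(ler_pM2l (_ : 0 < beta^-1)) ?invr_gt0//.
  move=> /le_trans; apply; rewrite mulrDr lerD//.
    rewrite mulrA ler_wpM2r ?ip_ge0//.
    rewrite le_eqVlt; apply/orP; left; apply/eqP; rewrite /c; field.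
    by rewrite ?abn0 ?bn0 ?en0 ?rn0.
  have k0 : 0 <= beta^-1 * (4 * c)^-1 by rewrite ltW// mulr_gt0 ?invr_gt0 ?mulr_gt0.
  have h1 := ler_wpM2l k0 th2'.
  rewrite [leLHS]mulrA; apply: (le_trans h1).
  rewrite le_eqVlt; apply/orP; left; apply/eqP; rewrite /c; field.
  by rewrite ?abn0 ?bn0 ?en0 ?rn0.
have b11 : ip dx ds <= ip dx dx + eta ^+ 2 * beta ^+ 2 * (ip u u + ip eh eh)
    + eta ^+ 2 * (Lf ^+ 2 / (2 * beta ^+ 2 * rho2 ^+ 2)) * G.
  rewrite /ds ipDr.
  have h1 := @ip_young _ _ _ 2^-1 dx ((eta * beta) *: xh) ltac:(lra).
  have h2 := @ip_young _ _ _ 2^-1 dx (beta^-1 *: th) ltac:(lra).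
  have h3 : ip ((eta * beta) *: xh) ((eta * beta) *: xh) <=
      2 * (eta ^+ 2 * beta ^+ 2 * (ip u u + ip eh eh)).
    have := ip_ge0 (u - eh).
    rewrite ipZl ipZr /xh !ipS (ipC eh u) => h3.
    have k0 : 0 <= (eta * beta) ^+ 2 by rewrite sqr_ge0.
    have := ler_wpM2l k0 h3; lra.
  have h4 : ip (beta^-1 *: th) (beta^-1 *: th) <=
      2 * (eta ^+ 2 * (Lf ^+ 2 / (2 * beta ^+ 2 * rho2 ^+ 2)) * G).
    rewrite ipZl ipZr mulrA -expr2.
    apply: le_trans (ler_wpM2l (sqr_ge0 _) th2') _.
    rewrite le_eqVlt; apply/orP; left; apply/eqP; field.
    by rewrite ?abn0 ?bn0 ?en0 ?rn0.
  lra.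
have b12 : (alpha + beta) / (2 * beta) * ipL ds ds <=
    eta ^+ 2 * ((alpha + beta) * beta) * ipL xh xh
    + eta ^+ 2 * ((alpha + beta) * Lf ^+ 2 / (beta ^+ 3 * rho2)) * G.
  have k0 : 0 <= (alpha + beta) / (2 * beta).
    by rewrite divr_ge0 ?mulr_ge0 ?addr_ge0 ?ltW.
  have h1 : ipL ds ds <= 2 * ((eta * beta) ^+ 2 * ipL xh xh)
      + 2 * (beta^-1 ^+ 2 * (eta ^+ 2 * Lf ^+ 2 * G / rho2)).
    have h2 : beta^-1 ^+ 2 * ipL th th <= beta^-1 ^+ 2 * (eta ^+ 2 * Lf ^+ 2 * G / rho2).
      by rewrite ler_wpM2l ?sqr_ge0.
    have := L_ge0 ((eta * beta) *: xh + - beta^-1 *: th); rewrite -/(ipL _ _).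
    by rewrite /ds !(ipL_sqrD ((eta * beta) *: xh)) !ipLZl !ipLZr; lra.
  apply: le_trans (ler_wpM2l k0 h1) _.
  rewrite le_eqVlt; apply/orP; left; apply/eqP; field.
  by rewrite ?abn0 ?bn0 ?en0 ?rn0.
have e0 := ltW eta_gt0; have be0 := ltW beta_gt0; have al0 := ltW alpha_gt0.
have bD : (h + 3 / 2) * ip dx dx <= (h + 3 / 2) * (eta ^+ 2 *
    (5 / 2 * alpha ^+ 2 * rho * ipL xh xh + 2 * beta ^+ 2 * rho * ipL s s + 10 * gam)).
  rewrite ler_wpM2l ?addr_ge0//.
  apply: le_trans step_size_le _; rewrite ler_wpM2l ?sqr_ge0//; lra.
have := consensus_energy_step; rewrite xhE.
have ea : 0 <= eta * alpha by rewrite mulr_ge0.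
have eb : 0 <= eta * beta by rewrite mulr_ge0.
have c1 := ler_wpM2l ea uE.
have c2 := ler_wpM2l ea ehL.
have c3 := ler_wpM2l eb b2.
have c3' := ler_wpM2l eb ehL.
have c4 := ler_wpM2l e0 b3.
have c5 := ler_wpM2l e0 b4.
have c6 := ler_wpM2l eb b5.
move=> e; lra.
Qed.

End Step.

(** * Scalar bounds: coefficients of one step against the constants eps1, ..., eps6 *)

Section Coefficients.
Variables (R : realType) (n : nat) (p : params R) (L : 'M[R]_n).
Local Notation al := (par_alpha p).
Local Notation be := (par_beta p).
Local Notation et := (par_eta p).
Local Notation Lf := (par_Lf p).
Local Notation N := (par_phi p * par_psi p * par_r p).
Local Notation rho := (spectral_radius L).
Local Notation rho2 := (smallest_pos_eigenvalue L).
Local Notation h := ((2 + N) / N).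

Hypotheses (al0 : 0 < al) (be0 : 0 < be) (et0 : 0 < et) (Lf0 : 0 < Lf)
  (rho20 : 0 < rho2) (rho2_le : rho2 <= rho) (N0 : 0 < N) (N1 : N <= 1)
  (be_al : be <= al) (e12 : et * eps2 p L < eps1 p L)
  (e56 : et * eps6 p L < eps5 p L).

Lemma h_ge3 : 3 <= h.
Proof. by rewrite ler_pdivlMr//; have := N1; lra. Qed.

Lemma eps2E : eps2 p L = 3 * Lf ^+ 2 + 4 * h * ((al * rho) ^+ 2 + Lf ^+ 2)
  + 2 * be ^+ 2 + 1 + 3 * (al * rho) ^+ 2.
Proof. by rewrite /eps2; move: N (lt0r_neq0 N0) => N' N'0; field. Qed.

Let eps1E : eps1 p L = al * rho2 / 2 - (9 * be + 4 + 5 * Lf ^+ 2) / 4.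
Proof. by rewrite /eps1; field. Qed.

Let alrho2 : al * rho2 <= al * rho.
Proof. by rewrite ler_pM2l. Qed.

(** Since [eps2] is nonnegative, the step-size condition forces [eps1] > 0, and this is the same
    inequality rearranged. *)
Lemma alpha_rho_ge : 2 + 9 / 2 * be + 5 / 2 * Lf ^+ 2 <= al * rho2.
Proof.
have h3 : 0 <= 4 * h * ((al * rho) ^+ 2 + Lf ^+ 2).
  have h0 : 0 <= h by have := h_ge3; lra.
  by apply: mulr_ge0; [apply: mulr_ge0 | rewrite addr_ge0 ?sqr_ge0].
have : 0 <= et * eps2 p L.
  rewrite mulr_ge0 ?ltW// eps2E.
  have := sqr_ge0 Lf; have := sqr_ge0 (al * rho); have := sqr_ge0 be; lra.
have := e12; rewrite eps1E; lra.
Qed.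

(** Keep only 4 h (alpha rho)^2 from [eps2], bound [eps1] by alpha rho / 2, and divide by alpha
    rho. *)
Lemma eta_h_le : 8 * (al * rho) * (et * h) <= 1.
Proof.
have a2 := alpha_rho_ge; have aa := alrho2.
have L0 := sqr_ge0 Lf; have b0 := be0; have e0 := ltW et0; have h3 := h_ge3.
have a0 : 0 < al * rho by lra.
rewrite -(ler_pM2r a0) mul1r.
have h1 : et * (4 * h * (al * rho) ^+ 2) <= et * eps2 p L.
  rewrite ler_wpM2l// eps2E.
  have : 0 <= 4 * h * Lf ^+ 2 by apply: mulr_ge0 => //; lra.
  have := sqr_ge0 (al * rho); have := sqr_ge0 be; lra.
have := e12; rewrite eps1E; lra.
Qed.

Let eta_h16 : et * h <= 1 / 16.
Proof.
have a2 := alpha_rho_ge; have aa := alrho2.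
have L0 := sqr_ge0 Lf; have b0 := be0; have e0 := ltW et0; have h3 := h_ge3.
have eh0 : 0 <= et * h by rewrite mulr_ge0//; lra.
have : 2 * (et * h) <= al * rho * (et * h) by rewrite ler_wpM2r//; lra.
have := eta_h_le; lra.
Qed.

Lemma coef_u : - (al / 2) * rho2 + 1 + 5 / 4 * be + et * be ^+ 2
  + (3 / 4 + 10 * (h + 3 / 2) * et) * Lf ^+ 2 + 1 / 2 * Lf ^+ 2
  <= - (eps1 p L - et * eps2 p L).
Proof.
rewrite eps1E eps2E.
have a2 := alpha_rho_ge; have aa := alrho2.
have L0 := sqr_ge0 Lf; have b0 := be0; have e0 := et0; have h3 := h_ge3.
have eb : 0 <= et * be ^+ 2 by rewrite mulr_ge0 ?sqr_ge0// ltW.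
(* Both 5/2 Lf^2 and 2 are at most alpha rho. The left side has more h Lf^2 than [eps2] provides;
   the excess is charged to its (alpha rho)^2. *)
have a5 : 5 * Lf ^+ 2 <= (al * rho) ^+ 2.
  have : (5 / 2 * Lf ^+ 2) * 2 <= (al * rho) * (al * rho).
    by rewrite ler_pM//; lra.
  by rewrite -expr2; lra.
have eh0 : 0 <= et * h by rewrite mulr_ge0//; lra.
have h1 : et * h * (5 * Lf ^+ 2) <= et * h * (al * rho) ^+ 2 by rewrite ler_wpM2l.
have h2 : et * 3 * Lf ^+ 2 <= et * h * Lf ^+ 2.
  by rewrite ler_wpM2r// ler_wpM2l// ltW.
have h4 : 0 <= et * (al * rho) ^+ 2 by rewrite mulr_ge0 ?sqr_ge0// ltW.
have h5 : 0 <= et * Lf ^+ 2 by rewrite mulr_ge0 ?sqr_ge0// ltW.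
lra.
Qed.

Let eta_be : et * be <= 1 / 108.
Proof.
have a2 := alpha_rho_ge; have aa := alrho2.
have L0 := sqr_ge0 Lf; have b0 := be0; have e0 := et0; have h3 := h_ge3.
have h1 : et * (9 / 2 * be) <= et * (al * rho) by rewrite ler_pM2l//; lra.
have h2 : et * (al * rho) * 3 <= et * (al * rho) * h.
  by rewrite ler_wpM2l// mulr_ge0//; lra.
have := eta_h_le; lra.
Qed.

(** As h >= 3, h + 3/2 is at most 3/2 h, so the last term is at most 5/2 * 3/16 = 15/32 of alpha.
    The middle term fits in the remaining 1/32 because [et * be] is at most 1/108. *)
Lemma coef_xh : - (al / 2) + et * (al + be) * be
  + (h + 3 / 2) * et * (5 / 2 * al ^+ 2 * rho) <= 0.
Proof.
have a2 := alpha_rho_ge; have aa := alrho2.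
have L0 := sqr_ge0 Lf; have b0 := be0; have e0 := et0; have h3 := h_ge3.
have h1 : et * be * (al + be) <= 1 / 108 * (al + be).
  by rewrite ler_wpM2r// addr_ge0// ltW.
have ba := be_al.
have h2 : (h + 3 / 2) * (et * (al * rho)) <= 3 / 2 * h * (et * (al * rho)).
  by rewrite ler_wpM2r//; [rewrite mulr_ge0//; lra | lra].
have h4 : al * ((h + 3 / 2) * (et * (al * rho))) <= al * (3 / 2 / 8).
  by rewrite ler_pM2l//; have := eta_h_le; lra.
lra.
Qed.

Lemma coef_s : - (5 / 8) * be + rho2^-1 + (h + 3 / 2) * et * (2 * be ^+ 2 * rho)
  <= - (eps3 p L - et * eps4 p L).
Proof.
have -> : eps4 p L = 2 * be ^+ 2 * rho + 4 * h * be ^+ 2 * rho ^+ 2 + rho2^-1.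
  rewrite /eps4; move: N (lt0r_neq0 N0) => N' N'0; field.
  by rewrite N'0 lt0r_neq0.
rewrite /eps3.
have a2 := alpha_rho_ge; have aa := alrho2.
have L0 := sqr_ge0 Lf; have b0 := be0; have e0 := et0; have h3 := h_ge3.
have r0 : 0 < rho2^-1 by rewrite invr_gt0.
have er : 0 < et * rho2^-1 by rewrite mulr_gt0.
have eh0 : 0 <= et * h by rewrite mulr_ge0//; lra.
(* The square says 2 rho <= 4 rho^2 + 1/4. It trades 2 h beta^2 rho for the 4 h beta^2 rho^2 of
   [eps4]; the remaining h beta^2 / 4 is paid from the spare beta / 8. *)
have h1 : 0 <= et * h * be ^+ 2 * (2 * rho - 1 / 2) ^+ 2.
  by rewrite mulr_ge0 ?sqr_ge0// mulr_ge0 ?sqr_ge0.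
have h2 : et * h * be * (9 / 2 * be) <= et * h * be * (al * rho).
  by apply: ler_wpM2l; [apply: mulr_ge0 => //; exact: ltW | lra].
have h4 : be * (8 * (al * rho) * (et * h)) <= be * 1.
  by apply: ler_wpM2l; [exact: ltW | exact: eta_h_le].
have rr : 0 < rho by apply: lt_le_trans rho2_le.
have h5 : et * be * rho * be <= et * be * rho * al.
  by rewrite ler_wpM2l// !mulr_ge0// ltW.
have h6 : be * (al * rho) * (et * 3) <= be * (al * rho) * (et * h).
  by apply: ler_wpM2l; [rewrite !mulr_ge0 ?ltW | rewrite ler_pM2l].
lra.
Qed.

Lemma coef_eh : (al / 2 + be) * rho + be + et * be ^+ 2 <=
  1 / 2 * (al + 2 * be) * rho + 2 * be
  + et * (7 * al ^+ 2 * rho ^+ 2 + 2 * be ^+ 2 + 1).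
Proof.
have h1 : 0 <= et * (al ^+ 2 * rho ^+ 2).
  by apply: mulr_ge0; [exact: ltW | rewrite mulr_ge0 ?sqr_ge0].
have h2 : 0 <= et * be ^+ 2 by apply: mulr_ge0; [exact: ltW | exact: sqr_ge0].
have h3 : 0 < be * rho by rewrite mulr_gt0// (lt_le_trans rho20).
have := be0; have := et0; lra.
Qed.

(** Twice the inequality eta eps6 < eps5 bounds everything except eta h by 1/4, and eta h is at most
    1/16. The right side 1/2 is what the descent lemma makes available. *)
Lemma coef_G : 2 * (al + be) ^+ 2 * Lf ^+ 2 / (be ^+ 5 * rho2)
  + Lf ^+ 2 / (2 * be ^+ 2 * rho2 ^+ 2)
  + et * ((al + be) * Lf ^+ 2 / (be ^+ 3 * rho2)
          + Lf ^+ 2 / (2 * be ^+ 2 * rho2 ^+ 2))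
  + et * (Lf / 2 + h) <= 1 / 2.
Proof.
set B := Lf ^+ 2 / (2 * be ^+ 2 * rho2 ^+ 2).
have B0 : 0 <= B.
  apply: divr_ge0; rewrite ?sqr_ge0//; apply: mulr_ge0; last exact: sqr_ge0.
  by apply: mulr_ge0 => //; exact: sqr_ge0.
set A := (al + be) ^+ 2 * Lf ^+ 2 / (be ^+ 5 * rho2).
set C := (al + be) * Lf ^+ 2 / (be ^+ 3 * rho2).
have -> : 2 * (al + be) ^+ 2 * Lf ^+ 2 / (be ^+ 5 * rho2) = 2 * A.
  by rewrite /A !mulrA.
have E6 : eps6 p L = C / 2 + 3 * Lf ^+ 2 / 4 + B + Lf / 2.
  rewrite /eps6 -/B; congr (_ + _ + _ + _).
  by rewrite /C; field; rewrite !gt_eqF.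
have := e56; rewrite E6 /eps5 -/A -/B => h1.
have h2 := eta_h16.
have h3 : 0 <= et * B by rewrite mulr_ge0// ltW.
have h4 : 0 <= et * Lf ^+ 2 by rewrite mulr_ge0 ?sqr_ge0// ltW.
have h5 : 0 <= et * Lf by rewrite mulr_ge0// ltW.
lra.
Qed.

End Coefficients.

(** * Gradients and the descent lemma *)

Section Smooth.
Variables (R : realType) (d : nat).
Implicit Types (f : 'rV[R]_d -> R) (x y v : 'rV[R]_d).

Lemma derive_gradient f x v : differentiable f x -> 'D_v f x = ip (gradient f x) v.
Proof.
move=> df; rewrite (deriveE _ df) {1}(row_sum_delta v) linear_sum ipE big_ord1.
apply: eq_bigr => j _; rewrite linearZ /= mxE (deriveE _ df).
exact: mulrC.
Qed.

Lemma gradient_avg_fun n (f : 'I_n -> 'rV[R]_d -> R) x :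
  (forall i x, differentiable (f i) x) ->
  gradient (avg_fun f) x = n%:R^-1 *: \sum_i gradient (f i) x.
Proof.
move=> df; apply/rowP => j; rewrite !mxE summxE.
have -> : avg_fun f = n%:R^-1 \*: (\sum_i f i).
  by apply/funext => y; rewrite /avg_fun /= fct_sumE.
have dfi i : derivable (f i) x (delta_mx ord0 j) by exact: diff_derivable.
rewrite deriveZ; last exact: derivable_sum.
rewrite derive_sum//; congr (_ * _); apply: eq_bigr => i _.
by rewrite mxE.
Qed.

Lemma is_derive_line f x v t : differentiable f (x + t *: v) ->
  is_derive t 1 (fun s => f (x + s *: v)) (ip (gradient f (x + t *: v)) v).
Proof.
move=> df; have dv : derivable f (x + t *: v) v by exact: diff_derivable.
have E : (fun h : R => h^-1 *: (((fun s => f (x + s *: v)) \o shift t) (h *: (1 : R))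
    - f (x + t *: v))) =
  (fun h => h^-1 *: ((f \o shift (x + t *: v)) (h *: v) - f (x + t *: v))).
  apply/funext => h /=; rewrite /shift /= [(h *: 1 + t) *: v]scalerDl addrCA.
  by rewrite [h *: 1]mulr1.
by split; [rewrite /derivable E | rewrite /derive E -/(derive _ _ _) derive_gradient].
Qed.

Lemma lipschitz_gradient_sqr f (l : R) x y : 0 <= l -> lipschitz_gradient l f ->
  ip (gradient f x - gradient f y) (gradient f x - gradient f y)
    <= l ^+ 2 * ip (x - y) (x - y).
Proof.
move=> l0 lf; rewrite -!enorm_sqr -exprMn; apply: lerXn2r; rewrite ?nnegrE ?lf//.
  exact: sqrtr_ge0.
by rewrite mulr_ge0// sqrtr_ge0.
Qed.

(** The mean value theorem is applied on the segment to f minus its quadratic upper model; the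
    derivative of this difference is nonpositive by the Lipschitz bound. *)
Lemma descent_lemma f (l : R) x y : 0 < l -> (forall x, differentiable f x) ->
  lipschitz_gradient l f ->
  f y <= f x + ip (gradient f x) (y - x) + l / 2 * ip (y - x) (y - x).
Proof.
move=> l0 df lf; set v := y - x.
pose phi : R -> R := (fun t => f (x + t *: v)) -
  (ip (gradient f x) v *: @id R + (l / 2 * ip v v) *: (@id R * @id R)).
pose dphi (t : R) := ip (gradient f (x + t *: v)) v - (ip (gradient f x) v *: 1
  + (l / 2 * ip v v) *: (t *: 1 + t *: 1)).
have dp t : is_derive t (1 : R) phi (dphi t).
  by have h1 := is_derive_line (df (x + t *: v)); apply: is_deriveB.
have cphi : ({within `[0, 1], continuous phi})%classic.
  apply: continuous_subspaceT => t; apply: differentiable_continuous.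
  by apply/derivable1_diffP; have [] := dp t.
have [c] := @MVT _ phi dphi 0 1 ltr01 (fun t _ => dp t) cphi.
rewrite in_itv /= => /andP[c0 c1]; rewrite subr0 mulr1.
rewrite /phi /dphi !fctE /= scale1r scale0r addr0 (addrC x v) subrK.
rewrite /GRing.scale /=.
(* With this weight Young's inequality does the work of Cauchy-Schwarz: both halves are at most l c
   / 2 times |v|^2. The mean value point satisfies c > 0. *)
have := @ip_young _ _ _ (2 * l * c)^-1 (gradient f (x + c *: v) - gradient f x) v.
have lc : 0 < 2 * l * c by rewrite !mulr_gt0.
rewrite invr_gt0 => /(_ lc).
have := @lipschitz_gradient_sqr f l (x + c *: v) x (ltW l0) lf.
rewrite (addrC x) addrK ipZl ipZr => h1 h2.
have h3 : ip (gradient f (c *: v + x) - gradient f x) v <= l * c * ip v v.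
  apply: (le_trans h2).
  have -> : (4 * (2 * l * c)^-1)^-1 = l * c / 2 by field; rewrite !gt_eqF.
  have := ler_wpM2l (ltW (_ : 0 < (2 * l * c)^-1)) h1; rewrite invr_gt0 => /(_ lc).
  have -> : (2 * l * c)^-1 * (l ^+ 2 * (c * (c * ip v v))) = l * c / 2 * ip v v.
    by field; rewrite !gt_eqF.
  lra.
move: h3; rewrite ipDl ipNl => h3 e.
lra.
Qed.

End Smooth.

(** The scalar part of [energy_decrease], separated so that [lra] sees only variables. [G0] and [G]
    are the squared averaged gradients at the average and at [X], [Gam] that of their difference;
    [G0] feeds the Polyak-Lojasiewicz inequality and [G] pays for the drift. *)
Lemma energy_decrease_combine (R : realFieldType)
    (et nu h D CE CE' E1 E3 cU cGam l2 lf cS cX cE cG c uu ss xx ee G G0 Gam gg gap gap' M : R) :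
  0 <= et ->
  CE' + h * D <= CE + et * cU * uu + et * cGam * (l2 * uu) + et * cS * ss
    + et * cX * xx + et * cE * ee + et * cG * G ->
  et * (cU + cGam * l2 + 1 / 2 * l2) * uu <= et * (- E1) * uu ->
  et * cS * ss <= et * (- E3) * ss ->
  et * cX * xx <= et * 0 * xx ->
  cE <= c -> ee <= M -> 0 <= ee -> 0 <= c -> 0 <= gg ->
  et * (cG + et * (lf / 2 + h)) * G <= et * (1 / 2) * G ->
  gap' <= gap - et / 2 * (G0 + G - Gam) + lf / 2 * et ^+ 2 * G ->
  2 * nu * gap <= G0 -> Gam + gg <= l2 * uu ->
  CE' + gap' + h * (et ^+ 2 * G + D) <=
    CE + gap - et * E1 * uu - et * E3 * ss - et * nu * gap + et * c * M.
Proof.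
move=> e0 ce cu cs cx cm eM ee0 c0 gg0 cGG gp pl gG.
have h1 : et * (2 * nu * gap) <= et * G0 by rewrite ler_wpM2l.
have h2 : et * Gam <= et * (l2 * uu) by rewrite ler_wpM2l//; lra.
have h3 : et * cE * ee <= et * c * M.
  by rewrite -!mulrA ler_wpM2l//; apply: (@le_trans _ _ (c * ee)); rewrite ?ler_wpM2r ?ler_wpM2l.
lra.
Qed.

(** * One step of the stacked iteration decreases the energy *)

Section DescentStep.
Variables (R : realType) (n d : nat) (A : 'M[R]_n) (p : params R).
Variables (f : 'I_n -> 'rV[R]_d -> R) (fstar : R).
Local Notation al := (par_alpha p).
Local Notation be := (par_beta p).
Local Notation et := (par_eta p).
Local Notation Lf := (par_Lf p).
Local Notation nu := (par_nu p).
Local Notation N := (par_phi p * par_psi p * par_r p).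
Local Notation L := (laplacian A).
Local Notation rho := (spectral_radius L).
Local Notation rho2 := (smallest_pos_eigenvalue L).
Local Notation h := ((2 + N) / N).
Local Notation J := (avg_mx R n).
Local Notation Qp := (laplacian_pinv A).

Definition row_mean (X : 'M[R]_(n, d)) : 'rV[R]_d := average (fun i => row i X).
Definition grad_mx (X : 'M[R]_(n, d)) : 'M[R]_(n, d) :=
  \matrix_(i < n) gradient (f i) (row i X).
Definition centered (X : 'M[R]_(n, d)) := X - J *m X.
(** For [V] of mean zero, [L] maps this to V + K g0 / beta: it vanishes when beta V cancels the
    disagreement of the local gradients. *)
Definition dual_err (X V : 'M[R]_(n, d)) :=
  Qp *m (V + be^-1 *: grad_mx (J *m X)).
(** The factor n lets stacked gradients enter with weight one. *)
Definition opt_gap (X : 'M[R]_(n, d)) := n%:R * (avg_fun f (row_mean X) - fstar).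
Definition energy (X V : 'M[R]_(n, d)) :=
  consensus_energy L al be (centered X) (dual_err X V) + opt_gap X.

Hypotheses (hn : (1 < n)%N) (hA : weighted_graph A) (hconn : graph_connected A).

Let sL := tr_laplacian hA.
Let sJ := tr_avg_mx R n.

Let L_ge0 (X : 'M[R]_(n, d)) : 0 <= ip X (L *m X).
Proof. by apply: psd_ip => //; exact: psd_laplacian. Qed.

Let L_le (X : 'M[R]_(n, d)) : ip X (L *m X) <= rho * ip X X.
Proof.
have sM : (rho%:M - L)^T = rho%:M - L by rewrite linearB /= tr_scalar_mx sL.
have := psd_ip X sM (psd_spectral_radius hn hA hconn).
by rewrite mulmxBl mul_scalar_mx ipDr ipNr ipZr subr_ge0.
Qed.

Lemma laplacian_ge (X : 'M[R]_(n, d)) : J *m X = 0 -> rho2 * ip X X <= ipL L X X.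
Proof.
move=> JX.
have sM : (L - rho2 *: (1%:M - J))^T = L - rho2 *: (1%:M - J).
  by rewrite linearB /= sL linearZ /= linearB /= tr_scalar_mx sJ.
have := psd_ip X sM (psd_smallest_pos_eigenvalue hn hA hconn).
by rewrite mulmxBl -scalemxAl [(1%:M - J) *m X]mulmxBl JX mul1mx subr0 ipDr ipNr ipZr subr_ge0.
Qed.

Let rho2_gt0 : 0 < rho2. Proof. exact: smallest_pos_eigenvalue_gt0. Qed.
Let rho2_le : rho2 <= rho. Proof. exact: smallest_pos_eigenvalue_le. Qed.
Let rho_gt0 : 0 < rho. Proof. exact: lt_le_trans rho2_le. Qed.

Let nR0 : (n%:R : R) != 0.
Proof. by rewrite pnatr_eq0 -lt0n ltnW. Qed.

Lemma row_avg_mx (X : 'M[R]_(n, d)) i : row i (J *m X) = row_mean X.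
Proof.
apply/rowP => j; rewrite avg_mx_mul !mxE summxE; congr (_ * _).
by apply: eq_bigr => k _; rewrite mxE.
Qed.

Lemma mul_avg_centered (X : 'M[R]_(n, d)) : J *m centered X = 0.
Proof. by rewrite mulmxBr mulmxA avg_mx_idem// subrr. Qed.

Lemma ip_avg_mx (X Y : 'M[R]_(n, d)) : ip (J *m X) (J *m Y) = ip X (J *m Y).
Proof. by rewrite ip_mull sJ mulmxA avg_mx_idem. Qed.

Lemma ip_avg_orth (X Y : 'M[R]_(n, d)) : J *m X = 0 -> ip X (J *m Y) = 0.
Proof. by move=> JX; rewrite -ip_avg_mx JX ip0l. Qed.

Lemma ip_pythagoras (X : 'M[R]_(n, d)) :
  ip X X = ip (J *m X) (J *m X) + ip (centered X) (centered X).
Proof.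
rewrite -[in LHS](subrK (J *m X) X) -/(centered X) ip_sqrD.
by rewrite (ip_avg_orth _ (mul_avg_centered X)); ring.
Qed.

Lemma mul_laplacian_centered (X : 'M[R]_(n, d)) : L *m centered X = L *m X.
Proof. by rewrite mulmxBr mulmxA laplacian_avg_mx// mul0mx subr0. Qed.

Lemma centeredD (X Y : 'M[R]_(n, d)) : centered (X + Y) = centered X + centered Y.
Proof. by rewrite /centered mulmxDr opprD addrACA. Qed.

Lemma centeredZ c (X : 'M[R]_(n, d)) : centered (c *: X) = c *: centered X.
Proof. by rewrite /centered -scalemxAr -scalerBr. Qed.

Lemma centeredB (X Y : 'M[R]_(n, d)) : centered (X - Y) = centered X - centered Y.
Proof. by rewrite centeredD -scaleN1r centeredZ scaleN1r. Qed.

Lemma centered_laplacian (X : 'M[R]_(n, d)) : centered (L *m X) = L *m X.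
Proof. by rewrite /centered mulmxA avg_mx_laplacian// mul0mx subr0. Qed.

Lemma laplacian_pinvE (X : 'M[R]_(n, d)) : L *m (Qp *m X) = centered X.
Proof. by rewrite mulmxA laplacian_pinvK// mulmxBl mul1mx. Qed.

Lemma pinv_laplacianE (X : 'M[R]_(n, d)) : Qp *m (L *m X) = centered X.
Proof. by rewrite mulmxA laplacian_pinvKl// mulmxBl mul1mx. Qed.

Lemma mul_avg_pinv (X : 'M[R]_(n, d)) : J *m (Qp *m X) = 0.
Proof. by rewrite mulmxA avg_laplacian_pinv// mul0mx. Qed.

(** For W = Q X the form is <W, X>. Young's inequality with weight rho2 / 2 produces rho2 / 2 |W|^2,
    of which at most half of the form is needed. *)
Lemma ipL_pinv_le (X : 'M[R]_(n, d)) : rho2 * ipL L (Qp *m X) (Qp *m X) <= ip X X.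
Proof.
have e : ipL L (Qp *m X) (Qp *m X) = ip (Qp *m X) X.
  by rewrite /ipL laplacian_pinvE ipDr ipNr (ip_avg_orth _ (mul_avg_pinv X)) subr0.
have r20 := rho2_gt0.
have r2 : 0 < rho2 / 2 by rewrite divr_gt0.
have h1 := ip_young (Qp *m X) X r2.
have h2 := laplacian_ge (mul_avg_pinv X).
rewrite -ler_pdivlMl//.
move: h1 h2; rewrite -e (_ : (4 * (rho2 / 2))^-1 = rho2^-1 / 2); last first.
  by field; rewrite gt_eqF.
move: (ipL _ _ _) (ip (Qp *m X) _) (ip X X) => a b c h1 h2; lra.
Qed.

Lemma ip_pinv_le (X : 'M[R]_(n, d)) :
  rho2 ^+ 2 * ip (Qp *m X) (Qp *m X) <= ip X X.
Proof.
apply: le_trans (ipL_pinv_le X); rewrite expr2 -mulrA ler_pM2l//.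
exact: laplacian_ge (mul_avg_pinv X).
Qed.

Hypotheses (hdiff : forall i x, differentiable (f i) x) (Lf_gt0 : 0 < Lf)
  (hlip : forall i, lipschitz_gradient Lf (f i))
  (hmin : is_minimum (avg_fun f) fstar)
  (hPL : polyak_lojasiewicz nu (avg_fun f) fstar).

Lemma opt_gap_ge0 X : 0 <= opt_gap X.
Proof. by rewrite mulr_ge0// subr_ge0; case: hmin. Qed.

Lemma grad_mx_lipschitz X Y : ip (grad_mx X - grad_mx Y) (grad_mx X - grad_mx Y)
  <= Lf ^+ 2 * ip (X - Y) (X - Y).
Proof.
rewrite ip_rows [X in _ * X]ip_rows mulr_sumr; apply: ler_sum => i _.
by rewrite !linearB /= !rowK lipschitz_gradient_sqr// ltW.
Qed.

Lemma opt_gap_descent X X' : opt_gap X' <= opt_gap X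
  + ip (grad_mx (J *m X)) (J *m X' - J *m X)
  + Lf / 2 * ip (J *m X' - J *m X) (J *m X' - J *m X).
Proof.
rewrite /opt_gap /avg_fun !mulrBr !mulrA !mulfV// !mul1r.
rewrite -addrA -addrA [X in _ <= _ + X]addrC !addrA lerD2r -addrA.
rewrite ip_rows [X in _ + _ * X]ip_rows mulr_sumr -!big_split /=.
apply: ler_sum => i _; rewrite !linearB /= rowK !row_avg_mx addrA.
exact: descent_lemma.
Qed.

Lemma opt_gap_PL X : 2 * nu * opt_gap X <= ip (J *m grad_mx (J *m X)) (J *m grad_mx (J *m X)).
Proof.
have -> : ip (J *m grad_mx (J *m X)) (J *m grad_mx (J *m X)) =
    n%:R * ip (gradient (avg_fun f) (row_mean X)) (gradient (avg_fun f) (row_mean X)).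
  rewrite ip_rows; under eq_bigr do rewrite row_avg_mx.
  rewrite sumr_const card_ord -[LHS]mulr_natl gradient_avg_fun//.
  suff -> : row_mean (grad_mx (J *m X)) =
      n%:R^-1 *: \sum_i gradient (f i) (row_mean X) by [].
  by congr (_ *: _); apply: eq_bigr => i _; rewrite rowK row_avg_mx.
have := hPL (row_mean X); rewrite enorm_sqr => h1.
have := ler_wpM2l (ler0n R n) h1; rewrite /opt_gap; lra.
Qed.

Let G X := ip (J *m grad_mx X) (J *m grad_mx X).
Let Gam X := ip (J *m (grad_mx X - grad_mx (J *m X))) (J *m (grad_mx X - grad_mx (J *m X))).

(** Polarizing the inner product of the two averaged gradients, rather than estimating it, keeps
    both of their squares with a negative sign. *)
Lemma opt_gap_step X X' : J *m X' - J *m X = - et *: (J *m grad_mx X) ->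
  opt_gap X' <= opt_gap X - et / 2 * (G (J *m X) + G X - Gam X)
    + Lf / 2 * et ^+ 2 * G X.
Proof.
move=> e; apply: le_trans (opt_gap_descent X X') _.
have -> : ip (J *m X' - J *m X) (J *m X' - J *m X) = et ^+ 2 * G X.
  by rewrite e ipZl ipZr mulrA mulrNN -expr2.
rewrite e ipZr -ip_avg_mx /Gam mulmxBr ip_sqrB /G.
move: (ip _ _) (ip (J *m grad_mx (J *m X)) (J *m grad_mx (J *m X)))
  (ip (J *m grad_mx (J *m X)) (J *m grad_mx X)) (opt_gap X) => a b c e'; lra.
Qed.

Hypotheses (al_gt0 : 0 < al) (be_gt0 : 0 < be) (et_gt0 : 0 < et)
  (N_gt0 : 0 < N) (N_le1 : N <= 1) (be_al : be <= al)
  (e12 : et * eps2 p L < eps1 p L) (e56 : et * eps6 p L < eps5 p L).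

Lemma energy_decrease (X V Xh : 'M[R]_(n, d))
    (X' := X - et *: (al *: (L *m Xh) + be *: V + grad_mx X))
    (V' := V + (et * be) *: (L *m Xh)) : J *m V = 0 ->
  energy X' V' + h * ip (X' - X) (X' - X) <= energy X V
  - et * (eps1 p L - et * eps2 p L) * ip (centered X) (centered X)
  - et * (eps3 p L - et * eps4 p L) * ipL L (dual_err X V) (dual_err X V)
  - et * nu * opt_gap X
  + et * (1 / 2 * (al + 2 * be) * rho + 2 * be
      + et * (7 * al ^+ 2 * rho ^+ 2 + 2 * be ^+ 2 + 1)) * ip (Xh - X) (Xh - X).
Proof.
move=> JV.
pose u := centered X; pose eh := centered (Xh - X); pose s := dual_err X V.
pose g0 := grad_mx (J *m X); pose g := centered (grad_mx X - g0).
pose dl := grad_mx (J *m X') - g0; pose th := Qp *m dl.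
pose dx := - et *: (al *: (L *m (u + eh)) + be *: (L *m s) + g).
pose ds := (et * be) *: (u + eh) + be^-1 *: th.
have bn0 : be != 0 by rewrite gt_eqF.
have ue : u + eh = centered Xh by rewrite /u /eh centeredB addrC subrK.
have Ls : L *m s = V + be^-1 *: centered g0.
  by rewrite /s laplacian_pinvE centeredD centeredZ {1}/centered JV subr0.
have uE : centered X' = u + dx.
  rewrite /X' centeredB centeredZ !centeredD !centeredZ centered_laplacian.
  rewrite {2}/centered JV subr0 /dx ue mul_laplacian_centered.
  rewrite Ls [be *: (V + _)]scalerDr scalerA mulfV// scale1r /g centeredB scaleNr.
  rewrite /u; congr (_ - _ *: _).
  move: (centered (grad_mx X)) (centered g0) => c1 c2.
  by rewrite -!addrA; congr (_ + (_ + _)); rewrite addrC subrK.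
have sE : dual_err X' V' = s + ds.
  rewrite /s /dual_err /V' /ds ue -(pinv_laplacianE Xh) /th /dl /g0.
  rewrite [(et * be) *: (Qp *m _)]scalemxAr [_ *: (Qp *m (_ - _))]scalemxAr -!(mulmxDr Qp).
  congr (_ *m _); rewrite scalerBr.
  move: (_ *: (L *m Xh)) (_ *: grad_mx _) (_ *: grad_mx _) => c1 c2 c3.
  rewrite -!addrA; congr (_ + _); rewrite [RHS]addrCA; congr (_ + _).
  by rewrite [RHS]addrC subrK.
have JX' : J *m X' - J *m X = - et *: (J *m grad_mx X).
  rewrite /X' mulmxBr -scalemxAr !mulmxDr -!scalemxAr JV mulmxA avg_mx_laplacian//.
  by rewrite mul0mx !scaler0 !add0r addrC addKr scaleNr.
have JdX : ip (J *m X' - J *m X) (J *m X' - J *m X) = et ^+ 2 * G X.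
  by rewrite JX' ipZl ipZr mulrA mulrNN -expr2.
(* The increment splits orthogonally: the average part is charged to [G], the centred part is the
   [h * ip dx dx] carried by [consensus_energy_decrease]. *)
have dXE : ip (X' - X) (X' - X) = et ^+ 2 * G X + ip dx dx.
  by rewrite ip_pythagoras mulmxBr JdX centeredB uE (addrC u) addrK.
have dl_le : ip dl dl <= et ^+ 2 * Lf ^+ 2 * G X.
  apply: le_trans (grad_mx_lipschitz _ _) _.
  by rewrite JdX mulrCA mulrA.
have thL := le_trans (ipL_pinv_le dl) dl_le.
have th2 := le_trans (ip_pinv_le dl) dl_le.
(* The averaged and centred parts of one gradient difference share a single Lipschitz bound. *)
have gG : Gam X + ip g g <= Lf ^+ 2 * ip u u.
  by rewrite -ip_pythagoras; exact: grad_mx_lipschitz.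
have gle : ip g g <= Lf ^+ 2 * ip u u.
  by apply: le_trans gG; rewrite lerDr ip_ge0.
have uL : rho2 * ip u u <= ipL L u u by apply: laplacian_ge; exact: mul_avg_centered.
have sL2 : rho2 * ip s s <= ipL L s s by apply: laplacian_ge; exact: mul_avg_pinv.
have h_ge0 : 0 <= h by apply: le_trans (h_ge3 N_gt0 N_le1).
have ehM : ip eh eh <= ip (Xh - X) (Xh - X).
  by rewrite [leRHS]ip_pythagoras lerDr ip_ge0.
have ce := @consensus_energy_decrease R n d L rho rho2 sL L_ge0 L_le rho_gt0 al be et
  al_gt0 be_gt0 et_gt0 rho2_gt0 u eh s g th Lf (G X) (Lf ^+ 2 * ip u u) h h_ge0 uL sL2
  gle thL th2.
have e0 := ltW et_gt0.
have scale (a b c : R) : a <= b -> 0 <= c -> et * a * c <= et * b * c.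
  by move=> ab c0; rewrite ler_wpM2r// ler_wpM2l.
have cu := scale _ _ (ip u u) (@coef_u R n p L al_gt0 be_gt0 et_gt0 rho2_le N_gt0 N_le1 e12)
  (ip_ge0 u).
have cs := scale _ _ (ipL L s s) (@coef_s R n p L al_gt0 be_gt0 et_gt0 rho2_gt0 rho2_le
  N_gt0 N_le1 be_al e12) (L_ge0 s).
have cx := scale _ _ (ipL L (u + eh) (u + eh)) (@coef_xh R n p L al_gt0 be_gt0 et_gt0 rho2_le
  N_gt0 N_le1 be_al e12) (L_ge0 (u + eh)).
have cm := @coef_eh R n p L be_gt0 et_gt0 rho2_gt0 rho2_le.
have cG := scale _ _ (G X) (@coef_G R n p L al_gt0 be_gt0 et_gt0 Lf_gt0 rho2_gt0 rho2_le
  N_gt0 N_le1 e12 e56) (ip_ge0 _).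
have c0 : 0 <= 1 / 2 * (al + 2 * be) * rho + 2 * be
      + et * (7 * al ^+ 2 * rho ^+ 2 + 2 * be ^+ 2 + 1).
  by rewrite !(mulr_ge0, addr_ge0) ?ltW.
rewrite /energy uE sE dXE.
apply: (energy_decrease_combine e0 ce cu cs cx cm ehM (ip_ge0 eh) c0 (ip_ge0 g) cG
  (opt_gap_step JX') (opt_gap_PL X) gG).
Qed.

End DescentStep.

(** The scalar part of [lyapunov_step]. The terms [h * D] cancel between energy and tracking error,
    and replacing [M] gives the new feedback error [EE'] the total weight [t0 + 2 * et * g]. *)
Lemma lyapunov_step_combine (R : realFieldType)
    (et nu h D en en' a1 a3 uu ss gap g M YY' b1 b2 b3 b4
    yy q EE' zz qh sg r ee E11 k c t0 : R) :
  0 <= et -> 0 <= t0 -> 0 <= g -> 0 <= uu -> 0 <= ss -> 0 <= gap -> 0 <= c ->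
  c * E11 = k ->
  k <= et * a1 -> k <= et * a3 -> k <= et * nu ->
  en' + h * D <= en - et * a1 * uu - et * a3 * ss - et * nu * gap + et * g * M ->
  YY' <= b1 * (b2 * yy + b3 * q) + h * D ->
  EE' <= b4 * qh + 2 * (1 - r) ^+ 2 * zz ->
  M <= 2 * sg ^+ 2 * ee + 2 * EE' ->
  en <= E11 * (uu + ss + gap) ->
  en' + YY' + t0 * EE' <= (1 - c) * en + 2 * et * g * sg ^+ 2 * ee
    + b1 * b2 * yy + b1 * b3 * q + (t0 + 2 * et * g) * b4 * qh
    + (t0 + 2 * et * g) * (2 * (1 - r) ^+ 2) * zz.
Proof.
move=> e0 t00 g0 u0 s0 gp0 c0 <- k1 k2 k3 ed hY hE hM el.
have h1 := ler_wpM2l c0 el.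
have h2 := ler_wpM2r u0 k1.
have h3 := ler_wpM2r s0 k2.
have h4 := ler_wpM2r gp0 k3.
have eg : 0 <= et * g by rewrite mulr_ge0.
have h5 := ler_wpM2l eg hM.
have h6 := ler_wpM2l eg hE.
have h7 := ler_wpM2l t00 hE.
lra.
Qed.

(** * The Lyapunov function and its pathwise increment *)

Section LyapunovStep.
Variables (R : realType) (n d : nat) (A : 'M[R]_n) (p : params R).
Variables (f : 'I_n -> 'rV[R]_d -> R) (fstar : R).
Local Notation al := (par_alpha p).
Local Notation be := (par_beta p).
Local Notation et := (par_eta p).
Local Notation psi := (par_psi p).
Local Notation sg := (par_sigma p).
Local Notation Lf := (par_Lf p).
Local Notation nu := (par_nu p).
Local Notation phi := (par_phi p).
Local Notation r := (par_r p).
Local Notation t0 := (par_tau0 p).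
Local Notation N := (phi * psi * r).
Local Notation L := (laplacian A).
Local Notation rho := (spectral_radius L).
Local Notation rho2 := (smallest_pos_eigenvalue L).
Local Notation J := (avg_mx R n).
Local Notation gap := (@opt_gap R n d f fstar).
Local Notation E11 := (eps11 p L).
Local Notation E12 := (check_eps12 p L).
Local Notation ceps := (check_eps p L).

Hypotheses (hn : (1 < n)%N) (hA : weighted_graph A) (hconn : graph_connected A)
  (hdiff : forall i x, differentiable (f i) x) (Lf_gt0 : 0 < Lf)
  (hlip : forall i, lipschitz_gradient Lf (f i))
  (hmin : is_minimum (avg_fun f) fstar)
  (hPL : polyak_lojasiewicz nu (avg_fun f) fstar)
  (al_gt0 : 0 < al) (be_gt0 : 0 < be) (et_gt0 : 0 < et)
  (N_gt0 : 0 < N) (N_le1 : N <= 1) (be_al : be <= al)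
  (e12 : et * eps2 p L < eps1 p L) (e56 : et * eps6 p L < eps5 p L).

Let rho2_gt0 : 0 < rho2. Proof. exact: smallest_pos_eigenvalue_gt0. Qed.
Let rho2_le : rho2 <= rho. Proof. exact: smallest_pos_eigenvalue_le. Qed.

(** The Young weight is dictated by [eps11]: added to the diagonal weights 1/2 and (alpha + beta) /
    (2 beta), the two coefficients give the two entries of its maximum. *)
Lemma consensus_cross_le (X : 'M[R]_(n, d)) V :
  `|ip (centered X) (dual_err A p f X V)|
    <= be / (2 * (al * rho2)) * ip (centered X) (centered X)
       + al / (2 * be) * ipL L (dual_err A p f X V) (dual_err A p f X V).
Proof.
set u := centered X; set s := dual_err A p f X V.
have ar0 : 0 < al * rho2 by rewrite mulr_gt0.
have c0 : 0 < be / (2 * (al * rho2)) by rewrite divr_gt0// mulr_gt0.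
have sL : ip s s <= rho2^-1 * ipL L s s.
  by rewrite ler_pdivlMl// laplacian_ge// mul_avg_pinv.
have sL2 : (4 * (be / (2 * (al * rho2))))^-1 * ip s s <= al / (2 * be) * ipL L s s.
  have k0 : 0 <= (4 * (be / (2 * (al * rho2))))^-1 by rewrite invr_ge0 mulr_ge0 ?ltW.
  apply: le_trans (ler_wpM2l k0 sL) _.
  rewrite [leLHS]mulrA le_eqVlt; apply/orP; left; apply/eqP; congr (_ * _); field.
  by rewrite !lt0r_neq0.
rewrite ler_norml; apply/andP; split.
  rewrite lerNl -ipNl; apply: le_trans (ip_young _ _ c0) _.
  by rewrite ipNl ipNr opprK lerD2l.
by apply: le_trans (ip_young _ _ c0) _; rewrite lerD2l.
Qed.

(** The cross term takes less of [ipL s s] than the energy contains, and of |u|^2 at most 1/9,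
    because alpha rho2 >= 9/2 beta; 1/2 - 1/9 exceeds 1/3. *)
Lemma energy_ge (X V : 'M[R]_(n, d)) :
  3^-1 * ip (centered X) (centered X) + gap X <= energy A p f fstar X V.
Proof.
have /ler_normlP[h1 _] := consensus_cross_le X V.
rewrite /energy lerD2r /consensus_energy.
set u := centered X in h1 *; set s := dual_err A p f X V in h1 *.
have c9 : be / (2 * (al * rho2)) <= 9^-1.
  rewrite ler_pdivrMr ?mulr_gt0//.
  have := alpha_rho_ge et_gt0 N_gt0 N_le1 e12.
  by have := sqr_ge0 Lf; move: (al * rho2) (Lf ^+ 2) => x y; lra.
have h2 := ler_wpM2r (ip_ge0 u) c9.
have s0 : 0 <= ipL L s s by apply: psd_ip; [exact: tr_laplacian|exact: psd_laplacian].
have u0 := ip_ge0 u.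
have -> : (al + be) / (2 * be) = al / (2 * be) + 2^-1 by field; rewrite lt0r_neq0.
move: h1 h2 s0 u0; move: (ip u u) (ip u s) (ipL L s s) => a b c.
move: (be / _) (al / _) => k1 k2; lra.
Qed.

Lemma energy_ge0 (X V : 'M[R]_(n, d)) : 0 <= energy A p f fstar X V.
Proof.
apply: le_trans (energy_ge X V).
by apply: addr_ge0; [rewrite mulr_ge0 ?ip_ge0 | exact: opt_gap_ge0].
Qed.

Lemma eps11_ge1 : 1 <= E11.
Proof.
have : 1 <= 1 / 2 + al / be.
  have : 1 <= al / be by rewrite ler_pdivlMr// mul1r.
  by move: (al / be) => x; lra.
by move=> /le_trans; apply; rewrite /eps11 le_max lexx.
Qed.

Lemma energy_le (X V : 'M[R]_(n, d)) : energy A p f fstar X V <=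
  E11 * (ip (centered X) (centered X)
    + ipL L (dual_err A p f X V) (dual_err A p f X V) + gap X).
Proof.
have /ler_normlP[_ h1] := consensus_cross_le X V.
rewrite /energy /consensus_energy.
set u := centered X in h1 *; set s := dual_err A p f X V in h1 *.
have s0 : 0 <= ipL L s s by apply: psd_ip; [exact: tr_laplacian|exact: psd_laplacian].
have k1 : 2^-1 + be / (2 * (al * rho2)) <= E11.
  rewrite /eps11 le_max; apply/orP; right; rewrite le_eqVlt; apply/orP; left.
  by apply/eqP; field; rewrite !lt0r_neq0.
have k2 : (al + be) / (2 * be) + al / (2 * be) <= E11.
  rewrite /eps11 le_max; apply/orP; left; rewrite le_eqVlt; apply/orP; left.
  by apply/eqP; field; rewrite !lt0r_neq0.
have h2 := ler_wpM2r (ip_ge0 u) k1.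
have h3 := ler_wpM2r s0 k2.
have h4 := ler_wpM2r (opt_gap_ge0 hmin X) eps11_ge1.
move: h1 h2 h3 h4; move: (ip u u) (ip u s) (ipL L s s) (gap X) => a b c g.
move: (be / _) (al / _) ((al + be) / _) => x y z; lra.
Qed.

(** [Y - psi *: Q] is the convex combination of [Y] and [Y - r^-1 *: Q] with weight psi r, so
    convexity of the square applies. Young's inequality with weight N / 4 then separates [D] and
    produces the factor h = (2 + N) / N. *)
Lemma tracking_sqr_le (Y Q D : 'M[R]_(n, d)) : 0 < r -> 0 <= psi -> psi * r <= 1 ->
  ip (Y - psi *: Q + D) (Y - psi *: Q + D) <=
    (1 + N / 2) * ((1 - psi * r) * ip Y Y
       + psi * r * ip (r^-1 *: Q - Y) (r^-1 *: Q - Y))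
    + (2 + N) / N * ip D D.
Proof.
move=> r0 p0 pr.
set Z := Y - psi *: Q.
have hZ : ip Z Z <= (1 - psi * r) * ip Y Y
    + psi * r * ip (r^-1 *: Q - Y) (r^-1 *: Q - Y).
  have -> : Z = Y - (psi * r) *: (r^-1 *: Q) by rewrite /Z scalerA mulfK ?lt0r_neq0.
  have t0' : 0 <= psi * r by rewrite mulr_ge0// ltW.
  move: (r^-1 *: Q) (psi * r) pr t0' => W t pr t0'.
  have h1 : 0 <= t * (1 - t) * ip W W.
    by rewrite mulr_ge0 ?ip_ge0// mulr_ge0// subr_ge0.
  rewrite !ip_sqrB !ipZl ipZr (ipC W Y).
  by move: h1; move: (ip W W) (ip Y W) (ip Y Y) => a b c; lra.
have N4 : 0 < N / 4 by rewrite divr_gt0.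
have hD : ip (Z + D) (Z + D) <= (1 + N / 2) * ip Z Z + (2 + N) / N * ip D D.
  have := ip_young Z D N4; rewrite ip_sqrD.
  have -> : (4 * (N / 4))^-1 = N^-1.
    by move: N N_gt0 => x x0; field; rewrite lt0r_neq0.
  have -> : (2 + N) / N = 1 + 2 * N^-1.
    by move: N N_gt0 => x x0; field; rewrite lt0r_neq0.
  by have := ip_ge0 D; move: (ip Z D) (ip Z Z) (ip D D) (N) (N^-1) => a b c x y; lra.
apply: le_trans hD _; rewrite lerD2r; apply: ler_wpM2l hZ.
by rewrite addr_ge0// divr_ge0// ltW.
Qed.

(** Z - Q is (1 - r) Z minus r times the relative compression error. In expectation the two
    coefficients become the two terms of [r0]. *)
Lemma compression_sqr_le (Z Q : 'M[R]_(n, d)) : 0 < r ->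
  ip (Z - Q) (Z - Q) <= 2 * r ^+ 2 * ip (r^-1 *: Q - Z) (r^-1 *: Q - Z)
    + 2 * (1 - r) ^+ 2 * ip Z Z.
Proof.
move=> r0; have {1 2}-> : Q = r *: (r^-1 *: Q) by rewrite scalerA mulfV ?scale1r ?lt0r_neq0.
move: (r^-1 *: Q) => W.
have := ip_ge0 (r *: (W - Z) + (1 - r) *: Z).
rewrite (ip_sqrD (r *: (W - Z))) (ip_sqrB Z) (ip_sqrB W) !ipZl !ipZr (ip_sqrB W).
rewrite ipDl ipNl (ipC W Z); move: (ip W W) (ip Z W) (ip Z Z) => a b c; lra.
Qed.

(** [et * gain] is the price of |Xh - X|^2 in [energy_decrease]. *)
Definition gain := 1 / 2 * (al + 2 * be) * rho + 2 * be
      + et * (7 * al ^+ 2 * rho ^+ 2 + 2 * be ^+ 2 + 1).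

Definition lyapunov (X V Y E : 'M[R]_(n, d)) :=
  energy A p f fstar X V + ip Y Y + t0 * ip E E.

Lemma gain_ge0 : 0 <= gain.
Proof.
have rho0 : 0 < rho by exact: lt_le_trans rho2_le.
by rewrite /gain !(mulr_ge0, addr_ge0) ?ltW.
Qed.

(* The randomness of the step enters only through the relative compression
   errors [ip (r^-1 *: Q - Y)] and [ip (r^-1 *: Qh - Z)]. *)
Lemma lyapunov_step (X V Y E Q Qh : 'M[R]_(n, d))
  (Xh := X - Y + Qh) (Z := sg *: E + Y)
  (X' := X - et *: (al *: (L *m Xh) + be *: V + grad_mx f X))
  (V' := V + (et * be) *: (L *m Xh)) : J *m V = 0 ->
  0 < r -> 0 <= psi -> psi * r <= 1 -> 0 <= t0 ->
  0 <= E12 -> E12 <= et * (eps1 p L - et * eps2 p L) ->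
  E12 <= et * (eps3 p L - et * eps4 p L) -> E12 <= et * nu ->
  lyapunov X' V' (Y - psi *: Q + (X' - X)) (Z - Qh) <=
    (1 - ceps) * energy A p f fstar X V
    + 2 * et * gain * sg ^+ 2 * ip E E
    + (1 + N / 2) * (1 - psi * r) * ip Y Y
    + (1 + N / 2) * (psi * r) * ip (r^-1 *: Q - Y) (r^-1 *: Q - Y)
    + (t0 + 2 * et * gain) * (2 * r ^+ 2) * ip (r^-1 *: Qh - Z) (r^-1 *: Qh - Z)
    + (t0 + 2 * et * gain) * (2 * (1 - r) ^+ 2) * ip Z Z.
Proof.
move=> JV r0 p0 pr t00 c0 c1 c2 c3.
have ed := energy_decrease hn hA hconn hdiff Lf_gt0 hlip hPL al_gt0 be_gt0
  et_gt0 N_gt0 N_le1 be_al e12 e56 X Xh JV.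
rewrite -/X' -/V' -/gain in ed.
have hY := tracking_sqr_le Y Q (X' - X) r0 p0 pr.
have hE := compression_sqr_le Z Qh r0.
have hXh : ip (Xh - X) (Xh - X) <= 2 * sg ^+ 2 * ip E E + 2 * ip (Z - Qh) (Z - Qh).
  (* [Z - Qh] is the next feedback error. *)
  have -> : Xh - X = sg *: E - (Z - Qh).
    by apply/matrixP => i j; rewrite !mxE; ring.
  have := ip_ge0 (sg *: E + (Z - Qh)).
  move: (Z - Qh) => W; rewrite (ip_sqrB (sg *: E) W) (ip_sqrD (sg *: E) W) (ipC W).
  by rewrite !ipZl !ipZr; move: (ip E E) (ip E W) (ip W W) => c4 c5 c6; lra.
have el := energy_le X V.
have k11 : ceps * E11 = E12.
  by rewrite /check_eps divfK// gt_eqF// (lt_le_trans ltr01 eps11_ge1).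
have ce0 : 0 <= ceps by rewrite divr_ge0// (le_trans ler01 eps11_ge1).
have s0 : 0 <= ipL L (dual_err A p f X V) (dual_err A p f X V).
  by apply: psd_ip; [exact: tr_laplacian|exact: psd_laplacian].
exact: (lyapunov_step_combine (ltW et_gt0) t00 gain_ge0 (ip_ge0 (centered X)) s0
  (opt_gap_ge0 hmin X) ce0 k11 c1 c2 c3 ed hY hE hXh el).
Qed.

End LyapunovStep.

Lemma lt_quadratic_root (R : rcfType) (a b c x : R) : 0 < a -> 0 <= b -> 0 <= x ->
  x < (Num.sqrt (b ^+ 2 + 4 * a * c) - b) / (2 * a) -> a * x ^+ 2 + b * x < c.
Proof.
move=> a0 b0 x0; rewrite ltr_pdivlMr ?mulr_gt0// ltrBrDr => h.
have y0 : 0 <= x * (2 * a) + b by rewrite addr_ge0// !mulr_ge0// ltW.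
(* [Num.sqrt] is 0 on negative numbers, so a positive root certifies a positive discriminant. *)
have s0 : 0 < Num.sqrt (b ^+ 2 + 4 * a * c) by exact: le_lt_trans h.
have : (x * (2 * a) + b) ^+ 2 < Num.sqrt (b ^+ 2 + 4 * a * c) ^+ 2.
  by rewrite ltr_pXn2r// nnegrE// ltW.
rewrite sqr_sqrtr; last by rewrite ltW// -sqrtr_gt0.
move=> h2; have a4 : 0 < 4 * a by rewrite mulr_gt0.
by rewrite -(ltr_pM2l a4); lra.
Qed.

(** * Admissible parameters *)

Section ParameterFacts.
Variables (R : realType) (n : nat) (A : 'M[R]_n) (p : params R).
Local Notation al := (par_alpha p).
Local Notation be := (par_beta p).
Local Notation et := (par_eta p).
Local Notation psi := (par_psi p).
Local Notation sg := (par_sigma p).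
Local Notation Lf := (par_Lf p).
Local Notation nu := (par_nu p).
Local Notation phi := (par_phi p).
Local Notation r := (par_r p).
Local Notation r1 := (par_r1 p).
Local Notation t0 := (par_tau0 p).
Local Notation N := (phi * psi * r).
Local Notation L := (laplacian A).
Local Notation rho := (spectral_radius L).
Local Notation rho2 := (smallest_pos_eigenvalue L).
Local Notation E11 := (eps11 p L).
Local Notation E12 := (check_eps12 p L).
Local Notation ceps := (check_eps p L).
Local Notation r0 := (r0 p).
Local Notation r2 := (r2 p).
Local Notation gain := (gain A p).

Hypotheses (hn : (1 < n)%N) (hA : weighted_graph A) (hconn : graph_connected A)
  (hLf : 0 < Lf) (hnu : 0 < nu) (hphi : 0 < phi <= 1) (hr : 0 < r) (hr1 : 1 < r1)
  (hkappa1 : kappa1_bound p L <= par_kappa1 p) (htau0 : 0 < t0)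
  (halpha : al = par_kappa1 p * be) (hbeta : kappa2 p L < be) (heta : 0 < et)
  (heta' : ((par_eta p)%:E < check_kappa3 p L)%E) (hsigma : 0 < sg) (hpsi : 0 < psi)
  (hpsi' : psi <= 1 / r).

Let rho2_gt0 : 0 < rho2. Proof. exact: smallest_pos_eigenvalue_gt0. Qed.
Let rho2_le : rho2 <= rho. Proof. exact: smallest_pos_eigenvalue_le. Qed.
Let rho_gt0 : 0 < rho. Proof. exact: lt_le_trans rho2_le. Qed.

Lemma beta_gt0 : 0 < be.
Proof.
apply: le_lt_trans hbeta; rewrite /kappa2 le_max; apply/orP; left.
by rewrite /kappa5 le_max; apply/orP; right; rewrite divr_ge0// ltW.
Qed.

Lemma beta_le_alpha : be <= al.
Proof.
rewrite halpha ler_peMl ?(ltW beta_gt0)//; apply: le_trans hkappa1.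
by rewrite /kappa1_bound le_max lexx orbT.
Qed.

Lemma alpha_gt0 : 0 < al.
Proof. exact: lt_le_trans beta_gt0 beta_le_alpha. Qed.

Lemma psi_r_le1 : psi * r <= 1.
Proof. by rewrite -ler_pdivlMr. Qed.

Lemma N_gt0 : 0 < N.
Proof. by case/andP: hphi => h _; rewrite !mulr_gt0. Qed.

Lemma N_le1 : N <= 1.
Proof.
by case/andP: hphi => h h1; rewrite -mulrA mulr_ile1// ?psi_r_le1// ltW// mulr_gt0.
Qed.

Lemma r0_ge0 : 0 <= r0.
Proof.
case/andP: hphi => h h1.
apply: addr_ge0; last by rewrite mulr_ge0 ?sqr_ge0.
by rewrite mulr_ge0 ?subr_ge0// mulr_ge0 ?sqr_ge0.
Qed.

Lemma r2_gt0 : 0 < r2.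
Proof. by rewrite divr_gt0 ?subr_gt0// (lt_trans ltr01). Qed.

Lemma eta_eps12 : et * eps2 p L < eps1 p L.
Proof.
have := heta'; rewrite /check_kappa3 lt_min lte_fin => /andP[+ _].
rewrite ltr_pdivlMr// eps2E ?N_gt0//.
have h0 : 0 <= 4 * ((2 + N) / N).
  by rewrite mulr_ge0// divr_ge0 ?addr_ge0// ltW// N_gt0.
have h1 := mulr_ge0 h0 (addr_ge0 (sqr_ge0 (al * rho)) (sqr_ge0 Lf)).
have := sqr_ge0 Lf; have := sqr_ge0 be; have := sqr_ge0 (al * rho); lra.
Qed.

Lemma eta_eps34 : et * eps4 p L < eps3 p L.
Proof.
have := heta'; rewrite /check_kappa3 !lt_min !lte_fin => /and3P[_ + _].
rewrite ltr_pdivlMr// /eps4.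
have h1 : 0 <= 2 * be ^+ 2 * rho by rewrite mulr_ge0 ?(ltW rho_gt0)// mulr_ge0 ?sqr_ge0.
have h2 : 0 <= 4 * (2 + N) * be ^+ 2 * rho ^+ 2 / N.
  have N0 := N_gt0.
  apply: divr_ge0 (ltW N0); apply: mulr_ge0 (sqr_ge0 _); apply: mulr_ge0 (sqr_ge0 _).
  by rewrite mulr_ge0// addr_ge0// ltW.
have : 0 < rho2^-1 by rewrite invr_gt0.
lra.
Qed.

Lemma eta_eps56 : et * eps6 p L < eps5 p L.
Proof.
have := heta'; rewrite /check_kappa3 !lt_min !lte_fin => /and4P[_ _ + _].
rewrite ltr_pdivlMr// /eps6.
have be0 := beta_gt0; have al0 := alpha_gt0.
have h1 : 0 <= (al + be) * Lf ^+ 2 / (2 * be ^+ 3 * rho2).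
  by rewrite divr_ge0 ?mulr_ge0 ?addr_ge0 ?exprn_ge0 ?(ltW be0) ?(ltW al0) ?(ltW hLf)
    ?(ltW rho2_gt0).
have h2 : 0 <= Lf ^+ 2 / (2 * be ^+ 2 * rho2 ^+ 2).
  by rewrite divr_ge0 ?mulr_ge0 ?exprn_ge0 ?(ltW be0) ?(ltW hLf)
    ?(ltW rho2_gt0).
have := sqr_ge0 Lf; have := hLf; lra.
Qed.

Let al2rho2_ge0 : 0 <= al ^+ 2 * rho ^+ 2.
Proof. by rewrite mulr_ge0 ?sqr_ge0. Qed.

Lemma tau3_gt0 : 0 < tau3 p L.
Proof.
have := heta'; rewrite /check_kappa3 !lt_min => /and5P[_ _ _ + _].
have al0 := alpha_gt0; have be0 := beta_gt0; have N0 := N_gt0.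
(* When r0 = 0, [tau1] is infinite and gives no bound on eta, but then eps8 = eps9 = 0 and [tau3] is
   just [eps7]. *)
rewrite /tau1; have [r00 _|r0n0] := eqVneq r0 0.
  rewrite /tau3 /eps8 /eps9 r00 !mulr0 !mul0r !addr0 !mulr0 !subr0.
  by rewrite /eps7 !mulr_gt0 ?invr_gt0 ?addr_gt0 ?N0//; case/andP: hphi.
have r0_gt0 : 0 < r0 by rewrite lt_def r0n0 r0_ge0.
have e8 : 0 <= eps8 p L.
  rewrite /eps8 addr_ge0// mulr_ge0 ?r0_ge0// ?mulr_ge0 ?addr_ge0 ?mulr_ge0 ?invr_ge0//;
  by rewrite ltW.
have e9 : 0 < eps9 p L.
  rewrite /eps9 ltr_wpDl//; last first.
    by rewrite mulr_gt0// ltr_wpDl// mulr_ge0 ?sqr_ge0.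
  rewrite divr_ge0 ?(ltW N0)// mulr_ge0 ?r0_ge0// -mulrA mulr_ge0//.
  have : 0 < 7 * phi * psi * r by rewrite -!mulrA mulr_gt0// mulrA.
  lra.
rewrite lte_fin => h.
have := @lt_quadratic_root R (r2 * eps9 p L) (r2 * eps8 p L)
  ((eps7 p - r0 * r2 * t0) / 2) et (mulr_gt0 r2_gt0 e9) (mulr_ge0 (ltW r2_gt0) e8)
  (ltW heta).
rewrite exprMn [4 * _ * _](_ : _ = 2 * r2 * eps9 p L * (eps7 p - r0 * r2 * t0)); last first.
  by field.
rewrite [2 * (r2 * _)]mulrA => /(_ h); rewrite /tau3; lra.
Qed.

Let gainE : gain = 1 / 2 * (al + 2 * be) * rho + 2 * be
      + et * (7 * (al ^+ 2 * rho ^+ 2) + 2 * be ^+ 2 + 1).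
Proof. by rewrite /gain mulrA. Qed.

Lemma check_eps89 : et * check_eps8 p L + et ^+ 2 * check_eps9 p L
  = 2 * et * gain * (r0 * r1 + 1) * sg ^+ 2.
Proof. by rewrite gainE /check_eps8 /check_eps9; field. Qed.

Let r01 : 0 < r0 * r1 + 1.
Proof. by rewrite ltr_wpDl// mulr_ge0 ?r0_ge0// ltW// (lt_trans ltr01). Qed.

Lemma tau4_gt0 : 0 < tau4 p L.
Proof.
have := heta'; rewrite /check_kappa3 !lt_min !lte_fin => /and5P[_ _ _ _].
have al0 := alpha_gt0; have be0 := beta_gt0.
have s2 : 0 < sg ^+ 2 by rewrite exprn_gt0.
have e8 : 0 <= check_eps8 p L.
  rewrite /check_eps8 mulr_ge0 ?(ltW s2)// mulr_ge0 ?(ltW r01)//.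
  by rewrite addr_ge0 ?mulr_ge0 ?addr_ge0 ?mulr_ge0 ?(ltW al0) ?(ltW be0) ?(ltW rho_gt0).
have e9 : 0 < check_eps9 p L.
  rewrite /check_eps9 mulr_gt0// mulr_gt0// mulr_gt0//.
  have := sqr_ge0 be; have := al2rho2_ge0; lra.
move=> h.
have := @lt_quadratic_root R _ _ ((1 - r0 * r1 * sg ^+ 2) * t0) et e9 e8 (ltW heta).
rewrite [4 * _ * _](_ : _ = 4 * (1 - r0 * r1 * sg ^+ 2) * t0 * check_eps9 p L); last by ring.
by move=> /(_ h); rewrite /tau4; lra.
Qed.

Lemma check_eps12_gt0 : 0 < E12.
Proof.
rewrite /check_eps12 mulr_gt0// !lt_min !subr_gt0 eta_eps12 eta_eps34 /=.
by rewrite !divr_gt0 ?tau3_gt0 ?tau4_gt0 ?mulr_gt0.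
Qed.

Lemma check_eps12_le : [/\ E12 <= et * (eps1 p L - et * eps2 p L),
  E12 <= et * (eps3 p L - et * eps4 p L), E12 <= et * nu, E12 <= tau3 p L &
  E12 <= tau4 p L / t0].
Proof.
have tt : tau4 p L / t0 = et * (tau4 p L / (et * t0)).
  by field; rewrite !gt_eqF.
have t3 : tau3 p L = et * (tau3 p L / et) by field; rewrite gt_eqF.
have nn : nu / 2 <= nu by have := hnu; lra.
rewrite tt [in X in [/\ _, _, _, X & _]]t3 /check_eps12 !ler_pM2l//.
by split; rewrite !ge_min ?lexx ?nn ?orbT.
Qed.

(** For the upper bound, [tau4] is strictly below [t0] because [gain] is positive, so
    [E12 <= tau4 / t0 < 1 <= E11]. *)
Lemma check_eps_range : 0 < ceps < 1.
Proof.
have E11_ge1 : 1 <= E11 := eps11_ge1 A beta_gt0 beta_le_alpha.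
have E11_gt0 : 0 < E11 by exact: lt_le_trans E11_ge1.
rewrite divr_gt0 ?check_eps12_gt0//= ltr_pdivrMr// mul1r.
apply: lt_le_trans E11_ge1; have [_ _ _ _ h] := check_eps12_le.
apply: le_lt_trans h _; rewrite ltr_pdivrMr// mul1r /tau4.
rewrite -addrA -opprD check_eps89.
have al0 := alpha_gt0; have be0 := beta_gt0.
have g0 : 0 < gain.
  rewrite gainE; have h1 : 0 <= 1 / 2 * (al + 2 * be) * rho.
    by rewrite !mulr_ge0 ?addr_ge0 ?mulr_ge0 ?(ltW al0) ?(ltW be0) ?(ltW rho_gt0).
  have h2 : 0 <= et * (7 * (al ^+ 2 * rho ^+ 2) + 2 * be ^+ 2 + 1).
    apply: mulr_ge0; first exact: ltW.
    have := sqr_ge0 be; have := al2rho2_ge0; lra.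
  lra.
have h1 : 0 < 2 * et * gain * (r0 * r1 + 1) * sg ^+ 2 by rewrite !mulr_gt0 ?exprn_gt0.
have h2 : 0 <= r0 * r1 * sg ^+ 2 * t0.
  by rewrite !mulr_ge0 ?sqr_ge0 ?r0_ge0 ?(ltW htau0)// ltW// (lt_trans ltr01).
lra.
Qed.

Lemma check_eps_le_check_eps12 : ceps <= E12.
Proof.
have E11_ge1 : 1 <= E11 := eps11_ge1 A beta_gt0 beta_le_alpha.
rewrite ler_pdivrMr ?(lt_le_trans ltr01)// ler_peMr// ltW//.
exact: check_eps12_gt0.
Qed.

(** The first two terms are (1 + N/2)(1 - N) = 1 - eps7, the others add up to (t0 + 2 eta gain) r0
    r2. With r0 gain <= eps8 + eta eps9 the whole is at most 1 - tau3. *)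
Lemma contraction_Y : (1 + N / 2) * (1 - psi * r)
  + (1 + N / 2) * (psi * r) * (1 - phi)
  + (t0 + 2 * et * gain) * (2 * r ^+ 2) * ((1 - phi) * r2)
  + (t0 + 2 * et * gain) * (2 * (1 - r) ^+ 2) * r2 <= 1 - ceps.
Proof.
have [_ _ _ h _] := check_eps12_le.
have := le_trans check_eps_le_check_eps12 h; rewrite /tau3 => {}h.
have hg : r0 * gain <= eps8 p L + et * eps9 p L.
  have -> : eps9 p L = (8 / N + 7) * (al ^+ 2 * rho ^+ 2) * r0 + (2 * be ^+ 2 + 1) * r0.
    rewrite /eps9 -!(mulrA 7); congr (_ + _).
    by move: N N_gt0 => x x0; field; rewrite gt_eqF.
  rewrite gainE /eps8.
  have : 0 <= 8 / N * (al ^+ 2 * rho ^+ 2) * r0 * et.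
    by rewrite !mulr_ge0 ?invr_ge0 ?r0_ge0 ?(ltW N_gt0) ?(ltW heta)// ?exprn_ge0
      ?(ltW alpha_gt0) ?(ltW rho_gt0).
  by move: (8 / N) => y; lra.
have := ler_wpM2l (mulr_ge0 (ler0n R 2) (mulr_ge0 (ltW heta) (ltW r2_gt0))) hg.
have er0 : 2 * r ^+ 2 * (1 - phi) + 2 * (1 - r) ^+ 2 = r0 by [].
move: h; rewrite /eps7 -er0.
move: (eps8 p L) (eps9 p L) gain r2 ceps => x y g z c; lra.
Qed.

(** The left side equals t0 - tau4, by [check_eps89]. *)
Lemma contraction_E : 2 * et * gain * sg ^+ 2
  + (t0 + 2 * et * gain) * (2 * r ^+ 2) * ((1 - phi) * (r1 * sg ^+ 2))
  + (t0 + 2 * et * gain) * (2 * (1 - r) ^+ 2) * (r1 * sg ^+ 2) <= (1 - ceps) * t0.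
Proof.
have [_ _ _ _ h] := check_eps12_le.
have := le_trans check_eps_le_check_eps12 h; rewrite ler_pdivlMr// /tau4.
rewrite -[X in _ <= X]addrA -opprD check_eps89.
have er0 : 2 * r ^+ 2 * (1 - phi) + 2 * (1 - r) ^+ 2 = r0 by [].
rewrite -er0; move: gain ceps => g c; lra.
Qed.

End ParameterFacts.

(** * Fresh seeds *)

Section BorelRowVectors.
Variables (R : realType) (d : nat).
Local Open Scope classical_set_scope.

(** Every open set is a countable union of boxes with rational centres and radii 1 / (m + 1), and
    the preimage of a box is a finite intersection of coordinate preimages. *)
Lemma measurable_rV dT (T : measurableType dT) (g : T -> borel_rV R d) :
  (forall j, measurable_fun setT (fun t => (g t : 'rV[R]_d) ord0 j)) ->
  measurable_fun setT g.
Proof.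
move=> mg; apply: (@measurability _ _ _ _ setT g (@open 'rV[R]_d)) => // _ [U oU <-].
rewrite setTI.
pose box (c : 'rV[rat]_d * nat) : set 'rV[R]_d :=
  [set x | forall j, ball (ratr (c.1 ord0 j) : R) c.2.+1%:R^-1 (x ord0 j)].
(* Boxes that leave [U] contribute the empty set, so the union can run over the whole countable
   index type. *)
pose F c : set T := if pselect (box c `<=` U) then g @^-1` box c else set0.
have -> : g @^-1` U = \bigcup_c F c.
  apply/seteqP; split => [t Ut|t [c _]]; last first.
    by rewrite /F; case: pselect => // cU; exact: cU.
  move: oU; rewrite openE => /(_ _ Ut) /nbhs_ballP[e /= e0 eU].
  have [m me] : exists m : nat, m.+1%:R^-1 < e / 2.
    have /ltr_add_invr[m] : 0 < e / 2 by rewrite divr_gt0.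
    by rewrite add0r; exists m.
  have m0 : 0 < (m.+1%:R^-1 : R) by rewrite invr_gt0.
  have rq j : exists q : rat, ball (ratr q : R) m.+1%:R^-1 ((g t : 'rV[R]_d) ord0 j).
    set y := (g t : 'rV[R]_d) ord0 j.
    have /rat_in_itvoo[q] : y - m.+1%:R^-1 < y by rewrite ltrBlDr ltrDl.
    rewrite inE /= => /andP[]; rewrite !bnd_simp => q1 q2; exists q.
    by rewrite /ball /= ltr_distl q1 (lt_trans q2)// ltrDl.
  have [q qP] := choice rq.
  exists (\row_j q j, m) => //; rewrite /F; case: pselect => [bU|]; last first.
    case=> x bx; apply: eU; split => // i j; rewrite ord1.
    have := bx j; have := qP j; rewrite !mxE /= /ball /= => h1 h2.
    rewrite (le_lt_trans (ler_distD (ratr (q j)) _ _))// distrC.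
    by apply: lt_trans (ltrD h1 h2) _; rewrite [ltRHS]splitr ltrD.
  by move=> j /=; rewrite mxE; exact: qP.
apply: countable_bigcupT_measurable => [|c]; first exact: countableP.
rewrite /F; case: pselect => [bU|nbU]; last exact: measurable0.
rewrite (_ : g @^-1` box c = \bigcap_(j in [set: 'I_d])
    (fun t => (g t : 'rV[R]_d) ord0 j) @^-1` ball (ratr (c.1 ord0 j) : R) c.2.+1%:R^-1); last first.
  by apply/seteqP; split => [t bt j _|t bt j]; [exact: bt | exact: bt].
apply: fin_bigcap_measurable; first exact: finite_finset.
move=> j _; rewrite -[X in measurable X]setTI; apply: mg => //.
by rewrite ball_itv; exact: measurable_itv.
Qed.

Lemma continuous_measurable_rV (h : 'rV[R]_d -> R) :
  continuous h -> measurable_fun setT (h : borel_rV R d -> R).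
Proof.
move=> ch; apply: (measurability _ (RGenOpens.measurableE R)) => // _ [_ [a [b ->]] <-].
rewrite setTI; apply: sub_sigma_algebra.
by move/continuousP : ch; apply; exact: interval_open.
Qed.

Lemma measurable_rV_coord dT (T : measurableType dT) (g : T -> borel_rV R d) j :
  measurable_fun setT g -> measurable_fun setT (fun t => (g t : 'rV[R]_d) ord0 j).
Proof.
move=> mg.
apply: (measurableT_comp (f := (fun x : borel_rV R d => (x : 'rV[R]_d) ord0 j))) => //.
by apply: continuous_measurable_rV; exact: coord_continuous.
Qed.

(** The Lipschitz bound is Euclidean, the topology that of the sup norm; continuity of y |-> |x -
    y|^2 links them. *)
Lemma gradient_coord_continuous (f : 'rV[R]_d -> R) (l : R) j : 0 < l ->
  lipschitz_gradient l f -> continuous (fun x => gradient f x ord0 j).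
Proof.
move=> l0 lf x; have xF := @nbhs_filter (matrix R 1 d) x.
apply/(@cvgrPdist_lt _ _ _ _ xF) => e e0.
have : (fun y : 'rV[R]_d => ip (x - y) ((x - y) *m 1%:M)) y @[y --> x] --> (0 : R).
  rewrite -[X in _ --> X](_ : ip (x - x) ((x - x) *m 1%:M) = 0); last by rewrite subrr ip0l.
  apply: (@continuous_comp _ _ _ (fun y : 'rV[R]_d => x - y)
    (fun y : 'rV[R]_d => ip y (y *m 1%:M))); last exact: ip_continuous.
  by apply: cvgB; [exact: cvg_cst | exact: cvg_id].
move=> /(@cvgrPdist_lt _ _ _ _ xF) /(_ ((e / l) ^+ 2)).
rewrite exprn_gt0 ?divr_gt0// => /(_ isT).
apply: (@filterS _ _ xF) => y; rewrite mulmx1 sub0r normrN ger0_norm ?ip_ge0// => h.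
rewrite -(@ltr_pXn2r _ 2) ?nnegrE ?normr_ge0 ?(ltW e0)// real_normK ?num_real//.
have h2 := lipschitz_gradient_sqr x y (ltW l0) lf.
apply: (@le_lt_trans _ _ (ip (gradient f x - gradient f y) (gradient f x - gradient f y))).
  rewrite ipE big_ord1 (bigD1 j)//= !mxE -expr2 lerDl sumr_ge0// => k _.
  by rewrite -expr2 sqr_ge0.
apply: le_lt_trans h2 _; rewrite -ltr_pdivlMl ?exprn_gt0//.
by rewrite mulrC -expr_div_n.
Qed.

End BorelRowVectors.

(** * Independence of one seed from the others *)

Section Independence.
Variables (R : realType) (dO dZ : measure_display) (Omega : measurableType dO)
  (Z : measurableType dZ) (P : probability Omega R) (J : eqType)
  (xi : J -> Omega -> Z).
Hypotheses (mxi : forall j, measurable_fun setT (xi j))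
  (ixi : mutually_independent P xi).
Local Open Scope classical_set_scope.

(** A pi-system generating the sigma-algebra of the seeds with index in [S]. *)
Definition cylinders (S : pred J) : set (set Omega) :=
  [set A | exists s : seq J, exists B : J -> set Z,
    [/\ uniq s, all S s, forall j, measurable (B j) &
        A = \bigcap_(j in [set` s]) (xi j @^-1` B j)]].

Lemma measurable_seed j (B : set Z) : measurable B -> measurable (xi j @^-1` B).
Proof. by move=> mB; rewrite -[X in measurable X]setTI; exact: mxi. Qed.

Lemma measurable_cylinder S A : cylinders S A -> measurable A.
Proof.
move=> [s [B [_ _ mB ->]]]; apply: fin_bigcap_measurable => // j _.
exact: measurable_seed.
Qed.

Lemma measurable_cylinders S A : <<s cylinders S >> A -> measurable A.
Proof.
move: A; apply: smallest_sub; last exact: measurable_cylinder.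
exact: sigma_algebra_measurable.
Qed.

Lemma setI_closed_cylinders S : setI_closed (cylinders S).
Proof.
move=> _ _ [s [B [us sS mB ->]]] [s' [B' [us' sS' mB' ->]]].
exists (undup (s ++ s')).
exists (fun j => (if j \in s then B j else setT) `&` (if j \in s' then B' j else setT)).
split.
- exact: undup_uniq.
- by apply/allP => j; rewrite mem_undup mem_cat => /orP[/(allP sS)|/(allP sS')].
- by move=> j; apply: measurableI; case: ifP.
- apply/seteqP; split => [w [h h'] j /= _|w h].
    by split; case: ifPn => // js; [exact: h | exact: h'].
  split=> j /= js; have := h j; rewrite /= mem_undup mem_cat js ?orbT => /(_ isT) [].
    by [].
  by [].
Qed.

(** Dynkin's pi-lambda argument: the events independent of a fixed [D] form a lambda-system, which
    contains the cylinders. *)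
Lemma cylinders_indep S j0 (C : set Z) A : ~~ S j0 -> measurable C ->
  <<s cylinders S >> A -> P (A `&` xi j0 @^-1` C) = (P A * P (xi j0 @^-1` C))%E.
Proof.
move=> Sj0 mC.
set D := xi j0 @^-1` C; have mD : measurable D by exact: measurable_seed.
pose H : set (set Omega) := [set A | measurable A /\ P (A `&` D) = (P A * P D)%E].
suff : <<s cylinders S >> `<=` H by move=> h /h [].
apply: lambda_system_subset => //; first exact: setI_closed_cylinders.
- split => //.
  + by split => //; rewrite setTI probability_setT mul1e.
  + move=> X Y YX [mX hX] [mY hY]; split; first exact: measurableD.
    have mXD : measurable (X `&` D) by exact: measurableI.
    have mYD : measurable (Y `&` D) by exact: measurableI.
    have -> : (X `\` Y) `&` D = (X `&` D) `\` (Y `&` D).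
      by apply/seteqP; split => [w [[? ?] ?]|w [[? ?] /not_andP[]]] //; split => //; case.
    rewrite !measureD ?(le_lt_trans (probability_le1 _ _)) ?ltry//.
    rewrite (setIidr YX) (setIidr (_ : Y `&` D `<=` X `&` D)); last first.
      by move=> w [/YX].
    transitivity (P X * P D - P Y * P D)%E; first by congr (_ - _)%E.
    by rewrite muleBl ?fin_num_measure// fin_num_adde_defr// fin_num_measure.
  + move=> F ndF HF.
    have mF k : measurable (F k) by have [] := HF k.
    split; first exact: bigcupT_measurable.
    have c1 := @nondecreasing_cvg_mu _ _ _ P _ mF (bigcupT_measurable _ mF) ndF.
    have mFD k : measurable (F k `&` D) by exact: measurableI.
    have c2 := @nondecreasing_cvg_mu _ _ _ P (fun k => F k `&` D) mFD
      (bigcupT_measurable _ mFD) _.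
    rewrite setI_bigcupl; apply: (cvg_unique _ (c2 _)) => //.
      by move=> m k mk; apply/subsetPset; apply: setSI; apply/subsetPset/ndF.
    rewrite (_ : _ \o _ = fun k => (P (F k) * P D)%E); last first.
      by apply/funext => k /=; have [_ ->] := HF k.
    by apply: cvgeZr => //; exact: fin_num_measure.
- move=> A' cA; split; first exact: measurable_cylinder cA.
  have [s [B [us sS mB ->]]] := cA.
  have j0s : j0 \notin s by apply: contra Sj0 => /(allP sS).
  (* As [j0] is outside [s], intersecting with [D] gives a cylinder over [j0 :: s], to which mutual
     independence applies. *)
  pose B' j := if j == j0 then C else B j.
  have mB' j : measurable (B' j) by rewrite /B'; case: ifP.
  have u' : uniq (j0 :: s) by rewrite /= j0s.
  have e : \bigcap_(j in [set` s]) (xi j @^-1` B j) `&` D =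
      \bigcap_(j in [set` j0 :: s]) (xi j @^-1` B' j).
    apply/seteqP; split => [w [h hD] j /=|w h].
      rewrite inE /B'; have [-> _|_ /= js] := eqVneq j j0; [exact: hD | exact: h].
    split => [j /= js|].
      have := h j; rewrite /= inE js orbT => /(_ isT); rewrite /B'.
      by case: eqP js => // ->; rewrite (negPf j0s).
    by have := h j0; rewrite /= inE eqxx => /(_ isT); rewrite /B' /= eqxx.
  rewrite e (ixi u' mB') (ixi us mB) big_cons /B' eqxx muleC; congr (_ * _)%E.
  apply: eq_big_seq => j js.
  by case: eqP js => // ->; rewrite (negPf j0s).
Qed.

End Independence.

(** * Integrating out a fresh seed *)

Section IndependentSeed.
Variables (R : realType) (dO dZ : measure_display) (Omega : measurableType dO)
  (Z : measurableType dZ) (P : probability Omega R) (J : eqType)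
  (xi : J -> Omega -> Z) (mu : probability Z R) (d : nat).
Hypotheses (mxi : forall j, measurable_fun setT (xi j))
  (ixi : mutually_independent P xi)
  (lxi : forall j (B : set Z), measurable B -> P (xi j @^-1` B)%classic = mu B).
Local Open Scope classical_set_scope.

Local Notation past S := (g_sigma_algebraType (cylinders xi S)).

(** [past S] has the points of [Omega] but only the sigma-algebra of the seeds in [S]; measurability
    on it expresses dependence on these seeds alone. *)
Lemma past_measurable d' (T : measurableType d') S (g : past S -> T) :
  measurable_fun setT g -> measurable_fun setT (g : Omega -> T).
Proof. by move=> mg _ B mB; apply: (measurable_cylinders mxi); exact: mg. Qed.

Lemma ip_continuous1 : continuous (fun x : 'rV[R]_d => ip x x).
Proof.
rewrite (_ : (fun x => _) = fun x : 'rV[R]_d => ip x (x *m 1%:M)).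
  exact: ip_continuous.
by apply/funext => x; rewrite mulmx1.
Qed.

(** The law of the pair (Y, xi j0) agrees with a product measure on rectangles, hence everywhere.
    Integrating over the seed first then takes the place of conditioning on the past. *)
Lemma integral_fresh_seed_le S j0 (Y : past S -> borel_rV R d)
    (G : borel_rV R d * Z -> R) (c : R) : ~~ S j0 -> measurable_fun setT Y ->
  measurable_fun setT G -> (forall u, 0 <= G u) -> 0 <= c ->
  (forall x : 'rV[R]_d, (\int[mu]_z (G (x, z))%:E <= (c * ip x x)%:E)%E) ->
  (\int[P]_w (G (Y w, xi j0 w))%:E
    <= c%:E * \int[P]_w (ip (Y w : 'rV[R]_d) (Y w))%:E)%E.
Proof.
move=> Sj0 mY mG G0 c0 hG.
have mYO : measurable_fun setT (Y : Omega -> borel_rV R d) by exact: past_measurable.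
have mX : measurable_fun setT (fun w : Omega => ((Y w, xi j0 w) : borel_rV R d * Z)%type).
  exact: measurable_fun_pair.
pose YO : {mfun Omega >-> borel_rV R d} := HB.pack (Y : Omega -> borel_rV R d)
  (isMeasurableFun.Build _ _ _ _ _ mYO).
pose X : {mfun Omega >-> (borel_rV R d * Z)%type} := HB.pack
  (fun w : Omega => ((Y w, xi j0 w) : borel_rV R d * Z)%type)
  (isMeasurableFun.Build _ _ _ _ _ mX).
have mGE : measurable_fun setT (fun u => (G u)%:E) by exact/measurable_EFinP.
have mip : measurable_fun setT (fun x : borel_rV R d => (ip (x : 'rV[R]_d) x)%:E).
  by apply/measurable_EFinP; apply: continuous_measurable_rV; exact: ip_continuous1.
have -> : (\int[P]_w (G (Y w, xi j0 w))%:E = \int[distribution P X]_u (G u)%:E)%E.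
  by rewrite ge0_integral_distribution// => u; rewrite lee_fin.
have -> : (\int[distribution P X]_u (G u)%:E =
    \int[(distribution P YO \x mu)%E]_u (G u)%:E)%E.
  apply: eq_measure_integral => B mB _; apply/esym.
  apply: (@product_measure_unique _ _ _ _ _ (distribution P YO) mu
    (distribution P X)) => // U V mU mV.
  transitivity (P (Y @^-1` U `&` xi j0 @^-1` V)).
    by congr (P _); apply/seteqP; split.
  rewrite (cylinders_indep mxi ixi Sj0 mV) ?lxi//.
  by have := mY measurableT U mU; rewrite setTI.
rewrite fubini_tonelli1//.
have -> : (c%:E * \int[P]_w (ip (Y w : 'rV[R]_d) (Y w))%:E =
    \int[distribution P YO]_x (c * ip (x : 'rV[R]_d) x)%:E)%E.
  rewrite ge0_integral_distribution//; last 2 first.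
  - by under eq_fun do rewrite EFinM; exact: measurable_funeM.
  - by move=> x; rewrite lee_fin mulr_ge0 ?ip_ge0.
  rewrite -ge0_integralZl//; last by move=> w _; rewrite lee_fin ip_ge0.
  by apply: measurableT_comp mip mYO.
apply: ge0_le_integral => //.
- by move=> x _; rewrite /fubini_F; apply: integral_ge0 => z _; rewrite lee_fin.
- by apply: measurable_fun_fubini_tonelli_F.
- by under eq_fun do rewrite EFinM; exact: measurable_funeM.
- by move=> x _; exact: hG.
Qed.

End IndependentSeed.

(** * Measurability of matrix-valued maps *)

Section MeasurableMatrices.
Variables (R : realType) (dT : measure_display) (T : measurableType dT).

(** Entrywise, so that closure under matrix operations reduces to real functions; [measurable_rV]
    converts back to Borel measurability of rows. *)
Definition mx_measurable m n (M : T -> 'M[R]_(m, n)) :=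
  forall i j, measurable_fun setT (fun t => M t i j).

Lemma mx_measurable_eq m n (M M' : T -> 'M[R]_(m, n)) : M =1 M' ->
  mx_measurable M' -> mx_measurable M.
Proof. by move=> /funext ->. Qed.

Lemma mx_measurableD m n (M M' : T -> 'M[R]_(m, n)) : mx_measurable M ->
  mx_measurable M' -> mx_measurable (fun t => M t + M' t).
Proof.
move=> h h' i j; under eq_fun do rewrite mxE.
exact: measurable_funD.
Qed.

Lemma mx_measurableZ m n c (M : T -> 'M[R]_(m, n)) : mx_measurable M ->
  mx_measurable (fun t => c *: M t).
Proof.
move=> h i j; under eq_fun do rewrite mxE.
by apply: measurable_funM => //; exact: measurable_cst.
Qed.

Lemma mx_measurableB m n (M M' : T -> 'M[R]_(m, n)) : mx_measurable M ->
  mx_measurable M' -> mx_measurable (fun t => M t - M' t).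
Proof.
move=> h h'; apply: mx_measurableD => //.
by under eq_fun do rewrite -scaleN1r; exact: mx_measurableZ.
Qed.

Lemma mx_measurable_mul l m n (B : 'M[R]_(l, m)) (M : T -> 'M[R]_(m, n)) :
  mx_measurable M -> mx_measurable (fun t => B *m M t).
Proof.
move=> h i j; under eq_fun do rewrite mxE.
apply: measurable_sum => k.
by apply: measurable_funM => //; exact: measurable_cst.
Qed.

Lemma mx_measurable_cst m n (M : 'M[R]_(m, n)) : mx_measurable (fun=> M).
Proof. by move=> i j; exact: measurable_cst. Qed.

Lemma mx_measurable_rows n d (g : 'I_n -> T -> 'rV[R]_d) :
  (forall i, mx_measurable (g i)) -> mx_measurable (fun t => \matrix_(i < n) g i t).
Proof. by move=> h i j; under eq_fun do rewrite mxE; exact: h. Qed.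

Lemma mx_measurable_row n d (M : T -> 'M[R]_(n, d)) i :
  mx_measurable M -> mx_measurable (fun t => row i (M t)).
Proof. by move=> h i' j; under eq_fun do rewrite mxE; exact: h. Qed.

Lemma mx_measurable_borel d (g : T -> 'rV[R]_d) :
  mx_measurable g -> measurable_fun setT (g : T -> borel_rV R d).
Proof. by move=> h; apply: measurable_rV => j; exact: h. Qed.

Lemma borel_mx_measurable d (g : T -> 'rV[R]_d) :
  measurable_fun setT (g : T -> borel_rV R d) -> mx_measurable g.
Proof. by move=> h i j; rewrite ord1; exact: measurable_rV_coord. Qed.

Lemma measurable_ip m n (M M' : T -> 'M[R]_(m, n)) : mx_measurable M ->
  mx_measurable M' -> measurable_fun setT (fun t => ip (M t) (M' t)).
Proof.
move=> h h'; under eq_fun do rewrite ipE.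
by apply: measurable_sum => i; apply: measurable_sum => j; exact: measurable_funM.
Qed.

Lemma measurable_continuous_row d (g : T -> 'rV[R]_d) (h : 'rV[R]_d -> R) :
  mx_measurable g -> continuous h -> measurable_fun setT (fun t => h (g t)).
Proof.
move=> mg ch; apply: (measurableT_comp (f := (h : borel_rV R d -> R))).
  exact: continuous_measurable_rV.
exact: mx_measurable_borel.
Qed.

Variables (n d : nat) (A : 'M[R]_n) (p : params R) (f : 'I_n -> 'rV[R]_d -> R).
Variable fstar : R.
Hypotheses (hdiff : forall i x, differentiable (f i) x) (Lf_gt0 : 0 < par_Lf p)
  (hlip : forall i, lipschitz_gradient (par_Lf p) (f i)).

Lemma mx_measurable_grad (M : T -> 'M[R]_(n, d)) :
  mx_measurable M -> mx_measurable (fun t => grad_mx f (M t)).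
Proof.
move=> h; apply: mx_measurable_rows => i i' j.
rewrite ord1; apply: (measurable_continuous_row (h := fun x => gradient (f i) x ord0 j)).
  exact: mx_measurable_row.
by apply: gradient_coord_continuous (hlip i).
Qed.

Lemma measurable_opt_gap (X : T -> 'M[R]_(n, d)) : mx_measurable X ->
  measurable_fun setT (fun t => opt_gap f fstar (X t)).
Proof.
move=> mX; have cM c (g : T -> R) : measurable_fun setT g -> measurable_fun setT (fun t => c * g t).
  by move=> mg; apply: measurable_funM => //; exact: measurable_cst.
apply: (cM); apply: measurable_funB; last exact: measurable_cst.
apply: (cM); apply: measurable_sum => i.
apply: (measurable_continuous_row (g := fun t => row_mean (X t))).
  move=> i' j; under eq_fun do rewrite mxE summxE.
  apply: (cM); apply: measurable_sum => k; under eq_fun do rewrite mxE.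
  exact: mX.
by move=> x; apply: differentiable_continuous.
Qed.

Lemma measurable_lyapunov (X V Y E : T -> 'M[R]_(n, d)) : mx_measurable X ->
  mx_measurable V -> mx_measurable Y -> mx_measurable E ->
  measurable_fun setT (fun t => energy A p f fstar (X t) (V t)) /\
  measurable_fun setT (fun t => lyapunov A p f fstar (X t) (V t) (Y t) (E t)).
Proof.
move=> mX mV mY mE.
have cM c (g : T -> R) : measurable_fun setT g -> measurable_fun setT (fun t => c * g t).
  by move=> mg; apply: measurable_funM => //; exact: measurable_cst.
have mc : mx_measurable (fun t => centered (X t)).
  by apply: mx_measurableB => //; exact: mx_measurable_mul.
have ms : mx_measurable (fun t => dual_err A p f (X t) (V t)).
  apply: mx_measurable_mul; apply: mx_measurableD => //; apply: mx_measurableZ.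
  by apply: mx_measurable_grad; exact: mx_measurable_mul.
have mgap := measurable_opt_gap mX.
have men : measurable_fun setT (fun t => energy A p f fstar (X t) (V t)).
  apply: measurable_funD => //; apply: measurable_funD; last exact: measurable_ip.
  apply: measurable_funD; apply: (cM); first exact: measurable_ip.
  by apply: measurable_ip => //; exact: mx_measurable_mul.
split=> //; apply: measurable_funD; last by apply: (cM); exact: measurable_ip.
by apply: measurable_funD => //; exact: measurable_ip.
Qed.

End MeasurableMatrices.

Section CompressionError.
Variables (R : realType) (dO dZ : measure_display) (Omega : measurableType dO)
  (Z : measurableType dZ) (P : probability Omega R) (J : eqType)
  (xi : J -> Omega -> Z) (mu : probability Z R) (n d : nat) (phi r : R)
  (C : 'rV[R]_d -> Z -> 'rV[R]_d).
Hypotheses (mxi : forall j, measurable_fun setT (xi j))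
  (ixi : mutually_independent P xi)
  (lxi : forall j (B : set Z), measurable B -> P (xi j @^-1` B)%classic = mu B)
  (phi1 : phi <= 1) (hC : compressor mu phi r C).
Local Notation past S := (g_sigma_algebraType (cylinders xi S)).

(** Both squared norms are sums over rows, so each agent's row is integrated against its own
    seed. *)
Lemma integral_compression_le S (j : 'I_n -> J) (Y : past S -> 'M[R]_(n, d))
    (Q : Omega -> 'M[R]_(n, d)) : (forall i, ~~ S (j i)) -> mx_measurable Y ->
  (forall i w, row i (Q w) = C (row i (Y w)) (xi (j i) w)) ->
  (\int[P]_w (ip (r^-1 *: Q w - Y w) (r^-1 *: Q w - Y w))%:E
    <= (1 - phi)%:E * \int[P]_w (ip (Y w) (Y w))%:E)%E.
Proof.
move=> jS mY QE.
have phi0 : 0 <= 1 - phi by rewrite subr_ge0.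
pose G (u : borel_rV R d * Z) : R := ip (r^-1 *: C u.1 u.2 - u.1) (r^-1 *: C u.1 u.2 - u.1).
have mG : measurable_fun setT G.
  have m1 : mx_measurable (fun u : borel_rV R d * Z => (u.1 : 'rV[R]_d)).
    by apply: borel_mx_measurable; exact: measurable_fst.
  have m2 : mx_measurable (fun u : borel_rV R d * Z => r^-1 *: C u.1 u.2 - u.1).
    apply: mx_measurableB => //; apply: mx_measurableZ.
    by apply: borel_mx_measurable; exact: (comp_meas hC).
  exact: measurable_ip.
have G0 u : 0 <= G u by exact: ip_ge0.
have mYi i : measurable_fun setT ((fun w => row i (Y w)) : past S -> borel_rV R d).
  by apply: mx_measurable_borel; exact: mx_measurable_row.
have hi i : (\int[P]_w (G (row i (Y w), xi (j i) w))%:E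
    <= (1 - phi)%:E * \int[P]_w (ip (row i (Y w)) (row i (Y w)))%:E)%E.
  apply: (integral_fresh_seed_le mxi ixi lxi (jS i) (mYi i) mG G0 phi0) => x.
  have := comp_ineq hC x; rewrite unlock enorm_sqr.
  by under eq_integral do rewrite enorm_sqr.
have mYO i : measurable_fun setT ((fun w => row i (Y w)) : Omega -> borel_rV R d).
  exact: past_measurable.
have mrow i : measurable_fun setT (fun w : Omega => ip (row i (Y w)) (row i (Y w))).
  apply: measurable_ip; apply: borel_mx_measurable; exact: mYO.
have -> : (\int[P]_w (ip (Y w) (Y w))%:E =
    \sum_(i < n) \int[P]_w (ip (row i (Y w)) (row i (Y w)))%:E)%E.
  rewrite -ge0_integral_sum//; last 2 first.
  - by move=> i; exact/measurable_EFinP.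
  - by move=> i w _; rewrite lee_fin ip_ge0.
  by apply: eq_integral => w _; rewrite ip_rows sumEFin.
rewrite ge0_sume_distrr; last first.
  by move=> i _; apply: integral_ge0 => w _; rewrite lee_fin ip_ge0.
have -> : (\int[P]_w (ip (r^-1 *: Q w - Y w) (r^-1 *: Q w - Y w))%:E =
    \sum_(i < n) \int[P]_w (G (row i (Y w), xi (j i) w))%:E)%E.
  rewrite -ge0_integral_sum//; last 2 first.
  - move=> i; apply/measurable_EFinP; apply: (measurableT_comp mG).
    exact: measurable_fun_pair.
  - by move=> i w _; rewrite lee_fin.
  apply: eq_integral => w _; rewrite ip_rows sumEFin; congr EFin.
  by apply: eq_bigr => i _; rewrite !linearB !linearZ /= QE.
by apply: lee_sum => i _.
Qed.

End CompressionError.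

(** * Convergence in expectation *)

Section Algorithm.
Variables (R : realType) (n d : nat) (A : 'M[R]_n) (p : params R)
  (f : 'I_n -> 'rV[R]_d -> R) (dO dZ : measure_display) (Omega : measurableType dO)
  (Z : measurableType dZ) (mu : probability Z R)
  (C : 'rV[R]_d -> Z -> 'rV[R]_d) (xi : nat * 'I_n * bool -> Omega -> Z)
  (x0 : 'I_n -> 'rV[R]_d) (a b x v q e qh : nat -> 'I_n -> Omega -> 'rV[R]_d).
Hypotheses (hA : weighted_graph A)
  (halg : error_feedback p (laplacian A) f C xi x0 a b x v q e qh).

Local Notation L := (laplacian A).
Local Notation al := (par_alpha p).
Local Notation be := (par_beta p).
Local Notation et := (par_eta p).
Local Notation psi := (par_psi p).
Local Notation sg := (par_sigma p).
Local Notation stack y k w := (\matrix_(i < n) y k i w).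

Definition tracking_err k w : 'M[R]_(n, d) := stack x k w - stack a k w.
Definition feedback k w : 'M[R]_(n, d) := sg *: stack e k w + tracking_err k w.
Local Notation Y := tracking_err.
Local Notation ZZ := feedback.

Lemma row_mulmx_sum (B : 'M[R]_n) (M : 'M[R]_(n, d)) i :
  row i (B *m M) = \sum_j B i j *: row j M.
Proof.
rewrite row_mul mulmx_sum_row; apply: eq_bigr => j _.
by rewrite mxE.
Qed.

Lemma stack_b k w : stack b k w = stack a k w - L *m stack a k w.
Proof.
apply/row_matrixP => i; rewrite linearB /= row_mulmx_sum !rowK.
under eq_bigr do rewrite rowK.
elim: k i => [|k IH] i.
  rewrite (ef_b0 halg) (ef_a0 halg) big1 ?subr0// => j _.
  by rewrite (ef_a0 halg) scaler0.
rewrite (ef_b halg) (ef_a halg) IH.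
under [in RHS]eq_bigr do rewrite (ef_a halg) scalerDr scalerA mulrC -scalerA.
by rewrite big_split /= -scaler_sumr scalerBr opprD addrACA.
Qed.

(** This is a + hat q, written in the shape that [lyapunov_step] expects. *)
Let Xh k w : 'M[R]_(n, d) := stack x k w - Y k w + stack qh k w.

Let forcing k w i : a k i w - b k i w + \sum_j L i j *: qh k j w = row i (L *m Xh k w).
Proof.
have -> : a k i w - b k i w = row i (L *m stack a k w).
  have := congr1 (row i) (stack_b k w); rewrite linearB /= !rowK => ->.
  by rewrite subKr.
rewrite /Xh /Y subKr mulmxDr linearD /=; congr (_ + _).
by rewrite row_mulmx_sum; apply: eq_bigr => j _; rewrite rowK.
Qed.

Lemma stack_x k w : stack x k.+1 w = stack x k w
  - et *: (al *: (L *m Xh k w) + be *: stack v k w + grad_mx f (stack x k w)).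
Proof.
apply/row_matrixP => i; move: (L *m Xh k w) (forcing k w i) => M fM.
by rewrite rowK (ef_x halg) fM; apply/rowP => j; rewrite !mxE rowK; ring.
Qed.

Lemma stack_v k w : stack v k.+1 w = stack v k w + (et * be) *: (L *m Xh k w).
Proof.
apply/row_matrixP => i; move: (L *m Xh k w) (forcing k w i) => M fM.
by rewrite rowK (ef_v halg) fM; apply/rowP => j; rewrite !mxE.
Qed.

Lemma tracking_err_step k w : Y k.+1 w =
  Y k w - psi *: stack q k w + (stack x k.+1 w - stack x k w).
Proof.
apply/matrixP => i j; rewrite !mxE (ef_a halg) !mxE; ring.
Qed.

Lemma stack_e k w : stack e k.+1 w = ZZ k w - stack qh k w.
Proof.
apply/matrixP => i j; rewrite !mxE (ef_e halg) !mxE; ring.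
Qed.

(** [v] starts at 0 and moves only within the range of the Laplacian. *)
Lemma mul_avg_stack_v k w : avg_mx R n *m stack v k w = 0.
Proof.
elim: k => [|k IH].
  rewrite (_ : stack v 0%N w = 0) ?mulmx0//.
  by apply/row_matrixP => i; rewrite rowK (ef_v0 halg) row0.
by rewrite stack_v mulmxDr IH add0r -scalemxAr mulmxA avg_mx_laplacian// mul0mx scaler0.
Qed.

Lemma row_stack_q k w i : row i (stack q k w) = C (row i (Y k w)) (xi (k, i, false) w).
Proof.
rewrite /Y linearB /= !rowK; case: k => [|k]; last exact: (ef_q halg).
by rewrite (ef_q0 halg) (ef_a0 halg) subr0.
Qed.

(* At iteration 0 the two compressors share the seed [(0, i, false)]. *)
Lemma row_stack_qh k w i :
  row i (stack qh k w) = C (row i (ZZ k w)) (xi (k, i, (0 < k)%N) w).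
Proof.
rewrite /ZZ /Y linearD linearZ linearB /= !rowK; case: k => [|k].
  by rewrite (ef_qh0 halg) (ef_q0 halg) (ef_a0 halg) (ef_e0 halg) scaler0 add0r subr0.
by rewrite (ef_qh halg) addrA.
Qed.

Hypotheses (Lf_gt0 : 0 < par_Lf p)
  (hlip : forall i, lipschitz_gradient (par_Lf p) (f i))
  (hC : compressor mu (par_phi p) (par_r p) C).

(** The resulting sigma-algebras form a filtration: the states at [k] are measurable for [before k],
    whereas q and hat q at [k] are measurable only for [before k.+1]. *)
Definition before k : pred (nat * 'I_n * bool) := fun j => (j.1.1 < k)%N.
Local Notation past k := (g_sigma_algebraType (cylinders xi (before k))).

Lemma past_mono k m m' (g : Omega -> 'M[R]_(m, m')) :
  mx_measurable (g : past k -> _) -> mx_measurable (g : past k.+1 -> _).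
Proof.
move=> mg i j _ B mB.
have := mg i j measurableT B mB.
suff : (<<s cylinders xi (before k) >> `<=` <<s cylinders xi (before k.+1) >>)%classic.
  by apply.
apply: sub_sigma_algebra2 => _ [s [B' [us sS mB' ->]]].
exists s; exists B'; split => //.
by apply: sub_all sS => j'; rewrite /before => /ltn_trans; apply.
Qed.

Lemma measurable_past_seed k i c : measurable_fun setT (xi (k, i, c) : past k.+1 -> Z).
Proof.
move=> _ B mB; rewrite setTI; apply: sub_sigma_algebra.
exists [:: (k, i, c)]; exists (fun=> B); split => //; first by rewrite /= /before /= ltnSn.
apply/seteqP; split => [w Bw j|w h]; first by rewrite /= inE => /eqP ->.
by apply: (h (k, i, c)); rewrite /= inE.
Qed.

Lemma mx_measurable_compressed k (M Q : Omega -> 'M[R]_(n, d)) (c : bool) :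
  mx_measurable (M : past k -> _) ->
  (forall w i, row i (Q w) = C (row i (M w)) (xi (k, i, c) w)) ->
  mx_measurable (Q : past k.+1 -> _).
Proof.
move=> mM QE i j.
have -> : (fun w : past k.+1 => Q w i j) =
    (fun w : past k.+1 => (C (row i (M w)) (xi (k, i, c) w)) ord0 j).
  by apply/funext => w; rewrite -QE mxE.
apply: (measurable_rV_coord (g := (fun w => C (row i (M w)) (xi (k, i, c) w)) :
  past k.+1 -> borel_rV R d)).
apply: (measurableT_comp (f := fun u : borel_rV R d * Z => C u.1 u.2 : borel_rV R d)
  (g := (fun w => (row i (M w), xi (k, i, c) w)) : past k.+1 -> borel_rV R d * Z)).
  exact: comp_meas hC.
apply: measurable_fun_pair; last exact: measurable_past_seed.
by apply: mx_measurable_borel; apply: mx_measurable_row; exact: past_mono.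
Qed.

Lemma states_measurable k : [/\ mx_measurable (fun w : past k => stack x k w),
  mx_measurable (fun w : past k => stack v k w), mx_measurable (Y k : past k -> _) &
  mx_measurable (fun w : past k => stack e k w)].
Proof.
have cst (y : nat -> 'I_n -> Omega -> 'rV[R]_d) (c : 'I_n -> 'rV[R]_d) :
    (forall i w, y 0%N i w = c i) -> mx_measurable (fun w : past 0 => stack y 0%N w).
  (* No seed precedes iteration 0; the initial states are measurable because they are constant. *)
  move=> h; rewrite (_ : (fun w : past 0 => _) = fun=> \matrix_i c i).
    exact: mx_measurable_cst.
  by apply/funext => w; apply/row_matrixP => i; rewrite !rowK.
elim: k => [|k [mx mv my me]].
  split.
  - exact: cst (ef_x0 halg).
  - exact: cst (ef_v0 halg).
  - by apply: mx_measurableB; [exact: cst (ef_x0 halg) | exact: cst (ef_a0 halg)].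
  - exact: cst (ef_e0 halg).
have mz : mx_measurable (ZZ k : past k -> _).
  by apply: mx_measurableD => //; exact: mx_measurableZ.
have mq : mx_measurable (fun w : past k.+1 => stack q k w).
  apply: (mx_measurable_compressed (c := false) my) => w i; exact: row_stack_q.
have mqh : mx_measurable (fun w : past k.+1 => stack qh k w).
  apply: (mx_measurable_compressed (c := (0 < k)%N) mz) => w i; exact: row_stack_qh.
have mx' := past_mono mx; have mv' := past_mono mv; have my' := past_mono my.
have mz' := past_mono mz.
have mL : mx_measurable (fun w : past k.+1 => L *m Xh k w).
  by apply: mx_measurable_mul; apply: mx_measurableD => //; exact: mx_measurableB.
have mg : mx_measurable (fun w : past k.+1 => grad_mx f (stack x k w)).
  exact: (mx_measurable_grad Lf_gt0 hlip).
have mx1 : mx_measurable (fun w : past k.+1 => stack x k.+1 w).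
  apply: mx_measurable_eq => [w|]; [exact: stack_x|].
  apply: mx_measurableB => //; apply: mx_measurableZ.
  apply: mx_measurableD => //.
  by apply: mx_measurableD; exact: mx_measurableZ.
split => //.
- apply: mx_measurable_eq => [w|]; [exact: stack_v|].
  by apply: mx_measurableD => //; exact: mx_measurableZ.
- apply: mx_measurable_eq => [w|]; [exact: tracking_err_step|].
  apply: mx_measurableD; last exact: mx_measurableB.
  by apply: mx_measurableB => //; exact: mx_measurableZ.
- by apply: mx_measurable_eq => [w|]; [exact: stack_e|]; exact: mx_measurableB.
Qed.

End Algorithm.

(** * From the pathwise inequality to a contraction of expectations *)

Section ExpectedContraction.
Variables (R : realType) (dO : measure_display) (Omega : measurableType dO)
  (P : probability Omega R).
Local Notation I f := (\int[P]_w (f w)%:E)%E.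

Let meas (f : Omega -> R) := measurable_fun setT f.

Lemma integralD_ge0 (f g : Omega -> R) : meas f -> meas g -> (forall w, 0 <= f w) ->
  (forall w, 0 <= g w) -> (I (fun w => f w + g w)%R = I f + I g)%E.
Proof.
move=> mf mg f0 g0; under eq_integral do rewrite EFinD.
rewrite ge0_integralD// => [w _||w _|]; rewrite ?lee_fin//; exact/measurable_EFinP.
Qed.

Lemma integralZ_ge0 (c : R) (f : Omega -> R) : meas f -> (forall w, 0 <= f w) -> 0 <= c ->
  (I (fun w => c * f w)%R = c%:E * I f)%E.
Proof.
move=> mf f0 c0; under eq_integral do rewrite EFinM.
by rewrite ge0_integralZl// => [|w _]; [exact/measurable_EFinP|rewrite lee_fin].
Qed.

Lemma integral_le_ge0 (f g : Omega -> R) : meas f -> meas g -> (forall w, 0 <= f w) ->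
  (forall w, f w <= g w) -> (I f <= I g)%E.
Proof.
move=> mf mg f0 fg; apply: ge0_le_integral => //.
- by move=> w _; rewrite lee_fin.
- exact/measurable_EFinP.
- exact/measurable_EFinP.
- by move=> w _; rewrite lee_fin.
Qed.

Lemma integral_finite (f : Omega -> R) : (forall w, 0 <= f w) -> (I f < +oo)%E ->
  exists2 r, 0 <= r & I f = r%:E.
Proof.
move=> f0 foo; have I0 : (0 <= I f)%E by apply: integral_ge0 => w _; rewrite lee_fin.
exists (fine (I f)); first exact: fine_ge0.
by rewrite fineK// ge0_fin_numE.
Qed.

Variables (ly en ee yy q qh zz : Omega -> R) (c1 c2 c3 c4 c5 c6 s r phi t : R).
Hypotheses (mly : meas ly) (men : meas en) (mee : meas ee) (myy : meas yy) (mq : meas q)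
  (mqh : meas qh) (mzz : meas zz).
Hypotheses (ly0 : forall w, 0 <= ly w) (en0 : forall w, 0 <= en w)
  (ee0 : forall w, 0 <= ee w) (yy0 : forall w, 0 <= yy w) (q0 : forall w, 0 <= q w)
  (qh0 : forall w, 0 <= qh w) (zz0 : forall w, 0 <= zz w).
Hypotheses (c10 : 0 <= c1) (c20 : 0 <= c2) (c30 : 0 <= c3) (c40 : 0 <= c4) (c50 : 0 <= c5)
  (c60 : 0 <= c6) (s0 : 0 <= s) (r0 : 0 <= r) (phi0 : 0 <= phi) (t0 : 0 < t).
Hypotheses (step : forall w, ly w <= c1 * en w + c2 * ee w + c3 * yy w + c4 * q w
    + c5 * qh w + c6 * zz w)
  (zzE : forall w, zz w <= s * ee w + r * yy w)
  (qE : (I q <= phi%:E * I yy)%E) (qhE : (I qh <= phi%:E * I zz)%E)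
  (hY : c3 + c4 * phi + c5 * (phi * r) + c6 * r <= c1)
  (hE : c2 + c5 * (phi * s) + c6 * s <= c1 * t).

(** Integrals live in the extended reals. The finite bound [B] makes each of them a real number,
    after which the claim is a linear combination of [step], [zzE], the compression bounds and the
    coefficient conditions. *)
Lemma expected_contraction (B : R) :
  (I (fun w => en w + yy w + t * ee w)%R <= B%:E)%E -> (I ly <= (c1 * B)%:E)%E.
Proof.
have mZ c f : meas f -> meas (fun w => c * f w).
  by move=> mf; apply: measurable_funM => //; exact: measurable_cst.
have mD f g : meas f -> meas g -> meas (fun w => f w + g w).
  by move=> mf mg; exact: measurable_funD.
have zM (c : R) f : 0 <= c -> (forall w, 0 <= f w) -> forall w : Omega, 0 <= c * f w.
  by move=> h1 h2 w; rewrite mulr_ge0.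
have pD (f g : Omega -> R) : (forall w, 0 <= f w) -> (forall w, 0 <= g w) ->
    forall w : Omega, 0 <= f w + g w.
  by move=> h1 h2 w; rewrite addr_ge0.
have t00 := ltW t0.
rewrite !integralD_ge0 ?integralZ_ge0//; do ?[exact: mD|exact: mZ|exact: pD|exact: zM].
have Ige (f : Omega -> R) : (forall w, 0 <= f w) -> (0 <= I f)%E.
  by move=> f0; apply: integral_ge0 => w _; rewrite lee_fin.
move=> hB.
have lt_oo (u : \bar R) : (u <= B%:E)%E -> (u < +oo)%E by move=> /le_lt_trans; apply; exact: ltry.
have tE0 : (0 <= t%:E * I ee)%E by rewrite mule_ge0 ?lee_fin ?Ige.
have [a a0 Ia] : exists2 a, 0 <= a & I en = a%:E.
  apply: integral_finite => //; apply: lt_oo; apply: le_trans hB.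
  by rewrite -addeA leeDl// adde_ge0 ?Ige.
have [y y0 Iy] : exists2 a, 0 <= a & I yy = a%:E.
  apply: integral_finite => //; apply: lt_oo; apply: le_trans hB.
  by rewrite addeAC leeDr// adde_ge0 ?Ige.
(* [B] bounds only the multiple by [t]; finiteness of the integral itself comes from t > 0. *)
have [e e0 Ie] : exists2 a, 0 <= a & I ee = a%:E.
  apply: integral_finite => //.
  have : (t%:E * I ee < +oo)%E by apply: lt_oo; apply: le_trans hB; rewrite leeDr// adde_ge0 ?Ige.
  have := Ige _ ee0; case: (I ee) => [u _ _||//]; first exact: ltry.
  by rewrite mulry gtr0_sg// mul1e.
have IzE : (I zz <= (s * e + r * y)%:E)%E.
  apply: le_trans (integral_le_ge0 mzz _ zz0 zzE) _; first by apply: (mD); exact: mZ.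
  rewrite integralD_ge0 ?integralZ_ge0 ?Ie ?Iy//; do ?[exact: mZ|exact: zM].
have [z z0 Iz] : exists2 a, 0 <= a & I zz = a%:E.
  by apply: integral_finite => //; apply: le_lt_trans IzE _; exact: ltry.
have [u u0 Iq] : exists2 a, 0 <= a & I q = a%:E.
  by apply: integral_finite => //; apply: le_lt_trans qE _; rewrite Iy -EFinM ltry.
have [uh uh0 Iqh] : exists2 a, 0 <= a & I qh = a%:E.
  by apply: integral_finite => //; apply: le_lt_trans qhE _; rewrite Iz -EFinM ltry.
have mR : meas (fun w => c1 * en w + c2 * ee w + c3 * yy w + c4 * q w + c5 * qh w + c6 * zz w).
  by do ![apply: (mD)]; exact: mZ.
apply: le_trans (integral_le_ge0 mly mR ly0 step) _.
rewrite !integralD_ge0 ?integralZ_ge0//; do ?[exact: mZ|exact: zM|by do ?[apply: (mD)]; exact: mZ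
  |by do ?[apply: (pD)]; exact: zM].
move: hB IzE qE qhE; rewrite Ia Iy Ie Iz Iq Iqh -!EFinM -!EFinD !lee_fin.
move=> hB hz hq hqh.
have h1 := ler_wpM2l c10 hB.
have h2 := ler_wpM2l c40 hq.
have h3 := ler_wpM2l c50 (le_trans hqh (ler_wpM2l phi0 hz)).
have h4 := ler_wpM2l c60 hz.
have h5 := ler_wpM2r y0 hY.
have h6 := ler_wpM2r e0 hE.
lra.
Qed.

End ExpectedContraction.

Unset Implicit Arguments.

Theorem theorem4
  (R : realType) (n d : nat) (hn : (1 < n)%N)
  (A : 'M[R]_n) (hA : weighted_graph A) (hconn : graph_connected A)
  (p : params R)
  (f : 'I_n -> 'rV[R]_d -> R)
  (hdiff : forall i x, differentiable (f i) x)
  (hLf : 0 < par_Lf p)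
  (hlip : forall i, lipschitz_gradient (par_Lf p) (f i))
  (fstar : R) (hmin : is_minimum (avg_fun f) fstar)
  (hnu : 0 < par_nu p)
  (hPL : polyak_lojasiewicz (par_nu p) (avg_fun f) fstar)
  (dO dZ : measure_display) (Omega : measurableType dO) (Z : measurableType dZ)
  (P : probability Omega R) (mu : probability Z R)
  (C : 'rV[R]_d -> Z -> 'rV[R]_d)
  (hphi : 0 < par_phi p <= 1) (hr : 0 < par_r p)
  (hC : compressor mu (par_phi p) (par_r p) C)
  (xi : nat * 'I_n * bool -> Omega -> Z) (hxi : fresh_seeds P mu xi)
  (x0 : 'I_n -> 'rV[R]_d)
  (a b x v q e qh : nat -> 'I_n -> Omega -> 'rV[R]_d)
  (halg : error_feedback p (laplacian A) f C xi x0 a b x v q e qh)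
  (hr1 : 1 < par_r1 p)
  (hkappa4 : 0 < par_kappa4 p)
  (hkappa1 : kappa1_bound p (laplacian A) <= par_kappa1 p)
  (htau0 : 0 < par_tau0 p) (htau0' : ((par_tau0 p)%:E < tau0_bound p)%E)
  (halpha : par_alpha p = par_kappa1 p * par_beta p)
  (hbeta : kappa2 p (laplacian A) < par_beta p)
  (heta : 0 < par_eta p)
  (heta' : ((par_eta p)%:E < check_kappa3 p (laplacian A))%E)
  (hsigma : 0 < par_sigma p) (hsigma' : ((par_sigma p)%:E < kappa0 p)%E)
  (hpsi : 0 < par_psi p) (hpsi' : par_psi p <= 1 / par_r p) :
  0 < check_eps p (laplacian A) < 1 /\
  exists M : R, forall k : nat,
    (\sum_(i < n)
       'E_P[fun w => let xbar := average (fun j => x k j w) in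
                     (enorm (x k i w - xbar) ^+ 2 + avg_fun f xbar - fstar)%R]
     <= (M * (1 - check_eps p (laplacian A)) ^+ k)%:E)%E.
Proof.
have be0 : 0 < par_beta p by exact: (beta_gt0 hn hA hconn hbeta).
have be_al : par_beta p <= par_alpha p.
  exact: (beta_le_alpha hn hA hconn hkappa1 halpha hbeta).
have al0 : 0 < par_alpha p by exact: lt_le_trans be_al.
have N0 := N_gt0 hphi hr hpsi.
have N1 := N_le1 hphi hr hpsi hpsi'.
have pr1 := psi_r_le1 hr hpsi'.
have phi1 : par_phi p <= 1 by case/andP: hphi.
have e12 : par_eta p * eps2 p (laplacian A) < eps1 p (laplacian A).
  by apply: eta_eps12.
have e56 : par_eta p * eps6 p (laplacian A) < eps5 p (laplacian A).
  by apply: (eta_eps56 hn hA hconn hLf hkappa1 halpha hbeta).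
have ceps01 : 0 < check_eps p (laplacian A) < 1.
  by apply: (check_eps_range (n := n)).
split => //.
case/andP: (ceps01) => _ ceps1.
set Lam := 1 - check_eps p (laplacian A).
have Lam0 : 0 <= Lam by rewrite subr_ge0 ltW.
pose X k w := \matrix_(i < n) x k i w.
pose V k w := \matrix_(i < n) v k i w.
pose E k w := \matrix_(i < n) e k i w.
pose Q k w := \matrix_(i < n) q k i w.
pose Qh k w := \matrix_(i < n) qh k i w.
pose Y k w := tracking_err a x k w.
pose W k w := feedback p a x e k w.
pose ly k w := lyapunov A p f fstar (X k w) (V k w) (Y k w) (E k w).
have mxi := seeds_meas hxi.
have sm := states_measurable halg hLf hlip hC.
have past_mx k m m' (M : Omega -> 'M[R]_(m, m')) :
    mx_measurable (M : g_sigma_algebraType (cylinders xi (before (n := n) k)) -> _) ->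
    mx_measurable M.
  by move=> mM i j; exact: (past_measurable mxi (mM i j)).
have mX k : mx_measurable (X k) by apply: (past_mx k); have [] := sm k.
have mV k : mx_measurable (V k) by apply: (past_mx k); have [] := sm k.
have mY k : mx_measurable (Y k) by apply: (past_mx k); have [] := sm k.
have mE k : mx_measurable (E k) by apply: (past_mx k); have [] := sm k.
have mWp k : mx_measurable
    (W k : g_sigma_algebraType (cylinders xi (before (n := n) k)) -> _).
  have [_ _ mYp mEp] := sm k.
  by apply: mx_measurableD => //; exact: mx_measurableZ.
have mW k : mx_measurable (W k) by apply: (past_mx k); exact: mWp.
have mQ k : mx_measurable (Q k).
  have [_ _ mYp _] := sm k; apply: (past_mx k.+1).
  by apply: (mx_measurable_compressed (c := false) hC mYp) => w i; exact: (row_stack_q halg).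
have mQh k : mx_measurable (Qh k).
  apply: (past_mx k.+1).
  by apply: (mx_measurable_compressed (c := (0 < k)%N) hC (mWp k)) => w i;
    exact: (row_stack_qh halg).
have mly k := measurable_lyapunov A fstar hdiff hLf hlip (mX k) (mV k) (mY k) (mE k).
have en0 k w : 0 <= energy A p f fstar (X k w) (V k w).
  by apply: energy_ge0.
have ly0 k w : 0 <= ly k w.
  apply: addr_ge0; first by apply: addr_ge0; rewrite ?ip_ge0.
  by apply: mulr_ge0; rewrite ?ip_ge0 ?ltW.
have g0 : 0 <= gain A p by apply: gain_ge0.
have E12 := check_eps12_gt0 hn hA hconn hnu hphi hr hr1 hkappa1 htau0 halpha hbeta heta
  heta' hsigma hpsi.
have [c1 c2 c3 _ _] := check_eps12_le A hnu htau0 heta.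
have step k w : ly k.+1 w <= Lam * energy A p f fstar (X k w) (V k w)
    + 2 * par_eta p * gain A p * par_sigma p ^+ 2 * ip (E k w) (E k w)
    + (1 + par_phi p * par_psi p * par_r p / 2) * (1 - par_psi p * par_r p) *
      ip (Y k w) (Y k w)
    + (1 + par_phi p * par_psi p * par_r p / 2) * (par_psi p * par_r p) *
      ip ((par_r p)^-1 *: Q k w - Y k w) ((par_r p)^-1 *: Q k w - Y k w)
    + (par_tau0 p + 2 * par_eta p * gain A p) * (2 * par_r p ^+ 2) *
      ip ((par_r p)^-1 *: Qh k w - W k w) ((par_r p)^-1 *: Qh k w - W k w)
    + (par_tau0 p + 2 * par_eta p * gain A p) * (2 * (1 - par_r p) ^+ 2) *
      ip (W k w) (W k w).
  have := lyapunov_step hn hA hconn hdiff hLf hlip hmin hPL al0 be0 heta N0 N1 be_al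
    e12 e56 (X k w) (Y k w) (E k w) (Q k w) (Qh k w) (mul_avg_stack_v hA halg k w)
    hr (ltW hpsi) pr1 (ltW htau0) (ltW E12) c1 c2 c3.
  rewrite /ly /X (stack_x halg) -/(X k w).
  by rewrite /V (stack_v halg) /Y (tracking_err_step halg) (stack_x halg) /E (stack_e halg).
have WE k w : ip (W k w) (W k w) <=
    par_r1 p * par_sigma p ^+ 2 * ip (E k w) (E k w) + r2 p * ip (Y k w) (Y k w).
  have r10 : 0 < par_r1 p - 1 by rewrite subr_gt0.
  (* With this Young weight the square of sigma E + Y gets the factors [r1] and [r2], which are
     conjugate: 1 / r1 + 1 / r2 = 1. *)
  have c0 : 0 < (par_r1 p - 1) / 2 by rewrite divr_gt0.
  have c0E : (4 * ((par_r1 p - 1) / 2))^-1 = (r2 p - 1) / 2.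
    by rewrite /r2; field; rewrite gt_eqF.
  rewrite /W /feedback -/(E k w) -/(Y k w); move: (E k w) (Y k w) (r2 p) c0E => M N' c c0E.
  have := ip_young (par_sigma p *: M) N' c0.
  rewrite c0E ip_sqrD !ipZl !ipZr.
  by move: (ip M M) (ip M N') (ip N' N') => u1 u2 u3; lra.
have hq k : (\int[P]_w (ip ((par_r p)^-1 *: Q k w - Y k w) ((par_r p)^-1 *: Q k w - Y k w))%:E
    <= (1 - par_phi p)%:E * \int[P]_w (ip (Y k w) (Y k w))%:E)%E.
  have [_ _ mYp _] := sm k.
  apply: (integral_compression_le mxi (seeds_indep hxi) (seeds_law hxi) phi1 hC
    (S := before (n := n) k) (j := fun i => (k, i, false))).
  - by move=> i; rewrite /before /= ltnn.
  - exact: mYp.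
  - by move=> i w; exact: (row_stack_q halg).
have hqh k : (\int[P]_w (ip ((par_r p)^-1 *: Qh k w - W k w) ((par_r p)^-1 *: Qh k w - W k w))%:E
    <= (1 - par_phi p)%:E * \int[P]_w (ip (W k w) (W k w))%:E)%E.
  apply: (integral_compression_le mxi (seeds_indep hxi) (seeds_law hxi) phi1 hC
    (S := before (n := n) k) (j := fun i => (k, i, (0 < k)%N))).
  - by move=> i; rewrite /before /= ltnn.
  - exact: mWp.
  - by move=> i w; exact: (row_stack_qh halg).
(* The initial state is deterministic, so its Lyapunov value can be read off at an arbitrary
   outcome. *)
have [M0 M0E] : exists M0, forall w, ly 0%N w = M0.
  have X0 w : X 0%N w = X 0%N point by apply/row_matrixP => i; rewrite !rowK !(ef_x0 halg).
  have V0 w : V 0%N w = V 0%N point by apply/row_matrixP => i; rewrite !rowK !(ef_v0 halg).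
  have E0 w : E 0%N w = E 0%N point by apply/row_matrixP => i; rewrite !rowK !(ef_e0 halg).
  have Y0 w : Y 0%N w = Y 0%N point.
    apply/row_matrixP => i.
    by rewrite /Y /tracking_err !linearB /= !rowK !(ef_x0 halg) !(ef_a0 halg).
  by exists (ly 0%N point) => w; rewrite /ly X0 V0 E0 Y0.
have decay k : (\int[P]_w (ly k w)%:E <= (Lam ^+ k * M0)%:E)%E.
  elim: k => [|k IH].
    under eq_integral do rewrite M0E.
    by rewrite integral_cst//= probability_setT mule1 expr0 mul1r.
  rewrite exprS -mulrA.
  have [men _] := measurable_lyapunov A fstar hdiff hLf hlip (mX k) (mV k) (mY k) (mE k).
  have mqe := mx_measurableB (mx_measurableZ (par_r p)^-1 (mQ k)) (mY k).
  have mqhe := mx_measurableB (mx_measurableZ (par_r p)^-1 (mQh k)) (mW k).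
  have G0 : 0 <= par_tau0 p + 2 * par_eta p * gain A p.
    by rewrite addr_ge0 ?(ltW htau0)// mulr_ge0// mulr_ge0 ?(ltW heta).
  have [phi0 psi0] : 0 <= 1 - par_phi p /\ 0 <= 1 - par_psi p * par_r p by rewrite !subr_ge0.
  have NN0 : 0 <= 1 + par_phi p * par_psi p * par_r p / 2.
    by rewrite addr_ge0// divr_ge0// ltW.
  have hcY : (1 + par_phi p * par_psi p * par_r p / 2) * (1 - par_psi p * par_r p)
      + (1 + par_phi p * par_psi p * par_r p / 2) * (par_psi p * par_r p) * (1 - par_phi p)
      + (par_tau0 p + 2 * par_eta p * gain A p) * (2 * par_r p ^+ 2) * ((1 - par_phi p) * r2 p)
      + (par_tau0 p + 2 * par_eta p * gain A p) * (2 * (1 - par_r p) ^+ 2) * r2 p <= Lam.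
    exact: contraction_Y.
  have hcE : 2 * par_eta p * gain A p * par_sigma p ^+ 2
      + (par_tau0 p + 2 * par_eta p * gain A p) * (2 * par_r p ^+ 2) *
        ((1 - par_phi p) * (par_r1 p * par_sigma p ^+ 2))
      + (par_tau0 p + 2 * par_eta p * gain A p) * (2 * (1 - par_r p) ^+ 2) *
        (par_r1 p * par_sigma p ^+ 2) <= Lam * par_tau0 p.
    exact: contraction_E.
  apply: (expected_contraction _ men (measurable_ip (mE k) (mE k))
    (measurable_ip (mY k) (mY k)) (measurable_ip mqe mqe) (measurable_ip mqhe mqhe)
    (measurable_ip (mW k) (mW k)) _ _ _ _ _ _ _ _ _ _ _ _ _ _ _ _ htau0 (step k) (WE k)
    (hq k) (hqh k) hcY hcE IH) => // [|w|w|w|w|w|||||||]; try exact: ip_ge0.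
  - by have [] := mly k.+1.
  - by rewrite mulr_ge0 ?exprn_ge0 ?(ltW hsigma)// mulr_ge0// mulr_ge0 ?(ltW heta).
  - by rewrite mulr_ge0.
  - by rewrite mulr_ge0// mulr_ge0 ?ltW.
  - by rewrite mulr_ge0// mulr_ge0 ?sqr_ge0.
  - by rewrite mulr_ge0// mulr_ge0 ?sqr_ge0.
  - by rewrite mulr_ge0 ?exprn_ge0 ?(ltW hsigma)// ltW// (lt_trans ltr01).
  - by apply: ltW; exact: r2_gt0.
(* The 3 inverts the coefficient 1/3 of |u|^2 in [energy_ge]. *)
exists (3 * M0) => k.
have gap0 w : 0 <= avg_fun f (row_mean (X k w)) - fstar by rewrite subr_ge0; case: hmin.
have xbE w : average (fun j => x k j w) = row_mean (X k w).
  by congr (_ *: _); apply: eq_bigr => j _; rewrite rowK.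
pose g i w := enorm (x k i w - average (fun j => x k j w)) ^+ 2 +
  avg_fun f (average (fun j => x k j w)) - fstar.
have g0' i w : 0 <= g i w by rewrite /g -addrA xbE addr_ge0 ?sqr_ge0.
have gE i w : g i w = ip (row i (centered (X k w))) (row i (centered (X k w)))
    + n%:R^-1 * opt_gap f fstar (X k w).
  rewrite /g enorm_sqr xbE /opt_gap mulKf ?pnatr_eq0 -?lt0n ?(ltnW hn)// -addrA.
  by rewrite /centered linearB /= row_avg_mx rowK.
have mg i : measurable_fun setT (g i).
  rewrite (_ : g i = fun w => ip (row i (centered (X k w))) (row i (centered (X k w)))
    + n%:R^-1 * opt_gap f fstar (X k w)); last by apply/funext => w; exact: gE.
  apply: measurable_funD.
    have mc : mx_measurable (fun w => row i (centered (X k w))).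
      by apply: mx_measurable_row; apply: mx_measurableB => //; exact: mx_measurable_mul.
    exact: measurable_ip.
  apply: measurable_funM; first exact: measurable_cst.
  exact: measurable_opt_gap.
have g_le w : \sum_i g i w <= 3 * ly k w.
  under eq_bigr do rewrite gE.
  rewrite big_split /= -ip_rows sumr_const card_ord -[_ *+ n]mulr_natl mulVKf; last first.
    by rewrite pnatr_eq0 -lt0n ltnW.
  have := energy_ge f fstar hn hA hconn al0 be0 heta N0 N1 e12 (X k w) (V k w).
  have := opt_gap_ge0 hmin (X k w); have := ip_ge0 (Y k w).
  have := mulr_ge0 (ltW htau0) (ip_ge0 (E k w)).
  rewrite /ly /lyapunov.
  move: (ip _ _) (opt_gap _ _ _) (energy _ _ _ _ _ _) (ip (Y k w) _) (_ * ip _ _) => c o en y ee.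
  lra.
have mgs : measurable_fun setT (fun w => \sum_i g i w) by exact: measurable_sum.
have -> : (\sum_(i < n) 'E_P[g i] = \int[P]_w (\sum_i g i w)%:E)%E.
  under [RHS]eq_integral do rewrite -sumEFin.
  rewrite ge0_integral_sum// => [|i|i w _]; last by rewrite lee_fin.
    by apply: eq_bigr => i _; rewrite unlock.
  exact/measurable_EFinP.
have m3 : measurable_fun setT (fun w => 3 * ly k w).
  by apply: measurable_funM; [exact: measurable_cst|have [] := mly k].
have gs0 w : 0 <= \sum_i g i w by exact: sumr_ge0.
have h := integral_le_ge0 P mgs m3 gs0 g_le.
apply: le_trans h _.
rewrite integralZ_ge0//; last by have [] := mly k.
by rewrite -mulrA (mulrC M0) EFinM; apply: lee_wpmul2l => //; exact: decay.
Qed.
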